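(* (Second-order sufficient optimality conditions.) Let $(x^*,y^* )\in\mathbb{R}^n\times\mathbb{R}^m$ be a point around which $f,g,h$ are twice continuously differentiable and thrice continuously differentiable with respect to the variable $y$ (in the sense stated in the context) and $F,G,H$ are twice continuously differentiable. Assume that $(x^*,y^* )\in\Phi$ and $y^*\in Y(x^* )$. Let $(\mu^*,\xi^* )\in\mathbb{R}^r\times\mathbb{R}^s$ and suppose that Problem $(P_{x^*})$ satisfies the Jacobian uniqueness conditions at $(y^*,\mu^*,\xi^* )$. Write $u^*=(x^*,y^*,\mu^*,\xi^* )$. Then the following statements are equivalent: (i) $\Lambda(x^* )\ne\emptyset$, and for every $d_x\in\mathcal{C}(x^* )\setminus\{0\}$, $$\sup_{(\lambda_H^*,\lambda_G^* )\in\Lambda(x^* )}\left\{d_x^T\nabla^2_{xx}L^{SP}(x^*;\lambda_H^*,\lambda_G^* )d_x\right\}>0.$$ (ii) $\Lambda(x^*,y^*,\mu^*,\xi^* )\ne\emptyset$, and for every $d\in\mathcal{C}(x^*,y^*,\mu^*,\xi^* )\setminus\{0\}$, $$\sup_{\lambda^*\in\Lambda(x^*,y^*,\mu^*,\xi^* )}\left\{d^T\nabla^2_{uu}L^{FP}(u^*;\lambda^* )d\right\}>0.$$ Furthermore, if (i) or (ii) holds, there exist $\delta_2\in(0,\delta_1)$, $\varepsilon_2\in(0,\varepsilon_1)$ and $\gamma>0$ such that for every $x\in\boldsymbol{B}_{\delta_2}(x^* )$, with $y(x)=\operatorname{argmin}_y\{f(x,y):y\in Y(x)\cap\boldsymbol{B}_{\varepsilon_2}(y^*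 )\}$ and $(x,y(x))\in\Phi$, $$F(x,y(x))\ge F(x^*,y^* )+\gamma\|x-x^*\|^2,$$ and hence $(x^*,y^* )$ is a bi-local minimum point (bi-local solution) of (BP).
   Context: Data: $F,f:\mathbb{R}^n\times\mathbb{R}^m\to\mathbb{R}$, $H:\mathbb{R}^n\times\mathbb{R}^m\to\mathbb{R}^p$, $G:\mathbb{R}^n\times\mathbb{R}^m\to\mathbb{R}^q$, $h:\mathbb{R}^n\times\mathbb{R}^m\to\mathbb{R}^r$, $g:\mathbb{R}^n\times\mathbb{R}^m\to\mathbb{R}^s$. Let $\Phi=\{(x,y):H(x,y)=0,\ G(x,y)\le0\}$, $Y(x)=\{y\in\mathbb{R}^m:h(x,y)=0,\ g(x,y)\le0\}$, $I_G(x^*,y^* )=\{i:G_i(x^*,y^* )=0\}$. Problem $(P_x)$ is $\min_yf(x,y)$ s.t. $y\in Y(x)$, with solution set $S(x)$ and Lagrangian $\mathcal{L}(x;y,\mu,\xi)=f(x,y)+\mu^Th(x,y)+\xi^Tg(x,y)$. The bilevel problem (BP) is $\min F(x,y)$ s.t. $(x,y)\in\Phi$, $y\in S(x)$. $\|\cdot\|$ is the Euclidean norm, $\mathcal{J}$ denotes Jacobians, $\boldsymbol{B}_\delta(z)$ the closed Euclidean ball, $\Pi_{\mathbb{R}^s_-}$ the Euclidean projection onto the nonpositive orthant of $\mathbb{R}^s$ (smooth near vectors with no zero component); $u\perp v$ means $u^Tv=0$. Smoothness convention: ''twice continuously differentiable and thrice continuously differentiable with respect to $y$ around $(x^*,y^*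 )$'' means that in a neighbourhood of $(x^*,y^* )$ the functions $f,g,h$ are $C^2$ and $\nabla_yf,\mathcal{J}_yg,\mathcal{J}_yh$ are $C^2$ as functions of $(x,y)$. Bi-local (optimal) solution of (BP): a point $(x^*,y^* )$ with $(x^*,y^* )\in\Phi$ and $y^*\in Y(x^* )$ for which there exist $\delta_0>0$ and a function $\eta:(0,\delta_0]\to(0,\infty)$ with $\eta(\delta)\to0$ as $\delta\to0$ such that for every $\delta\in(0,\delta_0]$: (a) $f(x^*,y^* )\le f(x^*,z)$ for all $z\in Y(x^* )\cap\boldsymbol{B}_{\eta(\delta)}(y^* )$; and (b) for every $(x,y)\in\Phi\cap[\boldsymbol{B}_\delta(x^* )\times\boldsymbol{B}_{\eta(\delta)}(y^* )]$ satisfying $y\in\operatorname{argmin}_z\{f(x,z):z\in Y(x)\cap\boldsymbol{B}_{\eta(\delta)}(y^* )\}$ one has $F(x^*,y^* )\le F(x,y)$. Jacobian uniqueness conditions of $(P_{x})$ at $(y,\mu,\xi)\in\mathbb{R}^m\times\mathbb{R}^r\times\mathbb{R}^s$: (a) KKT: $\nabla_y\mathcal{L}(x;y,\mu,\xi)=0$, $h(x,y)=0$, $\xi\ge0$, $g(x,y)\le0$, $\xi^Tg(x,y)=0$; (b) LICQ: the vectors $\nabla_yh_j(x,y)$, $j=1,\dots,r$, and $\nabla_yg_i(x,y)$, $i\in I_x(y):=\{i:g_i(x,y)=0\}$, are linearly independent; (c) strict complementarity: $\xi_i-g_i(x,y)>0$ for $i=1,\dots,s$; (d) second-order sufficiency: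 $\langle\nabla^2_{yy}\mathcal{L}(x;y,\mu,\xi)d_y,d_y\rangle>0$ for every nonzero $d_y$ in the critical cone $\{d_y\in\mathbb{R}^m:\mathcal{J}_yh(x,y)d_y=0,\ \nabla_yg_i(x,y)^Td_y\le0\ (i\in I_x(y)),\ \nabla_yf(x,y)^Td_y\le0\}$. Under these hypotheses (Robinson's theorem and the implicit function theorem) there are $\delta_1>0$, $\varepsilon_1>0$ and a twice continuously differentiable mapping $(y,\mu,\xi):\boldsymbol{B}_{\delta_1}(x^* )\to\boldsymbol{B}_{\varepsilon_1}(y^* )\times\boldsymbol{B}_{\varepsilon_1}(\mu^* )\times\boldsymbol{B}_{\varepsilon_1}(\xi^* )$ with value $(y^*,\mu^*,\xi^* )$ at $x^*$ such that the Jacobian uniqueness conditions of $(P_x)$ hold at $(y(x),\mu(x),\xi(x))$ for all $x\in\boldsymbol{B}_{\delta_1}(x^* )$. The constants $\delta_1,\varepsilon_1$ in the claim and the function $y(\cdot)$ in (SP) and $L^{SP}$ are these. Problem (SP) (considered for $x$ near $x^*$): $\min_xF(x,y(x))$ s.t. $H(x,y(x))=0$, $G(x,y(x))\le0$. Problem (FP): $\min_{x,y,\mu,\xi}F(x,y)$ s.t. $H(x,y)=0$, $G(x,y)\le0$, $\nabla_y\mathcal{L}(x;y,\mu,\xi)=0$, $h(x,y)=0$, $g(x,y)-\Pi_{\mathbb{R}^s_-}(g(x,y)+\xi)=0$. Lagrangians: $L^{SP}(x;\lambda_H,\lambda_G)=F(x,y(x))+\lambda_H^TH(x,y(x))+\lambda_G^TG(x,y(x))$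 and, for $u=(x,y,\mu,\xi)$, $\lambda=(\lambda_H,\lambda_G,\lambda_{\mathcal{L}},\lambda_h,\lambda_g)\in\mathbb{R}^p\times\mathbb{R}^q\times\mathbb{R}^m\times\mathbb{R}^r\times\mathbb{R}^s$, $$L^{FP}(u;\lambda)=F(x,y)+\lambda_H^TH(x,y)+\lambda_G^TG(x,y)+\lambda_{\mathcal{L}}^T\nabla_y\mathcal{L}(x;y,\mu,\xi)+\lambda_h^Th(x,y)+\lambda_g^T\big(g(x,y)-\Pi_{\mathbb{R}^s_-}(g(x,y)+\xi)\big).$$ Multiplier sets: $\Lambda(x^* )$ is the set of $(\lambda_H,\lambda_G)$ with $\nabla_xL^{SP}(x^*;\lambda_H,\lambda_G)=0$, $H(x^*,y^* )=0$, $0\le\lambda_G\perp G(x^*,y^* )\le0$. $\Lambda(x^*,y^*,\mu^*,\xi^* )$ is the set of $\lambda$ with $\nabla_uL^{FP}(u^*;\lambda)=0$, $H(x^*,y^* )=0$, $0\le\lambda_G\perp G(x^*,y^* )\le0$, $\nabla_y\mathcal{L}(x^*;y^*,\mu^*,\xi^* )=0$, $h(x^*,y^* )=0$, $g(x^*,y^* )-\Pi_{\mathbb{R}^s_-}(g(x^*,y^* )+\xi^* )=0$. Critical cones (derivatives of $F,G,H$ at $(x^*,y^* )$): $\mathcal{C}(x^* )$ is the set of $d_x\in\mathbb{R}^n$ with $(\mathcal{J}_xH+\mathcal{J}_yH\,\mathcal{J}y(x^* ))d_x=0$, $(\nabla_xG_i^T+\nabla_yG_i^T\mathcal{J}y(x^*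 ))d_x\le0$ for $i\in I_G(x^*,y^* )$, and $(\nabla_xF^T+\nabla_yF^T\mathcal{J}y(x^* ))d_x\le0$. $\mathcal{C}(x^*,y^*,\mu^*,\xi^* )$ is the set of $d=(d_x,d_y,d_\mu,d_\xi)\in\mathbb{R}^{n+m+r+s}$ with $Ad=0$, $\nabla_xG_i^Td_x+\nabla_yG_i^Td_y\le0$ for $i\in I_G(x^*,y^* )$, and $\nabla_xF^Td_x+\nabla_yF^Td_y\le0$, where, with $W^*=\mathcal{J}\Pi_{\mathbb{R}^s_-}(g(x^*,y^* )+\xi^* )$ and all functions evaluated at $(x^*,y^*,\mu^*,\xi^* )$, $$A=\begin{bmatrix}\mathcal{J}_xH&\mathcal{J}_yH&0&0\\ \nabla^2_{yx}\mathcal{L}&\nabla^2_{yy}\mathcal{L}&\mathcal{J}_yh^T&\mathcal{J}_yg^T\\ \mathcal{J}_xh&\mathcal{J}_yh&0&0\\ (I-W^* )\mathcal{J}_xg&(I-W^* )\mathcal{J}_yg&0&-W^*\end{bmatrix}.$$ *)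

(* Defs.v *)
From HB Require Import structures.
From mathcomp Require Import all_boot all_order all_algebra.
From mathcomp Require Import all_classical all_reals all_analysis.

Set Implicit Arguments.
Unset Strict Implicit.
Unset Printing Implicit Defensive.

Import Order.TTheory GRing.Theory Num.Theory.
Import numFieldNormedType.Exports.

Local Open Scope classical_set_scope.
Local Open Scope ring_scope.

Section Euclidean.
Context {R : realType}.
Implicit Types k : nat.

Definition dotv k (u v : 'cV[R]_k) : R := (u^T *m v) 0 0.

(* The norm of ['cV[R]_k] in the library is the sup norm; it is only used here
   through the topology it induces. *)
Definition enorm k (v : 'cV[R]_k) : R := Num.sqrt (dotv v v).

Definition cball k (z : 'cV[R]_k) (e : R) : set 'cV[R]_k :=
  [set w | enorm (w - z) <= e].

Definition nonneg k (v : 'cV[R]_k) : Prop := forall i, 0 <= v i 0.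
Definition nonpos k (v : 'cV[R]_k) : Prop := forall i, v i 0 <= 0.

Definition quad_form k (M : 'M[R]_k) (d : 'cV[R]_k) : R := (d^T *m M *m d) 0 0.

Definition argmin (T : Type) (f : T -> R) (C : set T) : set T :=
  [set z | C z /\ forall w, C w -> f z <= f w].

Definition proj k (C : set 'cV[R]_k) (v : 'cV[R]_k) : 'cV[R]_k :=
  get (argmin (fun w => enorm (v - w)) C).

Definition proj_nonpos k : 'cV[R]_k -> 'cV[R]_k := proj [set w | nonpos w].

End Euclidean.

Section Calculus.
Context {R : realType}.
Implicit Types k l : nat.

Definition grad k (f : 'cV[R]_k -> R) (x : 'cV[R]_k) : 'cV[R]_k :=
  \col_j 'D_(delta_mx j 0) f x.

Definition jac k l (f : 'cV[R]_k -> 'cV[R]_l) (x : 'cV[R]_k) : 'M[R]_(l, k) :=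
  \matrix_(i, j) 'D_(delta_mx j 0) (fun z => f z i 0) x.

Definition hess k (f : 'cV[R]_k -> R) : 'cV[R]_k -> 'M[R]_k := jac (grad f).

(* [f] is of class C^k on the open set [A].  The spaces below are all
   finite-dimensional, so that C^(k+1) amounts to differentiability together
   with directional derivatives of class C^k in every direction. *)
Fixpoint Ck_on (V W : normedModType R) (k : nat) (A : set V) (f : V -> W) :
    Prop :=
  match k with
  | 0 => forall x, A x -> {for x, continuous f}
  | k'.+1 => (forall x, A x -> differentiable f x) /\
             (forall v, Ck_on k' A (fun x => 'D_v f x))
  end.

Definition C2_around (V W : normedModType R) (z : V) (f : V -> W) : Prop :=
  exists2 U : set V, open_nbhs z U & Ck_on 2 U f.

End Calculus.

(* Upper level: objective F, constraints H = 0 and G <= 0.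
   Lower level: objective f, constraints h = 0 and g <= 0. *)
Record bilevel (R : realType) (n m p q r s : nat) := Bilevel {
  bF : 'cV[R]_n -> 'cV[R]_m -> R;
  bf : 'cV[R]_n -> 'cV[R]_m -> R;
  bH : 'cV[R]_n -> 'cV[R]_m -> 'cV[R]_p;
  bG : 'cV[R]_n -> 'cV[R]_m -> 'cV[R]_q;
  bh : 'cV[R]_n -> 'cV[R]_m -> 'cV[R]_r;
  bg : 'cV[R]_n -> 'cV[R]_m -> 'cV[R]_s }.

Section Bilevel.
Context {R : realType} {n m p q r s : nat}.
Variable P : bilevel R n m p q r s.

Local Notation F := (bF P).
Local Notation f := (bf P).
Local Notation H := (bH P).
Local Notation G := (bG P).
Local Notation h := (bh P).
Local Notation g := (bg P).

Definition smooth_around (x : 'cV[R]_n) (y : 'cV[R]_m) : Prop :=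
  [/\ [/\ C2_around (x, y) (fun z => f z.1 z.2),
          C2_around (x, y) (fun z => g z.1 z.2) &
          C2_around (x, y) (fun z => h z.1 z.2)],
      [/\ C2_around (x, y) (fun z => grad (f z.1) z.2),
          C2_around (x, y) (fun z => jac (g z.1) z.2) &
          C2_around (x, y) (fun z => jac (h z.1) z.2)] &
      [/\ C2_around (x, y) (fun z => F z.1 z.2),
          C2_around (x, y) (fun z => G z.1 z.2) &
          C2_around (x, y) (fun z => H z.1 z.2)]].

Definition Phi : set ('cV[R]_n * 'cV[R]_m) :=
  [set z | H z.1 z.2 = 0 /\ nonpos (G z.1 z.2)].

Definition Y (x : 'cV[R]_n) : set 'cV[R]_m :=
  [set y | h x y = 0 /\ nonpos (g x y)].

Definition bilocal_solution (xs : 'cV[R]_n) (ys : 'cV[R]_m) : Prop :=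
  [/\ Phi (xs, ys), Y xs ys &
   exists (delta0 : R) (eta : R -> R),
   [/\ 0 < delta0,
       (forall delta, 0 < delta <= delta0 -> 0 < eta delta),
       eta delta @[delta --> 0^'+] --> 0 &
       forall delta, 0 < delta <= delta0 ->
         (forall z, (Y xs `&` cball ys (eta delta)) z -> f xs ys <= f xs z) /\
         (forall x y, Phi (x, y) -> cball xs delta x ->
            cball ys (eta delta) y ->
            argmin (f x) (Y x `&` cball ys (eta delta)) y ->
            F xs ys <= F x y)]].

Definition lagr (x : 'cV[R]_n) (y : 'cV[R]_m) (mu : 'cV[R]_r) (xi : 'cV[R]_s)
    : R :=
  f x y + dotv mu (h x y) + dotv xi (g x y).

Definition grad_y_lagr x y mu xi : 'cV[R]_m := grad (fun z => lagr x z mu xi) y.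

Definition lower_critical_cone x y : set 'cV[R]_m :=
  [set d | [/\ jac (h x) y *m d = 0,
      (forall i, g x y i 0 = 0 -> dotv (grad (fun z => g x z i 0) y) d <= 0) &
      dotv (grad (f x) y) d <= 0]].

Definition jacobian_uniqueness x y mu xi : Prop :=
  [/\ [/\ grad_y_lagr x y mu xi = 0, h x y = 0, nonneg xi, nonpos (g x y) &
          dotv xi (g x y) = 0],
      free ([seq grad (fun z => h x z j 0) y | j <- enum 'I_r] ++
            [seq grad (fun z => g x z i 0) y | i <- enum 'I_s & g x y i 0 == 0]),
      (forall i, 0 < xi i 0 - g x y i 0) &
      (forall d, lower_critical_cone x y d -> d != 0 ->
         0 < quad_form (hess (fun z => lagr x z mu xi) y) d)].

(* Functions are total, so the C^2 requirement is imposed on the interior of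
   the ball only. *)
Definition kkt_map (xs : 'cV[R]_n) (ys : 'cV[R]_m) (mus : 'cV[R]_r)
    (xis : 'cV[R]_s) (delta1 eps1 : R) (y : 'cV[R]_n -> 'cV[R]_m)
    (mu : 'cV[R]_n -> 'cV[R]_r) (xi : 'cV[R]_n -> 'cV[R]_s) : Prop :=
  [/\ 0 < delta1 /\ 0 < eps1,
      [/\ y xs = ys, mu xs = mus & xi xs = xis],
      [/\ Ck_on 2 [set x | enorm (x - xs) < delta1] y,
          Ck_on 2 [set x | enorm (x - xs) < delta1] mu &
          Ck_on 2 [set x | enorm (x - xs) < delta1] xi] &
      forall x, cball xs delta1 x ->
        [/\ cball ys eps1 (y x), cball mus eps1 (mu x), cball xis eps1 (xi x) &
            jacobian_uniqueness x (y x) (mu x) (xi x)]].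

Definition lagr_SP (y : 'cV[R]_n -> 'cV[R]_m) (lam : 'cV[R]_p * 'cV[R]_q)
    (x : 'cV[R]_n) : R :=
  F x (y x) + dotv lam.1 (H x (y x)) + dotv lam.2 (G x (y x)).

Definition mult_SP (y : 'cV[R]_n -> 'cV[R]_m) (xs : 'cV[R]_n) :
    set ('cV[R]_p * 'cV[R]_q) :=
  [set lam | [/\ grad (lagr_SP y lam) xs = 0, H xs (y xs) = 0, nonneg lam.2,
                 dotv lam.2 (G xs (y xs)) = 0 & nonpos (G xs (y xs))]].

Definition crit_SP (y : 'cV[R]_n -> 'cV[R]_m) (xs : 'cV[R]_n) :
    set 'cV[R]_n :=
  let ys := y xs in
  [set d |
    [/\ (jac (H^~ ys) xs + jac (H xs) ys *m jac y xs) *m d = 0,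
        (forall i, G xs ys i 0 = 0 ->
          (((grad (fun x => G x ys i 0) xs)^T +
            (grad (fun z => G xs z i 0) ys)^T *m jac y xs) *m d) 0 0 <= 0) &
        (((grad (F^~ ys) xs)^T + (grad (F xs) ys)^T *m jac y xs) *m d) 0 0
          <= 0]].

Definition SOSC_SP (y : 'cV[R]_n -> 'cV[R]_m) (xs : 'cV[R]_n) : Prop :=
  mult_SP y xs !=set0 /\
  forall d, crit_SP y xs d -> d != 0 ->
    (0 < ereal_sup [set (quad_form (hess (lagr_SP y lam) xs) d)%:E
                   | lam in mult_SP y xs])%E.

(* The variable u = (x, y, mu, xi) of (FP) is a single column vector. *)
Local Notation FPvar := 'cV[R]_(n + (m + (r + s))).

Definition pack (x : 'cV[R]_n) (y : 'cV[R]_m) (mu : 'cV[R]_r) (xi : 'cV[R]_s) :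
    FPvar :=
  col_mx x (col_mx y (col_mx mu xi)).
Definition ux (u : FPvar) : 'cV[R]_n := usubmx u.
Definition uy (u : FPvar) : 'cV[R]_m := usubmx (dsubmx u).
Definition umu (u : FPvar) : 'cV[R]_r := usubmx (dsubmx (dsubmx u)).
Definition uxi (u : FPvar) : 'cV[R]_s := dsubmx (dsubmx (dsubmx u)).

Definition stat_FP (u : FPvar) : 'cV[R]_m :=
  grad_y_lagr (ux u) (uy u) (umu u) (uxi u).

Definition compl_FP (u : FPvar) : 'cV[R]_s :=
  g (ux u) (uy u) - proj_nonpos (g (ux u) (uy u) + uxi u).

Record FPmult := FPMult {
  lam_H : 'cV[R]_p;
  lam_G : 'cV[R]_q;
  lam_L : 'cV[R]_m;
  lam_h : 'cV[R]_r;
  lam_g : 'cV[R]_s }.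

Definition lagr_FP (lam : FPmult) (u : FPvar) : R :=
  F (ux u) (uy u) + dotv (lam_H lam) (H (ux u) (uy u))
  + dotv (lam_G lam) (G (ux u) (uy u)) + dotv (lam_L lam) (stat_FP u)
  + dotv (lam_h lam) (h (ux u) (uy u)) + dotv (lam_g lam) (compl_FP u).

Definition mult_FP (us : FPvar) : set FPmult :=
  let xs := ux us in let ys := uy us in
  [set lam |
    [/\ grad (lagr_FP lam) us = 0,
        H xs ys = 0,
        [/\ nonneg (lam_G lam), dotv (lam_G lam) (G xs ys) = 0 &
            nonpos (G xs ys)],
        stat_FP us = 0 &
        h xs ys = 0 /\ compl_FP us = 0]].

Definition A_FP (us : FPvar) :
    'M[R]_(p + (m + (r + s)), n + (m + (r + s))) :=
  let xs := ux us in let ys := uy us in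
  let mus := umu us in let xis := uxi us in
  let W := jac (@proj_nonpos R s) (g xs ys + xis) in
  let Jxg := jac (g^~ ys) xs in
  let Jyg := jac (g xs) ys in
  let Jxh := jac (h^~ ys) xs in
  let Jyh := jac (h xs) ys in
  col_mx
    (row_mx (jac (H^~ ys) xs)
      (row_mx (jac (H xs) ys) (row_mx 0 0)))
 (col_mx
    (row_mx (jac (fun x => grad_y_lagr x ys mus xis) xs)
      (row_mx (hess (fun z => lagr xs z mus xis) ys) (row_mx Jyh^T Jyg^T)))
 (col_mx
    (row_mx Jxh (row_mx Jyh (row_mx 0 0)))
    (row_mx ((1%:M - W) *m Jxg)
      (row_mx ((1%:M - W) *m Jyg) (row_mx 0 (- W)))))).

Definition crit_FP (us : FPvar) : set FPvar :=
  let xs := ux us in let ys := uy us in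
  [set d |
    [/\ A_FP us *m d = 0,
        (forall i, G xs ys i 0 = 0 ->
          dotv (grad (fun x => G x ys i 0) xs) (ux d) +
          dotv (grad (fun z => G xs z i 0) ys) (uy d) <= 0) &
        dotv (grad (F^~ ys) xs) (ux d) + dotv (grad (F xs) ys) (uy d) <= 0]].

Definition SOSC_FP (us : FPvar) : Prop :=
  mult_FP us !=set0 /\
  forall d, crit_FP us d -> d != 0 ->
    (0 < ereal_sup [set (quad_form (hess (lagr_FP lam) us) d)%:E
                   | lam in mult_FP us])%E.

Definition SP_growth (xs : 'cV[R]_n) (ys : 'cV[R]_m)
    (y : 'cV[R]_n -> 'cV[R]_m) (delta2 eps2 gamma : R) : Prop :=
  forall x, cball xs delta2 x ->
    argmin (f x) (Y x `&` cball ys eps2) = [set y x] /\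
    (Phi (x, y x) -> F xs ys + gamma * enorm (x - xs) ^+ 2 <= F x (y x)).

End Bilevel.

(* Main.v *)
Require Import Defs.
From HB Require Import structures.
From mathcomp Require Import all_boot all_order all_algebra.
From mathcomp Require Import ring lra.
From mathcomp Require Import all_classical all_reals all_analysis.

Set Implicit Arguments.
Unset Strict Implicit.
Unset Printing Implicit Defensive.

Import Order.TTheory GRing.Theory Num.Theory.
Import numFieldNormedType.Exports.

Local Open Scope classical_set_scope.
Local Open Scope ring_scope.

(** The complementarity condition is the only nonsmooth part of the lower-level
    KKT conditions. Under strict complementarity it is locally equivalent to
    [g_i = 0] for the constraints active at the base point and [xi_i = 0] for
    the others, so near [us = (xs, ys, mus, xis)] the KKT conditions are a
    smooth square system [E (x, w) = 0] in [w = (y, mu, xi)] ([kkt_system]).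
    LICQ and the second-order condition say that the partial derivative of [E]
    in [w] is invertible ([kkt_unit]). The implicit function theorem then gives
    the C^2 KKT map [x |-> w x] ([implicit_function], [kkt_map_exists]), along
    which the Jacobian uniqueness conditions persist
    ([near_jacobian_uniqueness]).

    Equivalence of the two second-order conditions. The projection onto the
    orthant is linear near [g + xi], so the lower-level constraints of (FP) are
    [E = 0] there, and [lagr_FP] is an upper-level Lagrangian plus
    [dotv lam (E u)]. Write [W x = (x, w x)]. As [E] vanishes on the graph of
    [w], [lagr_SP] is [lagr_FP] composed with [W] ([near_lagr_SP]). Three facts
    follow. The kernel of the derivative of [E] is the tangent space of the
    graph, whence [d |-> W' d] is a bijection between the critical cones
    ([crit_FPP]). The multiplier of [E] is the unique solution of a linear
    system with matrix the transpose of the derivative of [E] in [w], so the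
    multiplier sets correspond to each other ([mult_FP_SP], [mult_SP_FP]).
    Finally, the gradient of [lagr_FP] vanishes at [us], so the second
    derivative of [W] does not enter the chain rule, and the two quadratic forms
    agree along [W' d] ([hess_lagr_SP]).

    Growth. Each direction of the unit sphere either leaves the feasible set or
    increases the objective to first order, or else lies in the critical cone,
    where some Lagrangian has positive curvature. Each alternative persists for
    nearby directions, nearby points and nearby parameters, and the sphere is
    compact: this gives quadratic growth uniformly in a parameter
    ([parametric_growth], [constrained_growth]). Applied to the lower level,
    with parameter [x] and the Lagrangian at the multipliers of [x], it shows
    that [y x] is the only minimizer on a ball of radius independent of [x]
    ([lower_growth], [argmin_near]). Applied to (SP) with [lagr_SP], it gives
    the growth of the upper-level objective ([upper_growth]). Since [y] is
    Lipschitz at [xs] with some constant [K], the choice [eta delta = K * delta]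
    keeps [y x] in the ball of radius [eta delta] for all [x] in the ball of
    radius [delta]; this yields bi-local optimality. *)

(** * Differentials and functions of class C^k *)

Section Differentials.
Context {R : realType}.
Implicit Types V W U : normedModType R.

Lemma ler_norm_convex V (u : R) (x y : V) : 0 <= u <= 1 ->
  `|u *: x + (1 - u) *: y| <= Num.max `|x| `|y|.
Proof.
move=> /andP[u0 u1]; apply: le_trans (ler_normD _ _) _.
rewrite !normrZ (ger0_norm u0) ger0_norm ?subr_ge0 //.
rewrite -[leRHS]mul1r -[in leRHS](subrK u 1) [leRHS]mulrDl addrC lerD //.
  by rewrite ler_wpM2l ?subr_ge0 // le_max lexx orbT.
by rewrite ler_wpM2l // le_max lexx.
Qed.

(** The epsilon form of differentiability lets the derivative of an implicit
    function be checked by hand, its increments being known only through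
    inequalities. *)
Lemma is_diff_eps V W (f : V -> W) (x : V) (L : {linear V -> W}) :
  continuous L ->
  (forall e, 0 < e ->
     \forall h \near (0 : V), `|f (h + x) - f x - L h| <= e * `|h|) ->
  is_diff x f L.
Proof.
move=> Lc fL.
have fE : f \o shift x = cst (f x) + L +o_ (0 : V) id.
  apply/eqaddoP => e e0; near=> h => /=.
  rewrite [leLHS](_ : _ = `|f (h + x) - f x - L h|);
    first by near: h; exact: fL.
  by congr (`|_|); rewrite !fctE /= opprD addrA.
have dL : 'd f x = L :> (V -> W) by exact: diff_unique.
by apply: DiffDef => //; apply/diff_locallyP; rewrite dL.
Unshelve. all: by end_near. Qed.

Lemma differentiable_eps V W (f : V -> W) (x : V) : differentiable f x ->
  forall e, 0 < e ->
     \forall h \near (0 : V), `|f (h + x) - f x - 'd f x h| <= e * `|h|.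
Proof.
move=> /diff_locallyP [_ /eqaddoP fL] e e0; near=> h.
have : `|(f \o shift x - (cst (f x) + 'd f x)) h| <= e * `|h|.
  by near: h; exact: fL.
by congr (`|_| <= _); rewrite !fctE /= opprD addrA.
Unshelve. all: by end_near. Qed.

Lemma near_shift0 V (x : V) (P : set V) : (\forall z \near x, P z) ->
  \forall h \near (0 : V), P (h + x).
Proof.
move=> Px; have hx : (fun h => h + x) @ (0 : V) --> x.
  by rewrite -[X in _ --> X]add0r; apply: cvgD; [exact: cvg_id|exact: cvg_cst].
exact: (hx _ Px).
Qed.

Lemma near_eq_differentiable V W (f g : V -> W) (x : V) :
  (\forall z \near x, f z = g z) -> differentiable f x -> differentiable g x.
Proof.
move=> fg df.
suff : is_diff x g ('d f x) by move=> /@ex_diff.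
apply: is_diff_eps; first exact: diff_continuous.
move=> e e0; have fgx := nbhs_singleton fg.
have fg0 := near_shift0 fg.
near=> h; rewrite -fgx -(near fg0 h) //; near: h; exact: differentiable_eps.
Unshelve. all: by end_near. Qed.

Lemma derive_comp U V W (f : U -> V) (g : V -> W) (x v : U) :
  differentiable f x -> differentiable g (f x) ->
  'D_v (fun z => g (f z)) x = 'D_('D_v f x) g (f x).
Proof.
move=> fd gd; rewrite deriveE; last exact: differentiable_comp.
by rewrite -[fun z => g (f z)]/(g \o f) diff_comp //= -!deriveE.
Qed.

End Differentials.

Section CkOn.
Context {R : realType}.
Implicit Types (k : nat) (V W U : normedModType R).

Lemma Ck_on_ext k V W (A : set V) (f g : V -> W) : open A ->
  (forall x, A x -> f x = g x) -> Ck_on k A f -> Ck_on k A g.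
Proof.
move=> oA; elim: k f g => [|k IH] f g fg /=.
  move=> fc x Ax; rewrite /prop_for /continuous_at -fg //.
  apply: cvg_trans (fc x Ax); apply: near_eq_cvg.
  by near=> z; apply: fg; near: z; exact: open_nbhs_nbhs.
move=> [fd fD].
have fg' x : A x -> \forall z \near x, f z = g z.
  by move=> Ax; near=> z; apply: fg; near: z; exact: open_nbhs_nbhs.
split=> [x Ax|v]; first exact: near_eq_differentiable (fg' x Ax) (fd x Ax).
by apply: IH (fD v) => x Ax; exact: near_eq_derive (fg' x Ax).
Unshelve. all: by end_near. Qed.

Lemma Ck_onS k V W (A : set V) (f : V -> W) : Ck_on k.+1 A f -> Ck_on k A f.
Proof.
elim: k f => [|k IH] f /= [fd fD].
  by move=> x Ax; apply: differentiable_continuous; exact: fd.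
by split=> // v; apply: IH; exact: fD.
Qed.

Lemma Ck_on_le k l V W (A : set V) (f : V -> W) : (k <= l)%N ->
  Ck_on l A f -> Ck_on k A f.
Proof.
elim: l => [|l IH]; first by rewrite leqn0 => /eqP ->.
by rewrite leq_eqVlt => /predU1P[-> //|/IH {}IH] /Ck_onS.
Qed.

Lemma Ck_on_sub k V W (A B : set V) (f : V -> W) : A `<=` B ->
  Ck_on k B f -> Ck_on k A f.
Proof.
move=> AB; elim: k f => [|k IH] f /=; first by move=> fc x /AB /fc.
by move=> [fd fD]; split=> [x /AB /fd //|v]; exact: IH.
Qed.

Lemma Ck_on_cst k V W (A : set V) (w : W) : Ck_on k A (fun=> w).
Proof.
elim: k w => [|k IH] w /=; first by move=> x _; exact: cst_continuous.
split=> [x _|v]; first exact: differentiable_cst.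
rewrite (_ : 'D_v _ = fun=> 0) //.
by apply/funext => x; rewrite derive_cst.
Qed.

Lemma Ck_on_id k V (A : set V) : Ck_on k A (fun x => x).
Proof.
case: k => [x _ | k] /=; first exact: cvg_id.
split=> [x _ // |v]; rewrite (_ : 'D_v _ = fun=> v); first exact: Ck_on_cst.
by apply/funext => x; rewrite derive_id.
Qed.

Lemma Ck_onD k V W (A : set V) (f g : V -> W) : open A ->
  Ck_on k A f -> Ck_on k A g -> Ck_on k A (fun x => f x + g x).
Proof.
move=> oA; elim: k f g => [|k IH] f g /=.
  by move=> fc gc x Ax; apply: cvgD; [exact: fc|exact: gc].
move=> [fd fD] [gd gD]; split=> [x Ax|v].
  exact: differentiableD (fd _ Ax) (gd _ Ax).
apply: Ck_on_ext oA _ (IH _ _ (fD v) (gD v)) => x Ax.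
by rewrite -deriveD //; apply: diff_derivable; [exact: fd|exact: gd].
Qed.

Lemma Ck_onM k V (A : set V) (f g : V -> R) : open A ->
  Ck_on k A f -> Ck_on k A g -> Ck_on k A (fun x => f x * g x).
Proof.
move=> oA; elim: k f g => [|k IH] f g /=.
  by move=> fc gc x Ax; apply: cvgM; [exact: fc|exact: gc].
move=> [fd fD] [gd gD]; split=> [x Ax|v].
  exact: differentiableM (fd _ Ax) (gd _ Ax).
have fk : Ck_on k A f by apply: Ck_onS.
have gk : Ck_on k A g by apply: Ck_onS.
apply: Ck_on_ext oA _ (Ck_onD oA (IH _ _ fk (gD v)) (IH _ _ gk (fD v))) => x Ax.
by rewrite (@deriveM _ _ f g) //; apply: diff_derivable; [exact: fd|exact: gd].
Qed.

Lemma Ck_on_sum k V W (A : set V) (I : Type) (r : seq I) (P : pred I)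
    (f : I -> V -> W) : open A ->
  (forall i, P i -> Ck_on k A (f i)) ->
  Ck_on k A (fun x => \sum_(i <- r | P i) f i x).
Proof.
move=> oA fk; elim: r => [|i r IH].
  by apply: Ck_on_ext oA _ (Ck_on_cst k A 0) => x _; rewrite big_nil.
have [Pi|Pi] := boolP (P i).
  apply: Ck_on_ext oA _ (Ck_onD oA (fk i Pi) IH) => x _.
  by rewrite big_cons Pi.
by apply: Ck_on_ext oA _ IH => x _; rewrite big_cons (negbTE Pi).
Qed.

Lemma Ck_on_prod k V (A : set V) (I : Type) (r : seq I) (P : pred I)
    (f : I -> V -> R) : open A ->
  (forall i, P i -> Ck_on k A (f i)) ->
  Ck_on k A (fun x => \prod_(i <- r | P i) f i x).
Proof.
move=> oA fk; elim: r => [|i r IH].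
  by apply: Ck_on_ext oA _ (@Ck_on_cst k V R A 1) => x _; rewrite big_nil.
have [Pi|Pi] := boolP (P i).
  apply: Ck_on_ext oA _ (Ck_onM oA (fk i Pi) IH) => x _.
  by rewrite big_cons Pi.
by apply: Ck_on_ext oA _ IH => x _; rewrite big_cons (negbTE Pi).
Qed.

Lemma Ck_onV k V (A : set V) (f : V -> R) : open A ->
  (forall x, A x -> f x != 0) -> Ck_on k A f -> Ck_on k A (fun x => (f x)^-1).
Proof.
move=> oA f0; elim: k => [|k IH] /=.
  by move=> fc x Ax; apply: cvgV; [exact: f0|exact: fc].
move=> fk1; have {}IH := IH (Ck_onS fk1); move: fk1 => [fd fD].
split=> [x Ax|v]; first exact: (@differentiableV _ _ f _ (fd _ Ax) (f0 _ Ax)).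
apply: Ck_on_ext oA _
  (Ck_onM oA (Ck_onM oA (@Ck_on_cst k V R A (-1)) (Ck_onM oA IH IH))
    (fD v)) => x Ax.
rewrite (@deriveV _ _ f) ?f0 //; last by apply: diff_derivable; exact: fd.
by rewrite mulN1r -invfM -expr2.
Qed.

(** Composing on the inside with an affine map needs no coordinates: the
    directional derivatives of [f \o a] are those of [f] in other directions. *)
Lemma Ck_on_affine k U V W (A : set U) (B : set V) (a l : U -> V) (f : V -> W) :
  open A -> (forall x, is_diff x a l) -> (forall x, A x -> B (a x)) ->
  Ck_on k B f -> Ck_on k A (fun x => f (a x)).
Proof.
move=> oA al AB; elim: k f => [|k IH] f /=.
  move=> fc x Ax; apply: continuous_comp; last exact/fc/AB.
  by apply: differentiable_continuous; exact: ex_diff.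
have ad x : differentiable a x by exact: ex_diff.
move=> [fd fD]; split=> [x Ax|v].
  by apply: differentiable_comp; [exact: ad|exact/fd/AB].
apply: Ck_on_ext oA _ (IH _ (fD (l v))) => x Ax.
have fda := fd _ (AB _ Ax).
by rewrite (derive_comp _ (ad x) fda) (deriveE _ (ad x)) diff_val.
Qed.

Lemma continuous_mxP (T : topologicalType) m n (M : T -> 'M[R]_(m, n)) (x : T) :
  (forall i j, {for x, continuous (fun z => M z i j)}) -> {for x, continuous M}.
Proof.
move=> Mc; apply/cvgrPdist_le => e e0; near=> z.
rewrite [leLHS]/Num.Def.normr/= mx_normrE (bigmax_le _ (ltW e0))//= => i _.
rewrite !mxE; move: i; near: z; apply: filter_forall => i /=.
by have /cvgrPdist_le := Mc i.1 i.2; exact.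
Unshelve. all: by end_near. Qed.

Lemma differentiable_mxP V m n (M : V -> 'M[R]_(m, n)) (x : V) :
  (forall i j, differentiable (fun z => M z i j) x) -> differentiable M x.
Proof.
move=> Md.
rewrite (_ : M = \sum_(i < m) \sum_(j < n)
   (fun z => (M z i j) *: (delta_mx i j : 'M[R]_(m, n)))).
  apply: differentiable_sum => i; apply: differentiable_sum => j.
  exact: differentiableZl.
apply/funext => z; rewrite fct_sumE [LHS]matrix_sum_delta.
by apply: eq_bigr => i _; rewrite fct_sumE.
Qed.

Lemma differentiable_entry V m n (M : V -> 'M[R]_(m, n)) (x : V) i j :
  differentiable M x -> differentiable (fun z => M z i j : R) x.
Proof.
move=> Md.
apply: (@differentiable_comp _ _ _ _ M (fun N : 'M[R]_(m, n) =>
  N i j : R)) => //.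
exact: differentiable_coord.
Qed.

Lemma Ck_on_mxP k V m n (A : set V) (M : V -> 'M[R]_(m, n)) : open A ->
  (forall i j, Ck_on k A (fun x => M x i j)) <-> Ck_on k A M.
Proof.
move=> oA; split.
  elim: k M => [|k IH] M /= Mc.
    by move=> x Ax; apply: continuous_mxP => i j; exact: Mc.
  have Md x : A x -> differentiable M x.
    by move=> Ax; apply: differentiable_mxP => i j; have [+ _] := Mc i j; exact.
  split=> // v; apply: IH => i j; have [_ /(_ v)] := Mc i j.
  apply: Ck_on_ext oA _ => x Ax; rewrite derive_mx ?mxE //.
  exact/diff_derivable/Md.
elim: k M => [|k IH] M /= Mc i j.
  move=> x Ax; apply: (@continuous_comp _ _ _ M
    (fun N : 'M[R]_(m, n) => N i j)).
    exact: Mc.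
  exact: coord_continuous.
have [Md MD] := Mc; split=> [x Ax|v].
  exact/differentiable_entry/Md.
apply: Ck_on_ext oA _ (IH _ (MD v) i j) => x Ax; rewrite derive_mx ?mxE //.
exact/diff_derivable/Md.
Qed.

Lemma Ck_on_mulmx k V m n p (A : set V) (M : V -> 'M[R]_(m, n))
    (N : V -> 'M[R]_(n, p)) : open A ->
  Ck_on k A M -> Ck_on k A N -> Ck_on k A (fun x => M x *m N x).
Proof.
move=> oA /(Ck_on_mxP k M oA) Mk /(Ck_on_mxP k N oA) Nk.
apply/Ck_on_mxP => // i j.
have : Ck_on k A (fun x => \sum_l M x i l * N x l j).
  by apply: Ck_on_sum => // l _; apply: Ck_onM.
by apply: Ck_on_ext oA _ => x _; rewrite mxE.
Qed.

Lemma Ck_on_det k V n (A : set V) (M : V -> 'M[R]_n) : open A ->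
  Ck_on k A M -> Ck_on k A (fun x => \det (M x)).
Proof.
move=> oA /(Ck_on_mxP k M oA) Mk.
apply: Ck_on_sum => // s _; apply: Ck_onM => //; first exact: Ck_on_cst.
by apply: Ck_on_prod.
Qed.

(** Cramer's rule: the entries of the inverse are rational functions of those of
    the matrix. *)
Lemma Ck_on_invmx k V n (A : set V) (M : V -> 'M[R]_n) : open A ->
  (forall x, A x -> M x \in unitmx) ->
  Ck_on k A M -> Ck_on k A (fun x => invmx (M x)).
Proof.
move=> oA Mu Mk; apply/Ck_on_mxP => // i j.
have /(Ck_on_mxP k M oA) Mk' := Mk.
have dk : Ck_on k A (fun x => (\det (M x))^-1).
  apply: Ck_onV => //; last exact: Ck_on_det.
  by move=> x /Mu; rewrite unitmxE unitfE.
have cofk : Ck_on k A (fun x => cofactor (M x) j i).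
  apply: Ck_onM => //; first exact: Ck_on_cst.
  apply: Ck_on_det => //; apply/Ck_on_mxP => // a b.
  by apply: Ck_on_ext oA _ (Mk' (lift j a) (lift i b)) => x _; rewrite !mxE.
apply: Ck_on_ext oA _ (Ck_onM oA dk cofk) => x Ax.
by rewrite /invmx Mu // !mxE.
Qed.

(** Coordinates turn the derivative of a composite, whose direction varies with
    the point, into a finite sum of products of C^k functions. *)
Lemma deriveE_coord V k (f : 'cV[R]_k -> V) (x v : 'cV[R]_k) :
  differentiable f x -> 'D_v f x = \sum_i v i 0 *: 'D_(delta_mx i 0) f x.
Proof.
move=> fd; rewrite deriveE // {1}[v]matrix_sum_delta linear_sum.
apply: eq_bigr => i _; rewrite big_ord1 linearZ /= deriveE //.
Qed.

Lemma Ck_on_comp k V l (A : set V) (B : set 'cV[R]_l) (f : V -> 'cV[R]_l)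
    (g : 'cV[R]_l -> R) :
  open A -> (forall x, A x -> B (f x)) ->
  Ck_on k A f -> Ck_on k B g -> Ck_on k A (fun x => g (f x)).
Proof.
move=> oA AB; elim: k g => [|k IH] g /=.
  by move=> fc gc x Ax; apply: continuous_comp; [exact: fc|exact/gc/AB].
move=> fk; have {}IH := IH _ (Ck_onS fk); move: fk => [fd fD] [gd gD].
split=> [x Ax|v].
  by apply: differentiable_comp; [exact: fd|exact/gd/AB].
have : Ck_on k A (fun x => \sum_i ('D_v f x) i 0 * 'D_(delta_mx i 0) g (f x)).
  apply: Ck_on_sum => // i _; apply: Ck_onM => //; last exact: (IH _ (gD _)).
  by have /Ck_on_mxP := fD v; exact.
apply: Ck_on_ext oA _ => x Ax.
rewrite (derive_comp _ (fd _ Ax) (gd _ (AB _ Ax))) deriveE_coord //.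
exact/gd/AB.
Qed.

End CkOn.

Section CkAround.
Context {R : realType}.
Implicit Types (k : nat) (V W U : normedModType R).

(** At [k = 2] this unfolds to [C2_around]; the other orders are needed because
    every differentiation loses one. *)
Definition Ck_around k V W (z : V) (f : V -> W) : Prop :=
  exists2 A : set V, open_nbhs z A & Ck_on k A f.

(** Two functions of class C^k around [z] come with two different open sets; in
    terms of small radii their intersection is that of two filters. *)
Lemma Ck_aroundP k V W (z : V) (f : V -> W) :
  Ck_around k z f <-> \forall e \near 0^'+, Ck_on k (ball z e) f.
Proof.
split=> [[A [oA Az] fA]|fe].
  have /nbhs_ballP [e e0 eA] : nbhs z A by exact: open_nbhs_nbhs.
  near=> d; apply: Ck_on_sub fA => y /(le_ball _) dy; apply/eA/dy.
  by near: d; exact: nbhs_right_le.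
have [e [fe' e0]] : exists e, Ck_on k (ball z e) f /\ 0 < e.
  apply: (@filter_ex _ (0 : R)^'+); apply: filterI => //.
  exact: nbhs_right_gt.
by exists (ball z e) => //; split; [exact: ball_open|exact: ballxx].
Unshelve. all: by end_near. Qed.

Lemma Ck_on_around k V W (A : set V) (z : V) (f : V -> W) : open A -> A z ->
  Ck_on k A f -> Ck_around k z f.
Proof. by move=> oA Az fk; exists A. Qed.

Lemma Ck_around_near k V W (z : V) (f : V -> W) : Ck_around k z f ->
  \forall z' \near z, Ck_around k z' f.
Proof.
move=> [A oA fA]; near=> y; exists A => //; split; first by have [] := oA.
by near: y; exact: (open_nbhs_nbhs oA).
Unshelve. all: by end_near. Qed.

Lemma Ck_around_le k l V W (z : V) (f : V -> W) : (k <= l)%N ->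
  Ck_around l z f -> Ck_around k z f.
Proof. by move=> kl [A oA fA]; exists A => //; exact: Ck_on_le fA. Qed.

Lemma Ck_around_cont k V W (z : V) (f : V -> W) : Ck_around k z f ->
  {for z, continuous f}.
Proof. by move=> /(Ck_around_le (leq0n k)) [A [_ Az]] /(_ _ Az). Qed.

Lemma Ck_around_differentiable k V W (z : V) (f : V -> W) :
  Ck_around k.+1 z f -> differentiable f z.
Proof. by move=> [A [_ Az]] [/(_ _ Az)]. Qed.

Lemma Ck_around_near_differentiable k V W (z : V) (f : V -> W) :
  Ck_around k.+1 z f -> \forall y \near z, differentiable f y.
Proof.
by move=> /Ck_around_near; apply: filterS => y; exact: Ck_around_differentiable.
Qed.

Lemma Ck_around_derive k V W (z v : V) (f : V -> W) :
  Ck_around k.+1 z f -> Ck_around k z ('D_v f).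
Proof. by move=> [A oA [_ fA]]; exists A => //; exact: fA. Qed.

Lemma Ck_around_ext k V W (z : V) (f g : V -> W) :
  (\forall y \near z, f y = g y) -> Ck_around k z f -> Ck_around k z g.
Proof.
move=> /nbhs_ballP [e e0 fg] [A [oA Az] fA].
exists (A `&` ball z e).
  by split; [apply: openI => //; exact: ball_open|split=> //; exact: ballxx].
apply: (@Ck_on_ext _ _ _ _ _ f); first by apply: openI => //; exact: ball_open.
  by move=> x [_ /fg].
by apply: Ck_on_sub fA => x [].
Qed.

Lemma Ck_around_eq k V W (z : V) (f g : V -> W) :
  (forall y, f y = g y) -> Ck_around k z f -> Ck_around k z g.
Proof. by move=> /funext ->. Qed.

Lemma Ck_around_cst k V W (z : V) (w : W) : Ck_around k z (fun=> w).
Proof. by exists setT; [split=> //; exact: openT|exact: Ck_on_cst]. Qed.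

Lemma Ck_around_id k V (z : V) : Ck_around k z (fun x => x).
Proof. by exists setT; [split=> //; exact: openT|exact: Ck_on_id]. Qed.

Lemma Ck_aroundD k V W (z : V) (f g : V -> W) :
  Ck_around k z f -> Ck_around k z g -> Ck_around k z (fun x => f x + g x).
Proof.
move=> /Ck_aroundP fk /Ck_aroundP gk; apply/Ck_aroundP; near=> e.
by apply: Ck_onD; [exact: ball_open|near: e..].
Unshelve. all: by end_near. Qed.

Lemma Ck_aroundM k V (z : V) (f g : V -> R) :
  Ck_around k z f -> Ck_around k z g -> Ck_around k z (fun x => f x * g x).
Proof.
move=> /Ck_aroundP fk /Ck_aroundP gk; apply/Ck_aroundP; near=> e.
by apply: Ck_onM; [exact: ball_open|near: e..].
Unshelve. all: by end_near. Qed.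

Lemma Ck_around_sum k V W (z : V) (I : finType) (P : pred I)
    (f : I -> V -> W) : (forall i, P i -> Ck_around k z (f i)) ->
  Ck_around k z (fun x => \sum_(i | P i) f i x).
Proof.
move=> fk; apply/Ck_aroundP.
have fe : \forall e \near (0 : R)^'+, forall i, P i -> Ck_on k (ball z e) (f i).
  apply: filter_forall => i; have [Pi|Pi] := boolP (P i); last exact: nearW.
  by have /Ck_aroundP := fk i Pi; apply: filterS.
near=> e; apply: Ck_on_sum; first exact: ball_open.
by near: e.
Unshelve. all: by end_near. Qed.

Lemma Ck_around_mxP k V m n (z : V) (M : V -> 'M[R]_(m, n)) :
  (forall i j, Ck_around k z (fun x => M x i j)) <-> Ck_around k z M.
Proof.
split=> [Mk|[A [oA Az] /(Ck_on_mxP k _ oA) Mk] i j]; last by exists A.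
apply/Ck_aroundP.
have fe : \forall e \near (0 : R)^'+, forall ij : 'I_m * 'I_n,
    Ck_on k (ball z e) (fun x => M x ij.1 ij.2).
  by apply: filter_forall => ij; apply/Ck_aroundP.
near=> e; apply/Ck_on_mxP; first exact: ball_open.
move=> i j; have := near fe e; move=> H; exact: (H _ (i, j)).
Unshelve. all: by end_near. Qed.

Lemma Ck_around_mulmx k V m n p (z : V) (M : V -> 'M[R]_(m, n))
    (N : V -> 'M[R]_(n, p)) :
  Ck_around k z M -> Ck_around k z N -> Ck_around k z (fun x => M x *m N x).
Proof.
move=> /Ck_aroundP fk /Ck_aroundP gk; apply/Ck_aroundP; near=> e.
by apply: Ck_on_mulmx; [exact: ball_open|near: e..].
Unshelve. all: by end_near. Qed.

Lemma Ck_around_tr k V m n (z : V) (M : V -> 'M[R]_(m, n)) :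
  Ck_around k z M -> Ck_around k z (fun x => (M x)^T).
Proof.
move=> /Ck_around_mxP Mk; apply/Ck_around_mxP => i j.
by apply: Ck_around_eq (Mk j i) => y; rewrite mxE.
Qed.

Lemma Ck_around_dotv k V l (z : V) (f g : V -> 'cV[R]_l) :
  Ck_around k z f -> Ck_around k z g ->
  Ck_around k z (fun x => dotv (f x) (g x)).
Proof.
move=> fk gk.
by have /Ck_around_mxP := Ck_around_mulmx (Ck_around_tr fk) gk; exact.
Qed.

Lemma Ck_around_affine k U V W (z : U) (a l : U -> V) (f : V -> W) :
  (forall x, is_diff x a l) ->
  Ck_around k (a z) f -> Ck_around k z (fun x => f (a x)).
Proof.
move=> al [B [oB Bz] fB].
have ac : continuous a.
  by move=> x; apply: differentiable_continuous; exact: ex_diff.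
have oA : open (a @^-1` B) by apply: open_comp => // x _; exact: ac.
by exists (a @^-1` B) => //; exact: Ck_on_affine fB.
Qed.

Lemma Ck_around_comp k V l (z : V) (f : V -> 'cV[R]_l) (g : 'cV[R]_l -> R) :
  Ck_around k z f -> Ck_around k (f z) g -> Ck_around k z (fun x => g (f x)).
Proof.
move=> fk [B oB gB].
have /nbhs_ballP [e0 e00 fB] : \forall y \near z, B (f y).
  by apply: (Ck_around_cont fk); exact: open_nbhs_nbhs.
move: fk => /Ck_aroundP fk; apply/Ck_aroundP; near=> e.
apply: Ck_on_comp gB; [exact: ball_open| |by near: e].
move=> x xe; apply: fB; apply: le_ball xe.
by near: e; exact: nbhs_right_le.
Unshelve. all: by end_near. Qed.

Lemma linear_cV_continuous V k (l : {linear 'cV[R]_k -> V}) : continuous l.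
Proof.
move=> x; apply: differentiable_continuous.
rewrite (_ : (l : _ -> _) =
    \sum_i (fun x : 'cV[R]_k => (x i 0 : R) *: l (delta_mx i 0))).
  by apply: differentiable_sum => i;
    apply/differentiableZl/differentiable_coord.
apply/funext => y; rewrite {1}[y]matrix_sum_delta linear_sum fct_sumE.
by apply: eq_bigr => i _; rewrite big_ord1 linearZ.
Qed.

Lemma is_diff_linear_cV V k (l : {linear 'cV[R]_k -> V}) x : is_diff x l l.
Proof.
have lc := linear_cV_continuous (l := l).
by apply: DiffDef; [exact: linear_differentiable|rewrite diff_lin].
Qed.

Lemma is_diff_affine V W (a : V -> W) (l : {linear V -> W}) (x : V) :
  continuous l -> (forall y h, a (h + y) = a y + l h) -> is_diff x a l.
Proof.
move=> lc al; apply: is_diff_eps => // e e0; near=> h.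
by rewrite al [a x + _]addrC addrK subrr normr0 mulr_ge0 // ltW.
Unshelve. all: by end_near. Qed.

Lemma is_diff_affine_cV V k (a l : 'cV[R]_k -> V) (x : 'cV[R]_k) : linear l ->
  (forall y h, a (h + y) = a y + l h) -> is_diff x a l.
Proof.
move=> ll al.
pose L : {linear 'cV[R]_k -> V} :=
  HB.pack l (GRing.isLinear.Build _ _ _ _ _ ll).
have lc : continuous L by exact: linear_cV_continuous.
exact: (is_diff_affine (l := L)).
Qed.

End CkAround.

Section Jacobians.
Context {R : realType}.

Lemma dotvE k (u v : 'cV[R]_k) : dotv u v = \sum_i u i 0 * v i 0.
Proof. by rewrite /dotv mxE; apply: eq_bigr => i _; rewrite mxE. Qed.

Lemma dotvC k (u v : 'cV[R]_k) : dotv u v = dotv v u.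
Proof. by rewrite !dotvE; apply: eq_bigr => i _; rewrite mulrC. Qed.

Lemma derive_grad k (f : 'cV[R]_k -> R) (x v : 'cV[R]_k) :
  differentiable f x -> 'D_v f x = dotv (grad f x) v.
Proof.
move=> fd; rewrite deriveE_coord // dotvE.
by apply: eq_bigr => i _; rewrite mxE mulrC.
Qed.

Lemma derive_entry (V : normedModType R) k l
    (f : V -> 'M[R]_(k, l)) (x v : V) i j :
  differentiable f x -> 'D_v (fun z => f z i j) x = 'D_v f x i j.
Proof. by move=> fd; rewrite derive_mx ?mxE //; exact: diff_derivable. Qed.

Lemma derive_jac k l (f : 'cV[R]_k -> 'cV[R]_l) (x v : 'cV[R]_k) :
  differentiable f x -> 'D_v f x = jac f x *m v.
Proof.
move=> fd; apply/colP => i; rewrite deriveE_coord // summxE mxE.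
by apply: eq_bigr => j _; rewrite !mxE derive_entry // mulrC.
Qed.

Lemma Ck_around_jac k n l (f : 'cV[R]_n -> 'cV[R]_l) (x : 'cV[R]_n) :
  Ck_around k.+1 x f -> Ck_around k x (jac f).
Proof.
move=> /Ck_around_mxP fk; apply/Ck_around_mxP => i j.
apply: Ck_around_eq (Ck_around_derive (delta_mx j 0) (fk i 0)) => y.
by rewrite mxE.
Qed.

Lemma Ck_around_grad k n (f : 'cV[R]_n -> R) (x : 'cV[R]_n) :
  Ck_around k.+1 x f -> Ck_around k x (grad f).
Proof.
move=> fk; apply/Ck_around_mxP => i j.
apply: Ck_around_eq (Ck_around_derive (delta_mx i 0) fk) => y.
by rewrite mxE.
Qed.

(** Iterated directional derivatives go through the chain rule without matrix
    computations; second-order information is handled in that form and brought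
    back to Hessians here. *)
Lemma quad_form_hess k (f : 'cV[R]_k -> R) (x d : 'cV[R]_k) :
  Ck_around 2 x f -> quad_form (hess f x) d = 'D_d ('D_d f) x.
Proof.
move=> f2.
have gd : differentiable (grad f) x.
  exact: Ck_around_differentiable (Ck_around_grad f2).
have -> : quad_form (hess f x) d = dotv d ('D_d (grad f) x).
  by rewrite derive_jac // /quad_form /dotv mulmxA.
have near1 : \forall y \near x, dotv d (grad f y) = 'D_d f y.
  near=> y; rewrite derive_grad.
    exact: dotvC.
  by near: y; exact: Ck_around_near_differentiable f2.
rewrite -(near_eq_derive _ near1).
have dd i : differentiable (fun y => grad f y i 0 : R) x.
  exact: differentiable_entry.
rewrite [RHS](_ : _ = 'D_d (\sum_i (d i 0 *: (fun y => grad f y i 0 : R))) x).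
  rewrite derive_sum; last by move=> i; apply/derivableZ/diff_derivable.
  rewrite dotvE; apply: eq_bigr => i _.
  by rewrite deriveZ ?derive_entry //; exact: diff_derivable.
congr ('D_d _ x); apply/funext => y; rewrite dotvE fct_sumE.
by apply: eq_bigr.
Unshelve. all: by end_near. Qed.

End Jacobians.

(** * The implicit function theorem *)

Section MeanValue.
Context {R : realType}.

Lemma mvt_line (V : normedModType R) (f : V -> R) (a d : V) (t : R) : 0 < t ->
  (forall c, 0 <= c <= t -> differentiable f (c *: d + a)) ->
  exists2 c, 0 < c < t & f (t *: d + a) - f a = t * 'D_d f (c *: d + a).
Proof.
move=> t0 fd.
have ld (c : R) : differentiable (fun s : R => s *: d + a) c.
  by apply: differentiableD => //; exact: differentiableZl.
have lD (c : R) : 'D_1 (fun s : R => s *: d + a) c = d.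
  rewrite deriveD ?derive_cst ?addr0; last first.
  - exact: derivable_cst.
  - by apply/diff_derivable; exact: differentiableZl.
  have [dd dv] := is_diff_scalel c d.
  by rewrite deriveE // dv scale1r.
have fld (c : R) : 0 <= c <= t -> differentiable (fun s : R =>
  f (s *: d + a)) c.
  move=> ct; apply: (@differentiable_comp _ _ _ _ (fun s : R => s *:
    d + a) f) => //.
  exact: fd.
have [||c] := @MVT R (fun s : R => f (s *: d + a))
  (fun s => 'D_d f (s *: d + a)) 0 t t0.
- move=> c; rewrite in_itv /= => /andP[c0 ct].
  have c0t : 0 <= c <= t by rewrite !ltW.
  apply: DeriveDef; first exact/diff_derivable/fld.
  rewrite (@derive_comp _ _ _ _ (fun s : R => s *: d + a)) ?lD //; exact: fd.
- apply: continuous_in_subspaceT => c; rewrite inE /= in_itv /= => ct.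
  by apply: differentiable_continuous; exact: fld.
rewrite in_itv /= subr0 scale0r add0r => ct ->.
by exists c => //; rewrite mulrC.
Qed.

Lemma mx_norm_le m n (M : 'M[R]_(m, n)) (e : R) : 0 <= e ->
  (forall i j, `|M i j| <= e) -> `|M| <= e.
Proof.
move=> e0 Me; rewrite /Num.Def.normr/= mx_normrE (bigmax_le _ e0) //= => i _;
  exact: Me.
Qed.

Lemma le_mx_norm m n (M : 'M[R]_(m, n)) i j : `|M i j| <= `|M|.
Proof.
rewrite [leRHS]/Num.Def.normr/= mx_normrE.
exact: (@le_bigmax _ _ _ 0 (fun ij : 'I_m * 'I_n => `|M ij.1 ij.2|) (i, j)).
Qed.

Lemma norm_mulmx m n p (M : 'M[R]_(m, n)) (N : 'M[R]_(n, p)) :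
  `|M *m N| <= n%:R * `|M| * `|N|.
Proof.
apply: mx_norm_le => [|i j]; first by rewrite !mulr_ge0.
rewrite mxE; apply: le_trans (ler_norm_sum _ _ _) _.
rewrite -mulrA -[n in n%:R]card_ord -sum1_card natr_sum mulr_suml.
by apply: ler_sum => l _; rewrite mul1r normrM ler_pM ?le_mx_norm.
Qed.

Lemma norm_col_mx_le m n p (M : 'M[R]_(m, p)) (N : 'M[R]_(n, p)) (e : R) :
  (`|col_mx M N| <= e) = (`|M| <= e) && (`|N| <= e).
Proof.
apply/idP/andP => [MNe|[Me Ne]].
  have e0 : 0 <= e by apply: le_trans MNe.
  split; apply: mx_norm_le => // i j; apply: le_trans MNe.
    by rewrite -(col_mxEu M N) le_mx_norm.
  by rewrite -(col_mxEd M N) le_mx_norm.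
have e0 : 0 <= e by apply: le_trans Me.
apply: mx_norm_le => // i j; rewrite mxE; case: splitP => k _.
  by apply: le_trans Me; rewrite le_mx_norm.
by apply: le_trans Ne; rewrite le_mx_norm.
Qed.

(** The mean value theorem fails for vector-valued functions, but its inequality
    holds for the sup norm, entry by entry. *)
Lemma mean_value_le (V : normedModType R) n (f : V -> 'cV[R]_n)
    (a b : V) (K : R) :
  0 <= K ->
  (forall c, 0 <= c <= 1 -> differentiable f (c *: (b - a) + a) /\
     `|'D_(b - a) f (c *: (b - a) + a)| <= K) ->
  `|f b - f a| <= K.
Proof.
move=> K0 fK; apply: mx_norm_le => // i j; rewrite ord1 !mxE.
have fid c : 0 <= c <= 1 ->
    differentiable (fun z => f z i 0 : R) (c *: (b - a) + a).
  by move=> /fK [fd _]; exact: differentiable_entry.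
have [c /andP[c0 c1]] := mvt_line ltr01 fid.
rewrite scale1r subrK mul1r => ->.
have /fK [fd] : 0 <= c <= 1 by rewrite !ltW.
apply: le_trans; rewrite derive_entry //; exact: le_mx_norm.
Qed.

Lemma unitmx_inj n (M : 'M[R]_n) : (forall v : 'cV[R]_n, M *m v = 0 -> v = 0) ->
  M \in unitmx.
Proof.
move=> Minj; rewrite -unitmx_tr -row_free_unit -kermx_eq0.
apply/eqP/row_matrixP => i; rewrite row0; apply: trmx_inj; rewrite trmx0.
apply: Minj; apply: trmx_inj; rewrite trmx_mul trmxK trmx0.
by apply/sub_kermxP; exact: row_sub.
Qed.

Lemma differentiable_jac_eps n l (f : 'cV[R]_n -> 'cV[R]_l) (x : 'cV[R]_n) :
  differentiable f x -> forall e, 0 < e ->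
  \forall h \near (0 : 'cV[R]_n), `|f (h + x) - f x - jac f x *m h| <= e * `|h|.
Proof.
move=> fd e e0; have := differentiable_eps fd e0; apply: filterS => h.
by rewrite -deriveE // derive_jac.
Qed.

Lemma Ck_on_jac k n l (A : set 'cV[R]_n) (f : 'cV[R]_n -> 'cV[R]_l) :
  open A -> Ck_on k.+1 A f -> Ck_on k A (jac f).
Proof.
move=> oA /(Ck_on_mxP _ _ oA) fk; apply/Ck_on_mxP => // i j.
have [_ /(_ (delta_mx j 0))] := fk i 0.
by apply: Ck_on_ext oA _ => x _; rewrite mxE.
Qed.

End MeanValue.

(** The fixed point theorem needs the norm and the completeness in one
    structure. *)
HB.instance Definition _ (R : realType) (n : nat) := Complete.on 'cV[R]_n.

Section ImplicitFunction.
Context {R : realType} {n N k : nat}.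
Variables (E : 'cV[R]_(n + N) -> 'cV[R]_N) (xs : 'cV[R]_n) (ws : 'cV[R]_N).
Hypothesis EC : Ck_around k.+1 (col_mx xs ws) E.
Hypothesis E0 : E (col_mx xs ws) = 0.
Hypothesis Eu : rsubmx (jac E (col_mx xs ws)) \in unitmx.

Let us := col_mx xs ws.

(* [T x] is a Newton step for [E (x, w) = 0] with the derivative frozen at the
   base point. *)
Let B := invmx (rsubmx (jac E us)).
Let T x w := w - B *m E (col_mx x w).

(* [B *m rsubmx (jac E u)] differs from the identity by an operator of norm at
   most [1 / 2]; the factor [N%:R] accounts for the sup norm of a matrix not
   being an operator norm. *)
Let good (u : 'cV[R]_(n + N)) :=
  N%:R * `|1%:M - B *m rsubmx (jac E u)| <= 2^-1.

Lemma near_good : \forall u \near us, good u.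
Proof.
have jc : {for us, continuous (fun u => 1%:M - B *m rsubmx (jac E u))}.
  apply: (@Ck_around_cont _ 0).
  apply: Ck_aroundD; first exact: Ck_around_cst.
  apply: (Ck_around_eq (f := fun u => (- B) *m rsubmx (jac E u))).
    by move=> u; rewrite mulNmx.
  apply: Ck_around_mulmx; first exact: Ck_around_cst.
  apply/Ck_around_mxP => i j.
  have /Ck_around_mxP/(_ i (rshift n j)) := Ck_around_le (leq0n k)
    (Ck_around_jac EC).
  by apply: Ck_around_eq => u; rewrite [RHS]mxE.
have e0 : 0 < (2 * N.+1%:R)^-1 :> R by rewrite invr_gt0 mulr_gt0.
have /cvgrPdist_le/(_ _ e0) := jc; apply: filterS => u.
rewrite mulVmx // subrr sub0r normrN => uN; rewrite /good.
apply: (@le_trans _ _ (N%:R * (2 * N.+1%:R)^-1)); first exact: ler_wpM2l.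
by rewrite invfM mulrCA ler_piMr // ler_pdivrMr // mul1r ler_nat.
Qed.

(** The derivative of [T x] is [1 - B *m rsubmx (jac E u)], of operator norm at
    most [1 / 2] at good points. *)
Lemma good_lipschitz (x : 'cV[R]_n) (w w' : 'cV[R]_N) :
  (forall c, 0 <= c <= 1 -> good (col_mx x (c *: (w - w') + w')) /\
     differentiable E (col_mx x (c *: (w - w') + w'))) ->
  `|T x w - T x w'| <= 2^-1 * `|w - w'|.
Proof.
move=> gE; apply: mean_value_le => [|c c01]; first by rewrite mulr_ge0.
have [gu dE] := gE _ c01; set v := c *: (w - w') + w' in gu dE *.
have da : is_diff v (fun v : 'cV[R]_N => col_mx x v) (fun v => col_mx 0 v).
  apply: is_diff_affine_cV => [b d e|y h].
    by rewrite scale_col_mx add_col_mx scaler0 add0r.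
  by rewrite add_col_mx addr0 [h + y]addrC.
have dEa : differentiable (fun v => E (col_mx x v)) v.
  by apply: differentiable_comp; [exact: ex_diff|].
have @Bl : {linear 'cV[R]_N -> 'cV[R]_N} := mulmx B.
have DBE := @is_diff_linear_cV _ _ _ Bl (E (col_mx x v)).
have dBE : differentiable (fun v => B *m E (col_mx x v)) v.
  by apply: (@differentiable_comp _ _ _ _ (fun v => E (col_mx x v)) Bl) => //;
    exact: ex_diff.
have dT : differentiable (T x) v by apply: differentiableB.
split=> //.
have -> : 'D_(w - w') (T x) v =
  (1%:M - B *m rsubmx (jac E (col_mx x v))) *m (w - w').
  rewrite deriveB; [|by apply: diff_derivable..].
  rewrite derive_id mulmxBl mul1mx; congr (_ - _).
  rewrite (@derive_comp _ _ _ _ (fun v => E (col_mx x v)) Bl) //.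
  rewrite deriveE ?diff_val; last exact: ex_diff.
  rewrite /Bl /= -mulmxA; congr (_ *m _).
  rewrite (@derive_comp _ _ _ _ (fun v => col_mx x v) E) //.
  rewrite derive_jac // deriveE // diff_val.
  by rewrite -[jac E _ in LHS]hsubmxK mul_row_col mulmx0 add0r.
apply: le_trans (norm_mulmx _ _) _.
by apply: ler_wpM2r.
Qed.

Lemma good_unit u : good u -> rsubmx (jac E u) \in unitmx.
Proof.
move=> gu; apply: unitmx_inj => v Mv.
have vE : v = (1%:M - B *m rsubmx (jac E u)) *m v.
  by rewrite mulmxBl mul1mx -mulmxA Mv mulmx0 subr0.
have : `|v| <= 2^-1 * `|v|.
  by rewrite {1}vE; apply: le_trans (norm_mulmx _ _) _; exact: ler_wpM2r.
rewrite -subr_ge0 -{2}[`|v|]mul1r -mulrBl => h; apply/normr0_eq0/eqP.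
by rewrite eq_le normr_ge0 andbT; move: h; lra.
Qed.

Lemma near_jac_unit : \forall u \near us, rsubmx (jac E u) \in unitmx.
Proof. by have := near_good; apply: filterS => u; exact: good_unit. Qed.

(* Neighbourhoods are fixed so that [T x] maps the closed ball of radius [r]
   around [ws] to itself: half of the radius pays for the contraction, the other
   half for [T x ws - ws]. *)
Section Solution.
Variables (A : set 'cV[R]_(n + N)) (r d : R).
Hypotheses (oA : open A) (EA : Ck_on k.+1 A E) (r0 : 0 < r) (dr : d <= r).
Hypothesis rA : forall x w, `|x - xs| <= r -> `|w - ws| <= r ->
  good (col_mx x w) /\ A (col_mx x w).
Hypothesis dE : forall x, ball xs d x -> `|B *m E (col_mx x ws)| <= r / 2.

Let D := closed_ball_ Num.norm ws r.

Let DE w : D w = (`|w - ws| <= r).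
Proof. by rewrite /D /closed_ball_ /= distrC. Qed.

Let ball_le x : ball xs d x -> `|x - xs| <= r.
Proof.
by rewrite -ball_normE /= distrC => xd; apply: ltW; apply: lt_le_trans dr.
Qed.

Let T_lipschitz x w w' : ball xs d x -> D w -> D w' ->
  `|T x w - T x w'| <= 2^-1 * `|w - w'|.
Proof.
move=> xd Dw Dw'; apply: good_lipschitz => c /andP[c0 c1].
have [|gu Au] := rA (ball_le xd) (w := c *: (w - w') + w').
  have -> : c *: (w - w') + w' - ws = c *: (w - ws) + (1 - c) *: (w' - ws).
    by apply/colP => i; rewrite !mxE; ring.
  apply: le_trans (ler_norm_convex _ _ _) _; first by rewrite c0.
  by move: Dw Dw'; rewrite !DE ge_max => -> ->.
split=> //; have [+ _] := EA; exact.
Qed.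

Lemma solution_exists x : ball xs d x ->
  exists w, D w /\ E (col_mx x w) = 0.
Proof.
move=> xd.
have Dws : D ws by rewrite DE subrr normr0 ltW.
have TD : {homo T x : w / D w >-> D w}.
  move=> w Dw; rewrite DE -[T x w](subrK (T x ws)) -addrA.
  apply: le_trans (ler_normD _ _) _; rewrite [leRHS]splitr; apply: lerD.
    apply: le_trans (T_lipschitz xd Dw Dws) _.
    by rewrite mulrC ler_wpM2r // -DE.
  by rewrite /T addrAC subrr sub0r normrN dE.
have /banach_fixed_point : is_contraction (mkfun_fun TD).
  have h0 : 0 <= 2^-1 :> R by [].
  exists (NngNum h0); split => /=; first by lra.
  by move=> [w w'] [/= Dw Dw']; exact: T_lipschitz.
move=> [| |w Dw wT]; first exact: closed_closed_ball_.
  by exists ws.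
exists w; split=> //.
have BE : B *m E (col_mx x w) = 0.
  by move: wT; rewrite /= /mkfun /T => /eqP;
    rewrite eq_sym subr_eq addrC -subr_eq subrr eq_sym => /eqP.
by rewrite -[E _]mul1mx -(mulmxV Eu) -mulmxA BE mulmx0.
Qed.

(** Since [T x] contracts by [1 / 2], two points are at most twice as far apart
    as the residuals of [E] make them. This gives uniqueness when both residuals
    vanish, and the Lipschitz continuity of the solution otherwise. *)
Lemma solution_unique x w w' : ball xs d x -> D w -> D w' ->
  `|w - w'| <= 2 * `|B *m (E (col_mx x w) - E (col_mx x w'))|.
Proof.
move=> xd Dw Dw'; have := T_lipschitz xd Dw Dw'.
have -> : T x w - T x w' = (w - w') - B *m (E (col_mx x w) - E (col_mx x w')).
  rewrite /T mulmxBr; move: (B *m E _) (B *m E _) => p q.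
  by apply/colP => i; rewrite !mxE; ring.
move=> h; have := ler_normB (w - w' - B *m (E (col_mx x w) - E (col_mx x w')))
  (- (B *m (E (col_mx x w) - E (col_mx x w')))).
rewrite opprK subrK normrN; move: h.
set a := `|_ - B *m _|; set b := `|B *m _|; set c := `|_|; lra.
Qed.

Variable w : 'cV[R]_n -> 'cV[R]_N.
Hypothesis wD : forall x, ball xs d x -> D (w x) /\ E (col_mx x (w x)) = 0.

Let wA x : ball xs d x -> good (col_mx x (w x)) /\ A (col_mx x (w x)).
Proof.
by move=> xd; have [Dw _] := wD xd; apply: rA; rewrite ?ball_le // -DE.
Qed.

Let Dw (u : 'cV[R]_(n + N)) := - (invmx (rsubmx (jac E u)) *m lsubmx (jac E u)).

(** Expanding [E (h + x, w (h + x)) = 0] at first order and solving for the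
    increment of [w] gives the formula of the derivative; the remainder is
    negligible with respect to [h] because [w] is Lipschitz at [x]. *)
Lemma solution_is_diff x : ball xs d x ->
  is_diff x w (mulmx (Dw (col_mx x (w x)))).
Proof.
move=> xd; have [gu Au] := wA xd; have Mu := good_unit gu.
have [Dwx Ewx] := wD xd.
set u := col_mx x (w x) in gu Au Mu Ewx *.
have dEu : differentiable E u by have [+ _] := EA; exact.
set M := rsubmx (jac E u); set L := lsubmx (jac E u).
have jacE (h : 'cV[R]_n) (v : 'cV[R]_N) : jac E u *m col_mx h v =
  L *m h + M *m v.
  by rewrite -{1}[jac E u]hsubmxK mul_row_col.
(* [K] is a Lipschitz constant of [w] at [x]: [solution_unique] compares [w x]
   and [w (h + x)] through [E (h + x, w x)], which is small by differentiability
   of [E]. *)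
pose K := 2 * (N%:R * `|B|) * ((n + N)%:R * `|jac E u| + 1) + 1.
have K1 : 1 <= K by rewrite lerDr !mulr_ge0 // addr_ge0 // mulr_ge0.
have K0 : 0 < K by exact: lt_le_trans K1.
have near_ball : \forall h \near (0 : 'cV[R]_n), ball xs d (h + x).
  apply: near_shift0; apply: open_nbhs_nbhs; split=> //; exact: ball_open.
have near_col0 (P : set 'cV[R]_(n + N)) : nbhs 0 P ->
    \forall h \near (0 : 'cV[R]_n), P (col_mx h 0).
  move=> /nbhs_ballP [e e0 eP]; near=> h; apply: eP.
  rewrite -ball_normE /= sub0r normrN; apply: (@le_lt_trans _ _ `|h|).
    by rewrite norm_col_mx_le lexx normr0 normr_ge0.
  by near: h; apply/nbhs_ballP; exists e => //= h;
    rewrite -ball_normE /= sub0r normrN.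
have colE h v : col_mx h v + u = col_mx (h + x) (v + w x) by rewrite add_col_mx.
have near_jac := near_col0 _ (differentiable_jac_eps dEu ltr01).
have dw_le : \forall h \near (0 : 'cV[R]_n), `|w (h + x) - w x| <= K * `|h|.
  near=> h.
  have xhd : ball xs d (h + x) by near: h.
  have [Dwh Ewh] := wD xhd.
  apply: le_trans (solution_unique xhd Dwh Dwx) _.
  rewrite Ewh sub0r mulmxN normrN.
  have Ehu : `|E (col_mx h 0 + u) - E u - jac E u *m col_mx h 0| <=
    1 * `|col_mx h (0 : 'cV[R]_N)|.
    by near: h.
  have hn : `|col_mx h (0 : 'cV[R]_N)| <= `|h|.
    by rewrite norm_col_mx_le lexx normr0 normr_ge0.
  have {}Ehu : `|E (col_mx (h + x) (w x))| <=
    ((n + N)%:R * `|jac E u| + 1) * `|h|.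
    rewrite -[w x]add0r -colE -[E _](subrK (jac E u *m col_mx h 0)).
    apply: le_trans (ler_normD _ _) _; rewrite mulrDl addrC; apply: lerD.
      apply: le_trans (norm_mulmx _ _) _; apply: ler_wpM2l => //.
    by move: Ehu; rewrite Ewx subr0 => /le_trans; apply; rewrite !mul1r.
  apply: (@le_trans _ _
    (2 * (N%:R * `|B| * (((n + N)%:R * `|jac E u| + 1) * `|h|)))).
    rewrite ler_wpM2l //; apply: le_trans (norm_mulmx _ _) _.
    by rewrite ler_wpM2l // mulr_ge0.
  by rewrite /K [leRHS]mulrDl !mulrA mul1r lerDl.
have @Lw : {linear 'cV[R]_n -> 'cV[R]_N} := mulmx (Dw u).
apply: (@is_diff_eps _ _ _ _ _ Lw); first exact: linear_cV_continuous.
move=> e e0; pose C := N%:R * `|invmx M| + 1.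
have C0 : 0 < C by rewrite ltr_wpDl // mulr_ge0.
have e'0 : 0 < e / (C * K) by rewrite divr_gt0 // mulr_gt0.
have /nbhs_ballP[rho rho0 Erho] := differentiable_jac_eps dEu e'0.
near=> h.
have xhd : ball xs d (h + x) by near: h.
have [Dwh Ewh] := wD xhd.
have dwK : `|w (h + x) - w x| <= K * `|h| by near: h.
set dw := w (h + x) - w x in dwK *.
have hK : `|col_mx h dw| <= K * `|h|.
  by rewrite norm_col_mx_le dwK andbT ler_peMl.
have : `|E (col_mx h dw + u) - E u - jac E u *m col_mx h dw| <=
  e / (C * K) * `|col_mx h dw|.
  apply: Erho; rewrite -ball_normE /= sub0r normrN; apply: le_lt_trans hK _.
  rewrite mulrC -ltr_pdivlMr //; near: h.
  apply/nbhs_ballP; exists (rho / K) => /=; first exact: divr_gt0.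
  by move=> h; rewrite -ball_normE /= sub0r normrN.
rewrite colE subrK Ewh Ewx subrr sub0r normrN jacE => LM.
have -> : dw - Lw h = invmx M *m (L *m h + M *m dw).
  rewrite /Lw /= /Dw -/M -/L mulNmx opprK mulmxDr !mulmxA mulVmx // mul1mx.
  by rewrite addrC.
apply: le_trans (norm_mulmx _ _) _.
apply: (@le_trans _ _ (C * (e / (C * K) * (K * `|h|)))).
  apply: ler_pM => //; first by rewrite lerDl.
  by apply: le_trans LM _; rewrite ler_wpM2l // ltW.
rewrite [leLHS](_ : _ = e * `|h|) //; field.
by rewrite !gt_eqF.
Unshelve. all: by end_near. Qed.

(** The derivative of [w] at [x] is an expression in [jac E (x, w x)], so [w] is
    of class C^(j+1) as soon as it is of class C^j, up to the smoothness of
    [E]. *)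
Lemma Ck_on_solution : Ck_on k.+1 (ball xs d) w.
Proof.
have ob := @ball_open R 'cV[R]_n xs d.
have wd x : ball xs d x -> differentiable w x.
  by move=> xd; have wdx := solution_is_diff xd; exact: ex_diff.
have jk := Ck_on_jac oA EA.
suff wj j : (j <= k.+1)%N -> Ck_on j (ball xs d) w by exact: wj.
elim: j => [_|j IH jk1] /=.
  by move=> x /wd; exact: differentiable_continuous.
split=> // v.
have {}IH := IH (ltnW jk1).
have colk : Ck_on j (ball xs d) (fun x => col_mx x (w x)).
  apply/Ck_on_mxP => // a b.
  case: (splitP a) => c ac;
    [ have -> : a = lshift N c by exact: val_inj
    | have -> : a = rshift n c by exact: val_inj].
    have := Ck_on_id j (ball xs d); move=> /(Ck_on_mxP _ _ ob)/(_ c b).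
    by apply: Ck_on_ext => // x _; rewrite col_mxEu.
  move: IH => /(Ck_on_mxP _ _ ob)/(_ c b).
  by apply: Ck_on_ext => // x _; rewrite col_mxEd.
have jck : Ck_on j (ball xs d) (fun x => jac E (col_mx x (w x))).
  apply/Ck_on_mxP => // a b.
  have := Ck_on_le _ jk; move=> /(_ j jk1)/(Ck_on_mxP _ _ oA)/(_ a b).
  by apply: Ck_on_comp => // x /wA [].
have invk : Ck_on j (ball xs d)
  (fun x => invmx (rsubmx (jac E (col_mx x (w x))))).
  apply: Ck_on_invmx => // [x /wA [gu _]|]; first exact: good_unit.
  apply/Ck_on_mxP => // a b.
  have /(Ck_on_mxP _ _ ob)/(_ a (rshift n b)) := jck.
  by apply: Ck_on_ext => // x _; rewrite [RHS]mxE.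
have lk : Ck_on j (ball xs d) (fun x => lsubmx (jac E (col_mx x (w x)))).
  apply/Ck_on_mxP => // a b.
  have /(Ck_on_mxP _ _ ob)/(_ a (lshift N b)) := jck.
  by apply: Ck_on_ext => // x _; rewrite [RHS]mxE.
have : Ck_on j (ball xs d) (fun x => Dw (col_mx x (w x)) *m v).
  have := Ck_on_mulmx ob (Ck_on_mulmx ob invk lk)
    (Ck_on_cst j (ball xs d) (- v)).
  by apply: Ck_on_ext => // x _; rewrite /Dw mulNmx mulmxN.
apply: Ck_on_ext => // x xd.
have dwx := solution_is_diff xd.
by rewrite deriveE ?diff_val //; exact: wd.
Qed.

End Solution.

(** For [x] close to [xs] the map [T x] is a contraction of a fixed ball, whose
    fixed point is the solution. *)
Theorem implicit_function : exists (d : R) (w : 'cV[R]_n -> 'cV[R]_N),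
  [/\ 0 < d, w xs = ws, Ck_on k.+1 (ball xs d) w &
      forall x, ball xs d x -> E (col_mx x (w x)) = 0].
Proof.
have [A [oA Aus] EA] := EC.
have /nbhs_ballP [e e0 eG] : \forall u \near us, good u /\ A u.
  by near=> u; split; near: u; [exact: near_good|exact: open_nbhs_nbhs].
have r0 : 0 < e / 2 by exact: divr_gt0.
have rA x w : `|x - xs| <= e / 2 -> `|w - ws| <= e / 2 ->
    good (col_mx x w) /\ A (col_mx x w).
  move=> xe we; apply: eG;
    rewrite -ball_normE /= distrC /us opp_col_mx add_col_mx.
  apply: (@le_lt_trans _ _ (e / 2)); first by rewrite norm_col_mx_le xe we.
  by rewrite ltr_pdivrMr // ltr_pMr // ltr1n.
have BEc : {for xs, continuous (fun x => B *m E (col_mx x ws))}.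
  apply: (@Ck_around_cont _ 0).
  apply: Ck_around_mulmx; first exact: Ck_around_cst.
  apply: (@Ck_around_affine _ _ _ _ _ _ (fun x => col_mx x ws)
    (fun x => col_mx x 0) E).
    move=> x; apply: is_diff_affine_cV => [a y z|y h].
      by rewrite scale_col_mx add_col_mx scaler0 add0r.
    by rewrite add_col_mx addr0 [h + y]addrC.
  exact: Ck_around_le EC.
have r20 : 0 < e / 2 / 2 by exact: divr_gt0.
have /nbhs_ballP [d0 d00 d0E] :
    \forall x \near xs, `|B *m E (col_mx x ws)| <= e / 2 / 2.
  have /cvgrPdist_le/(_ _ r20) := BEc; apply: filterS => x.
  by rewrite E0 mulmx0 sub0r normrN.
pose d := Num.min d0 (e / 2).
have d_gt0 : 0 < d by rewrite lt_min d00 r0.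
have dr : d <= e / 2 by rewrite ge_min lexx orbT.
have dE x : ball xs d x -> `|B *m E (col_mx x ws)| <= e / 2 / 2.
  by move=> xd; apply: d0E; apply: le_ball xd; rewrite ge_min lexx.
have [w wD] : exists w : 'cV[R]_n -> 'cV[R]_N, forall x, ball xs d x ->
    closed_ball_ Num.norm ws (e / 2) (w x) /\ E (col_mx x (w x)) = 0.
  exists (fun x => get [set v |
    closed_ball_ Num.norm ws (e / 2) v /\ E (col_mx x v) = 0]) => x.
  by move=> /(solution_exists EA r0 dr rA dE)/getPex.
exists d, w; split=> //.
- have xsd : ball xs d xs by exact: ballxx.
  have [Dw Ew] := wD _ xsd.
  have Dws : closed_ball_ Num.norm ws (e / 2) ws.
    by rewrite /closed_ball_ /= subrr normr0 ltW.
  have := solution_unique EA dr rA xsd Dw Dws.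
  by rewrite Ew E0 subrr mulmx0 normr0 mulr0 normr_le0 subr_eq0 => /eqP.
- exact: (Ck_on_solution oA EA dr rA wD).
- by move=> x /wD [].
Unshelve. all: by end_near. Qed.

End ImplicitFunction.

(** * Quadratic growth uniform in a parameter *)

Section Growth.
Context {R : realType}.

(** Transposition is an isometry onto row vectors, where closed bounded sets are
    compact. *)
Lemma compact_sphere k : compact [set d : 'cV[R]_k | `|d| = 1].
Proof.
have -> : [set d : 'cV[R]_k | `|d| = 1] =
    (@trmx R 1 k) @` [set d : 'rV[R]_k | `|d| = 1].
  have trn m l (M : 'M[R]_(m, l)) : `|M^T| <= `|M|.
    by apply: mx_norm_le => // i j; rewrite mxE le_mx_norm.
  have trn' m l (M : 'M[R]_(m, l)) : `|M^T| = `|M|.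
    by apply/eqP; rewrite eq_le trn /= -{1}[M]trmxK trn.
  apply/seteqP; split=> [d /= d1|_ [d /= d1 <-]]; last by rewrite trn'.
  by exists d^T; rewrite ?trn' ?trmxK.
apply: continuous_compact.
  apply: continuous_subspaceT => x; apply: continuous_mxP => i j.
  rewrite (_ : (fun z => _) = (fun z : 'rV[R]_k => z j i)).
    exact: coord_continuous.
  by apply/funext => z; rewrite mxE.
apply: bounded_closed_compact.
  exists 1; split=> // M M1 d /= ->; exact: ltW.
rewrite (_ : [set _ | _] = Num.norm @^-1` [set (1 : R)]) //.
apply: preimage_closed; last exact: closed_eq.
by move=> x _; exact: norm_continuous.
Qed.

Lemma near_fst (X Y : topologicalType) (x : X) (y : Y) (P : set X) :
  (\forall z \near x, P z) -> \forall q \near (x, y), P q.1.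
Proof.
by move=> Px; exists (P, setT); [split=> //; exact: filterT|move=> q []].
Qed.

Lemma near_snd (X Y : topologicalType) (x : X) (y : Y) (P : set Y) :
  (\forall z \near y, P z) -> \forall q \near (x, y), P q.2.
Proof.
by move=> Py; exists (setT, P); [split=> //; exact: filterT|move=> q []].
Qed.

Context {T : normedModType R} {k : nat}.
Local Notation V := 'cV[R]_k.
Implicit Types (p : T * V) (d v : V).

Let vert (v : V) : T * V := (0, v).

Let vert_linear : linear vert.
Proof.
by move=> a v w; apply/pair_equal_spec; split; rewrite /= ?scaler0 ?addr0.
Qed.

Let vert_line (c : R) (v y : V) (t : T) :
  c *: vert v + (t, y) = (t, c *: v + y).
Proof. by apply/pair_equal_spec; split; rewrite /= ?scaler0 ?add0r. Qed.

Lemma is_diff_fst (U W : normedModType R) (x : U * W) : is_diff x fst fst.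
Proof.
by apply: (is_diff_affine (l := fst)) => [y|y h];
  [exact: cvg_fst|rewrite addrC].
Qed.

Lemma is_diff_snd (U W : normedModType R) (x : U * W) : is_diff x snd snd.
Proof.
by apply: (is_diff_affine (l := snd)) => [y|y h];
  [exact: cvg_snd|rewrite addrC].
Qed.

(** Only the second factor of [T * V] is finite-dimensional; the derivatives
    used below are all in its directions, where they expand in coordinates. *)
Lemma derive_vert (f : T * V -> R) p d : differentiable f p ->
  'D_(vert d) f p = \sum_i d i 0 * 'D_(vert (delta_mx i 0)) f p.
Proof.
move=> fd; rewrite deriveE //.
have -> : vert d = \sum_i d i 0 *: vert (delta_mx i 0).
  pose l : {linear V -> (T * V)%type} :=
    HB.pack vert (GRing.isLinear.Build _ _ _ _ _ vert_linear).
  rewrite -[vert d]/(l d) {1}[d]matrix_sum_delta linear_sum.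
  by apply: eq_bigr => i _; rewrite big_ord1 linearZ.
rewrite linear_sum; apply: eq_bigr => i _; rewrite linearZ /= deriveE //.
Qed.

Lemma near_derive_vert_gt (f : T * V -> R) p d a : Ck_around 1 p f ->
  a < 'D_(vert d) f p ->
  \forall q \near (d, p), a < 'D_(vert q.1) f q.2.
Proof.
move=> f1 ad.
pose Df (q : V * (T * V)) := \sum_i q.1 i 0 * 'D_(vert (delta_mx i 0)) f q.2.
have Dfc : {for (d, p), continuous Df}.
  apply: (@Ck_around_cont _ 0); apply: Ck_around_sum => i _.
  apply: Ck_aroundM.
    apply: (Ck_around_affine (@is_diff_fst _ _) (f := fun d : V => d i 0 : R)).
    have /Ck_around_mxP := Ck_around_id 0 d; exact.
  apply: (Ck_around_affine (@is_diff_snd _ _)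
    (f := 'D_(vert (delta_mx i 0)) f)).
  exact: Ck_around_derive.
have fd := Ck_around_differentiable f1.
have : a < Df (d, p) by rewrite /Df /= -derive_vert.
have /cvgr_gt Dfgt : Df @ (d, p) --> Df (d, p) := Dfc.
move=> /Dfgt Dfa.
have fdq : \forall q \near (d, p), differentiable f q.2.
  exact: (near_snd d (Ck_around_near_differentiable f1)).
by near=> q; rewrite derive_vert; [near: q|near: q].
Unshelve. all: by end_near. Qed.

Lemma derive2_vert (f : T * V -> R) p d : Ck_around 2 p f ->
  'D_(vert d) ('D_(vert d) f) p =
  \sum_i d i 0 * \sum_j d j 0 *
    'D_(vert (delta_mx i 0)) ('D_(vert (delta_mx j 0)) f) p.
Proof.
move=> f2; rewrite derive_vert; last first.
  exact: (Ck_around_differentiable (Ck_around_derive (vert d) f2)).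
apply: eq_bigr => i _; congr (_ * _).
have fd : \near p, 'D_(vert d) f p =
    (\sum_j d j 0 *: 'D_(vert (delta_mx j 0)) f : T * V -> R) p.
  have := Ck_around_near_differentiable f2; apply: filterS => y fy.
  by rewrite derive_vert // fct_sumE.
have dd j : derivable ('D_(vert (delta_mx j 0)) f) p (vert (delta_mx i 0)).
  apply: diff_derivable.
  exact: (Ck_around_differentiable (Ck_around_derive _ f2)).
rewrite (near_eq_derive _ fd) derive_sum; last by move=> j; exact: derivableZ.
by apply: eq_bigr => j _; rewrite deriveZ.
Qed.

Lemma near_derive2_vert_gt (f : T * V -> R) p d a : Ck_around 2 p f ->
  a < 'D_(vert d) ('D_(vert d) f) p ->
  \forall q \near (d, p), a < 'D_(vert q.1) ('D_(vert q.1) f) q.2.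
Proof.
move=> f2 ad.
pose Df (q : V * (T * V)) := \sum_i q.1 i 0 * \sum_j q.1 j 0 *
    'D_(vert (delta_mx i 0)) ('D_(vert (delta_mx j 0)) f) q.2.
have coord i : Ck_around 0 (d, p) (fun q : V * (T * V) => q.1 i 0 : R).
  apply: (Ck_around_affine (@is_diff_fst _ _) (f := fun d : V => d i 0 : R)).
  have /Ck_around_mxP := Ck_around_id 0 d; exact.
have Dfc : {for (d, p), continuous Df}.
  apply: (@Ck_around_cont _ 0); apply: Ck_around_sum => i _.
  apply: Ck_aroundM => //; apply: Ck_around_sum => j _; apply: Ck_aroundM => //.
  apply: (Ck_around_affine (@is_diff_snd _ _)
    (f := 'D_(vert (delta_mx i 0)) ('D_(vert (delta_mx j 0)) f))).
  exact/Ck_around_derive/Ck_around_derive.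
have : a < Df (d, p) by rewrite /Df /= -derive2_vert.
have /cvgr_gt Dfgt : Df @ (d, p) --> Df (d, p) := Dfc.
move=> /Dfgt Dfa.
have f2q : \forall q \near (d, p), Ck_around 2 q.2 f.
  exact: (near_snd d (Ck_around_near f2)).
by near=> q; rewrite derive2_vert; near: q.
Unshelve. all: by end_near. Qed.

Variables (b : T -> V) (t0 : T).
Hypothesis bc : {for t0, continuous b}.
Local Notation p0 := (t0, b t0).

(** A property that holds near [(d, p0)] holds on whole segments starting from
    the graph of [b], because balls are convex and the graph passes through
    [p0]. *)
Lemma near_segment (d : V) (P : V -> T * V -> Prop) :
  (\forall q \near (d, p0), P q.1 q.2) ->
  \forall q \near (d, p0), forall s, 0 <= s -> q.2.2 = s *: q.1 + b q.2.1 ->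
    forall c, 0 <= c <= s -> P q.1 (q.2.1, c *: q.1 + b q.2.1).
Proof.
move=> /nbhs_ballP [e e0 eP].
have bt : \forall t \near t0, ball (b t0) e (b t).
  by apply: bc; exact: nbhsx_ballx.
have btq : \forall q \near (d, p0), ball (b t0) e (b q.2.1).
  exact: (near_snd d (near_fst (b t0) bt)).
have qe : \forall q \near (d, p0), ball (d, p0) e q by exact: nbhsx_ballx.
near=> q => s s0 qs c /andP[c0 cs].
have [qd [qt qz]] : ball (d, p0) e q by near: q.
have bq : ball (b t0) e (b q.2.1) by near: q.
apply: (eP (q.1, (q.2.1, _))); split=> //; split=> //=.
have [s0'|s0'] := eqVneq s 0.
  have -> : c = 0 by apply/eqP; rewrite eq_le c0 -s0' cs.
  by rewrite scale0r add0r.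
have sgt0 : 0 < s by rewrite lt_neqAle eq_sym s0' s0.
have -> : c *: q.1 + b q.2.1 = (c / s) *: q.2.2 + (1 - c / s) *: b q.2.1.
  by rewrite qs; apply/colP => i; rewrite !mxE; field.
move: qz bq; rewrite -!ball_normE /= => qz bq.
have -> : b t0 - (c / s *: q.2.2 + (1 - c / s) *: b q.2.1) =
  (c / s) *: (b t0 - q.2.2) + (1 - c / s) *: (b t0 - b q.2.1).
  by apply/colP => i; rewrite !mxE; ring.
have cs01 : 0 <= c / s <= 1 by rewrite divr_ge0 //= ler_pdivrMr // mul1r.
apply: le_lt_trans (ler_norm_convex _ _ cs01) _.
by rewrite gt_max qz bq.
Unshelve. all: by end_near. Qed.

Lemma near_first_order (f : T * V -> R) d : Ck_around 1 p0 f ->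
  0 < 'D_(vert d) f p0 ->
  exists2 a, 0 < a & \forall q \near (d, p0), forall s, 0 < s ->
    q.2.2 = s *: q.1 + b q.2.1 -> a * s <= f q.2 - f (q.2.1, b q.2.1).
Proof.
move=> f1 fd; exists ('D_(vert d) f p0 / 2); first exact: divr_gt0.
have fd2 : 'D_(vert d) f p0 / 2 < 'D_(vert d) f p0.
  by rewrite ltr_pdivrMr // ltr_pMr // ltr1n.
have near1 : \forall q \near (d, p0),
    'D_(vert d) f p0 / 2 < 'D_(vert q.1) f q.2 /\ differentiable f q.2.
  near=> q; split; near: q; first exact: near_derive_vert_gt.
  exact: (near_snd d (Ck_around_near_differentiable f1)).
have := near_segment (P := fun v p => 'D_(vert d) f p0 / 2 < 'D_(vert v) f p /\
  differentiable f p) near1.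
apply: filterS => q qP s s0 qs; have {}qP := qP _ (ltW s0) qs.
have lineE c := vert_line c q.1 (b q.2.1) q.2.1.
have [c|c /andP[c0 cs]] := @mvt_line R _ f (q.2.1, b q.2.1) (vert q.1) s s0.
  by rewrite lineE => /qP [].
rewrite !lineE -qs -surjective_pairing => ->.
have [|+ _] := qP c; first by rewrite !ltW.
by move=> h; rewrite mulrC ler_wpM2l // ltW.
Unshelve. all: by end_near. Qed.

(** The slope of [L] along the segment is zero at the start and grows at rate at
    least [D / 2], [D] being the second derivative at the base point. *)
Lemma near_second_order (L : T * V -> R) d : Ck_around 2 p0 L ->
  (\forall t \near t0, forall v, 'D_(vert v) L (t, b t) = 0) ->
  0 < 'D_(vert d) ('D_(vert d) L) p0 ->
  exists2 a, 0 < a & \forall q \near (d, p0), forall s, 0 < s ->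
    q.2.2 = s *: q.1 + b q.2.1 -> a * s ^+ 2 <= L q.2 - L (q.2.1, b q.2.1).
Proof.
move=> L2 Lb Ld; set D := 'D_(vert d) ('D_(vert d) L) p0 in Ld *.
have D2 : D / 2 < D by rewrite ltr_pdivrMr // ltr_pMr // ltr1n.
pose Q v p := D / 2 < 'D_(vert v) ('D_(vert v) L) p /\
   (differentiable L p /\ differentiable ('D_(vert v) L) p).
have Q_near : \forall q \near (d, p0), Q q.1 q.2.
  near=> q.
  have L2q : Ck_around 2 q.2 L.
    near: q; exact: (near_snd d (Ck_around_near L2)).
  split; first by near: q; exact: near_derive2_vert_gt.
  split; first exact: (Ck_around_differentiable L2q).
  exact: (Ck_around_differentiable (Ck_around_derive (vert q.1) L2q)).
(* On the second half of the segment the slope is at least [s / 2 * (D / 2)],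
   and that half has length [s / 2]; on the first half [L] does not decrease. *)
exists (D / 8); first exact: divr_gt0.
have := near_segment Q_near => seg.
have Lbq : \forall q \near (d, p0), forall v, 'D_(vert v) L
  (q.2.1, b q.2.1) = 0.
  exact: (near_snd d (near_fst (b t0) Lb)).
near=> q => s s0 qs.
have qQ : forall c, 0 <= c <= s -> Q q.1 (q.2.1, c *: q.1 + b q.2.1).
  have qseg : forall s, 0 <= s -> q.2.2 = s *: q.1 + b q.2.1 ->
    forall c, 0 <= c <= s -> Q q.1 (q.2.1, c *: q.1 + b q.2.1) by near: q.
  exact: qseg (ltW s0) qs.
have Lq : forall v, 'D_(vert v) L (q.2.1, b q.2.1) = 0 by near: q.
pose line c := (q.2.1, c *: q.1 + b q.2.1).
have lineE c : c *: vert q.1 + (q.2.1, b q.2.1) = line c by rewrite vert_line.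
have lineD c e : c *: vert q.1 + line e = line (c + e).
  by rewrite vert_line /line scalerDl addrA.
have slope c : 0 <= c <= s -> c * (D / 2) <= 'D_(vert q.1) L (line c).
  move=> /andP[c0 cs]; have [<-|c0'] := eqVneq 0 c.
    by rewrite mul0r -lineE scale0r add0r Lq.
  have {}c0 : 0 < c by rewrite lt_neqAle c0' c0.
  have [e|e /andP[e0 ec]] := @mvt_line R _ ('D_(vert q.1) L) (q.2.1, b q.2.1)
    (vert q.1) c c0.
    by rewrite lineE => /andP[e0 ec]; have [|_ []] := qQ e;
      rewrite ?e0 ?(le_trans ec).
  rewrite (lineE c) (lineE e) Lq subr0 => ->; apply: (ler_wpM2l (ltW c0)).
  have [|/ltW //] := qQ e; by rewrite (ltW e0) /= ltW // (lt_le_trans ec).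
have incr c e : 0 <= c -> 0 < e -> c + e <= s ->
    e * (c * (D / 2)) <= L (line (c + e)) - L (line c).
  move=> c0 e0 ces.
  have [x|x /andP[x0 xe]] := @mvt_line R _ L (line c) (vert q.1) e e0.
    move=> /andP[x0 xe]; rewrite lineD.
    by have [|_ []] := qQ (x + c);
      rewrite ?addr_ge0 //= (le_trans _ ces) // addrC lerD2l.
  rewrite (lineD e c) (lineD x c) [e + c]addrC => ->;
    apply: (ler_wpM2l (ltW e0)).
  apply: (le_trans _ (slope (x + c) _)).
    by apply: ler_wpM2r; [apply/ltW/divr_gt0|rewrite lerDr ltW].
  apply/andP; split; first by apply: addr_ge0 => //; exact: ltW.
  by apply: le_trans ces; rewrite addrC lerD2l ltW.
have s2 : 0 < s / 2 by exact: divr_gt0.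
have line0 : (q.2.1, b q.2.1) = line 0 by rewrite /line scale0r add0r.
have qE : q.2 = line s by rewrite /line -qs -surjective_pairing.
have := incr 0 (s / 2) (lexx _) s2; have := incr (s / 2) (s / 2) (ltW s2) s2.
rewrite add0r -splitr line0 => h1 h2; rewrite qE.
have := h1 (lexx _); have : s / 2 <= s by rewrite [leRHS]splitr lerDl ltW.
move=> /h2; rewrite mul0r mulr0 {h1 h2}.
move: (L (line s)) (L (line 0)) (L _) => x y z h1 h2; rewrite expr2; lra.
Unshelve. all: by end_near. Qed.

(** A point [p = (t, z)] with [z != b t] is written [z = b t + s *: d] with
    [`|d| = 1]. For each [d] of the unit sphere one of three cases gives the
    inequality near [(d, p0)]: a constraint [psi <= 0] violated to first order,
    so that no such point is in [C]; a first-order increase of [phi]; or a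
    function [L] below [phi] on [C] and equal to it on the graph of [b], where
    it is critical, with positive curvature in the direction [d]. The sphere
    being compact, finitely many of these neighbourhoods suffice. The constant
    [gamma] is part of the filter of the covering argument, which makes its
    choice uniform in [d]. *)
Theorem parametric_growth (C : set (T * V)) (phi : T * V -> R) :
  Ck_around 1 p0 phi ->
  (forall d, d != 0 ->
    [\/ exists psi : T * V -> R, [/\ Ck_around 1 p0 psi,
          \forall p \near p0, C p -> psi p <= 0,
          \forall t \near t0, 0 <= psi (t, b t) & 0 < 'D_(0, d) psi p0],
        0 < 'D_(0, d) phi p0 |
        exists L : T * V -> R, [/\ Ck_around 2 p0 L,
          \forall p \near p0, C p -> L p <= phi p,
          \forall t \near t0, L (t, b t) = phi (t, b t),
          \forall t \near t0, forall v, 'D_(0, v) L (t, b t) = 0 &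
          0 < 'D_(0, d) ('D_(0, d) L) p0]]) ->
  exists2 gamma, 0 < gamma & \forall p \near p0, C p ->
    phi (p.1, b p.1) + gamma * `|p.2 - b p.1| ^+ 2 <= phi p.
Proof.
move=> phi1 cases.
pose P (i : (T * V) * R) (d : V) := `|d| = 1 -> C i.1 -> forall s, 0 < s ->
  i.1.2 = s *: d + b i.1.1 ->
  i.2 * s ^+ 2 <= phi i.1 - phi (i.1.1, b i.1.1).
pose F := filter_prod (nbhs p0) (0 : R)^'+.
have comb d (A : set (V * (T * V))) (B : set R) :
    (\forall q \near (d, p0), A q) -> (\forall g \near 0^'+, B g) ->
    (forall q g, A q -> B g -> P (q.2, g) q.1) ->
    \forall d' \near d & i \near F, P i d'.
  move=> [[A1 A2] [/= A1d A2p] A12] Bg ABP.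
  exists (A1, [set i | A2 i.1 /\ B i.2]); first by split=> //=; exists (A2, B).
  move=> [d' [p g]] /= [A1d' [A2p' Bg']].
  by apply: (ABP (d', p)) => //; exact: A12.
have small : \forall q \near p0, `|q.2 - b q.1| <= 1.
  have half0 : 0 < 1 / 2 :> R by exact: divr_gt0.
  have bq : \forall q \near p0, ball (b t0) (1 / 2) (b q.1).
    have bt : \forall t \near t0, ball (b t0) (1 / 2) (b t).
      by apply: bc; exact: nbhsx_ballx.
    exact: (near_fst (b t0) bt).
  have zq : \forall q \near p0, ball (b t0) (1 / 2) q.2.
    exact: (near_snd t0 (nbhsx_ballx _ _ half0)).
  near=> q; rewrite -(subrK (b t0) q.2) -addrA;
    apply: le_trans (ler_normD _ _) _.
  have : ball (b t0) (1 / 2) q.2 by near: q.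
  have : ball (b t0) (1 / 2) (b q.1) by near: q.
  rewrite -!ball_normE /= distrC [`|b t0 - q.2|]distrC.
  by rewrite [`|b q.1 - _|]distrC; lra.
have near_all : \near F, [set d : V | `|d| = 1] `<=` P F.
  apply: (proj1 (compact_near_coveringP _) (@compact_sphere k) _ F P) =>
    d /= d1.
  have d0 : d != 0 by rewrite -normr_eq0 d1 oner_eq0.
  have [[psi [psi1 psiC psib psid]]|phid|[L [L2 LC Lb LD Ld]]] := cases d d0.
  - have [a a0 near_a] := near_first_order psi1 psid.
    apply: (comb _ [set q | (forall s, 0 < s -> q.2.2 = s *: q.1 + b q.2.1 ->
      a * s <= psi q.2 - psi (q.2.1, b q.2.1)) /\
      (C q.2 -> psi q.2 <= 0) /\ 0 <= psi (q.2.1, b q.2.1)] setT).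
    + near=> q; split; [|split]; near: q => //.
        exact: (near_snd d psiC).
      exact: (near_snd d (near_fst (b t0) psib)).
    + exact: filterT.
    + move=> q g [qa [qC qb]] _ _ /qC qC' s s0 qs; have := qa s s0 qs.
      have : 0 < a * s by exact: mulr_gt0.
      by move: qC' qb; lra.
  - have [a a0 near_a] := near_first_order phi1 phid.
    apply: (comb _ [set q | (forall s, 0 < s -> q.2.2 = s *: q.1 + b q.2.1 ->
      a * s <= phi q.2 - phi (q.2.1, b q.2.1)) /\ `|q.2.2 - b q.2.1| <= 1]
      [set g | 0 < g <= a]).
    + by near=> q; split; near: q => //; exact: (near_snd d small).
    + near=> g; apply/andP; split; near: g; first exact: nbhs_right_gt.
      exact: nbhs_right_le.
    + move=> [d' q] g [/= qa qs1] /= /andP[g0 ga] d'1 _ s s0 qs.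
      apply: le_trans (qa s s0 qs).
      move: qs1; rewrite qs addrK normrZ d'1 mulr1 gtr0_norm // => s1.
      rewrite /= expr2 mulrA; apply: ler_wpM2r; first exact: ltW.
      by apply: le_trans ga; rewrite ler_piMr // ltW.
  - have [a a0 near_a] := near_second_order L2 LD Ld.
    apply: (comb _ [set q | (forall s, 0 < s -> q.2.2 = s *: q.1 + b q.2.1 ->
      a * s ^+ 2 <= L q.2 - L (q.2.1, b q.2.1)) /\
      (C q.2 -> L q.2 <= phi q.2) /\
      L (q.2.1, b q.2.1) = phi (q.2.1, b q.2.1)] [set g | 0 < g <= a]).
    + near=> q; split; [|split]; near: q => //.
        exact: (near_snd d LC).
      exact: (near_snd d (near_fst (b t0) Lb)).
    + near=> g; apply/andP; split; near: g; first exact: nbhs_right_gt.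
      exact: nbhs_right_le.
    + move=> [d' q] g [/= qa [qC qL]] /= /andP[g0 ga] d'1 /qC Cq s s0 qs.
      rewrite -qL; apply: le_trans (_ : a * s ^+ 2 <= _).
        by rewrite ler_wpM2r // exprn_ge0 // ltW.
      by apply: le_trans (qa s s0 qs) _; rewrite lerD2r.
have [[A B] /= [Ap Bg] AB] := near_all.
have [g [g0 Bg']] : exists g, 0 < g /\ B g.
  by apply: (@filter_ex _ (0 : R)^'+); apply: filterI => //;
    exact: nbhs_right_gt.
exists g => //; near=> p => Cp.
have [pb|pb] := eqVneq p.2 (b p.1).
  rewrite pb subrr normr0 expr0n mulr0 addr0 -pb.
  by rewrite -(surjective_pairing p).
have s0 : 0 < `|p.2 - b p.1| by rewrite normr_gt0 subr_eq0.
rewrite -lerBrDl.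
have Ap' : A p by near: p.
apply: (AB (p, g) _ (`|p.2 - b p.1|^-1 *: (p.2 - b p.1))) => //=.
- by rewrite normrZ ger0_norm ?invr_ge0 // mulVf // gt_eqF.
- by rewrite normrZ ger0_norm ?invr_ge0 // mulVf // gt_eqF.
- by rewrite scalerA mulfV ?gt_eqF // scale1r subrK.
Unshelve. all: by end_near. Qed.

End Growth.

(** * Euclidean norm, projection and second derivatives *)

Section EuclideanNorm.
Context {R : realType}.
Implicit Types k : nat.

Lemma dotv_ge0 k (v : 'cV[R]_k) : 0 <= dotv v v.
Proof. by rewrite dotvE; apply: sumr_ge0 => i _; rewrite -expr2 sqr_ge0. Qed.

Lemma enorm_sqr k (v : 'cV[R]_k) : enorm v ^+ 2 = dotv v v.
Proof. by rewrite sqr_sqrtr // dotv_ge0. Qed.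

Lemma enorm_ge0 k (v : 'cV[R]_k) : 0 <= enorm v.
Proof. exact: sqrtr_ge0. Qed.

Lemma norm_le_enorm k (v : 'cV[R]_k) : `|v| <= enorm v.
Proof.
apply: mx_norm_le => [|i j]; first exact: enorm_ge0.
rewrite ord1 -sqrtr_sqr ler_wsqrtr // dotvE (bigD1 i) //= -expr2 lerDl.
by apply: sumr_ge0 => l _; rewrite -expr2 sqr_ge0.
Qed.

Lemma enorm_sqr_le k (v : 'cV[R]_k) : enorm v ^+ 2 <= k.+1%:R * `|v| ^+ 2.
Proof.
rewrite enorm_sqr dotvE; apply: (@le_trans _ _ (\sum_(i < k) `|v| ^+ 2)).
  apply: ler_sum => i _; rewrite -expr2 -real_normK ?num_real //.
  by rewrite lerXn2r ?nnegrE ?le_mx_norm.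
by rewrite sumr_const card_ord -[leLHS]mulr_natl ler_wpM2r ?sqr_ge0 // ler_nat.
Qed.

Lemma enorm_le k (v : 'cV[R]_k) : enorm v <= k.+1%:R * `|v|.
Proof.
rewrite -(@ler_pXn2r _ 2) ?nnegrE ?enorm_ge0 ?mulr_ge0 //.
apply: le_trans (enorm_sqr_le v) _; rewrite exprMn ler_wpM2r ?sqr_ge0 //.
by rewrite expr2 -natrM ler_nat leq_pmull.
Qed.

Lemma enorm0 k : enorm (0 : 'cV[R]_k) = 0.
Proof.
by apply/eqP;
  rewrite eq_le enorm_ge0 andbT (le_trans (enorm_le 0)) // normr0 mulr0.
Qed.

Lemma near_enorm_le k (z : 'cV[R]_k) (e : R) : 0 < e ->
  \forall x \near z, enorm (x - z) <= e.
Proof.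
move=> e0; apply/nbhs_ballP; exists (e / k.+1%:R) => /=; first exact: divr_gt0.
move=> x; rewrite -ball_normE /= distrC => xz; apply: le_trans (enorm_le _) _.
by rewrite mulrC -ler_pdivlMr // ltW.
Qed.

(** The topology is that of the sup norm while the conclusions speak of
    Euclidean balls; small Euclidean balls are contained in every
    neighbourhood. *)
Lemma near_cball k (z : 'cV[R]_k) (P : set 'cV[R]_k) :
  (\forall x \near z, P x) -> exists2 e, 0 < e & cball z e `<=` P.
Proof.
move=> /nbhs_ballP [e /= e0 eP]; exists (e / 2); first exact: divr_gt0.
move=> x; rewrite /cball /= => xz; apply: eP; rewrite -ball_normE /= distrC.
by apply: le_lt_trans (norm_le_enorm _) _; apply: le_lt_trans xz _;
  rewrite ltr_pdivrMr // ltr_pMr // ltr1n.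
Qed.

Lemma enorm_continuous k : continuous (@enorm R k).
Proof.
move=> x; apply: (@continuous_comp _ _ _ (fun v : 'cV[R]_k =>
  dotv v v) Num.sqrt).
  apply: (@Ck_around_cont _ 0 _ _ x (fun v => dotv v v)).
  by apply: Ck_around_dotv; exact: Ck_around_id.
exact: sqrt_continuous.
Qed.

Lemma open_enorm_ball k (z : 'cV[R]_k) (e : R) : open
    [set x | enorm (x - z) < e].
Proof.
apply: (@open_comp _ _ (fun x : 'cV[R]_k => enorm (x - z)) [set t | t < e]);
  last exact: open_lt.
move=> x _; apply: (@continuous_comp _ _ _ (fun x : 'cV[R]_k => x - z)
  (@enorm R k)); last exact: enorm_continuous.
by apply: (@Ck_around_cont _ 0); apply: Ck_aroundD;
  [exact: Ck_around_id|exact: Ck_around_cst].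
Qed.

(** The squared distance is a sum over the entries, so the projection is
    computed entry by entry; a strictly smaller distance in one entry would give
    a strictly smaller sum. *)
Lemma proj_nonposE k (v : 'cV[R]_k) : proj_nonpos v = \col_i Num.min (v i 0) 0.
Proof.
set p := \col_i _.
have pv (w : 'cV[R]_k) : nonpos w -> forall i, (v i 0 - p i 0) ^+ 2 <=
  (v i 0 - w i 0) ^+ 2.
  move=> w0 i; rewrite mxE; have := w0 i; case: (leP (v i 0) 0) => [vi|vi] wi.
    by rewrite subrr expr0n sqr_ge0.
  by rewrite subr0 lerXn2r ?nnegrE; lra.
have d2 (w : 'cV[R]_k) : dotv (v - w) (v - w) = \sum_i (v i 0 - w i 0) ^+ 2.
  by rewrite dotvE; apply: eq_bigr => i _; rewrite !mxE expr2.
have pargmin : argmin (fun w => enorm (v - w)) [set w | nonpos w] p.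
  split=> [i|w w0]; first by rewrite mxE ge_min lexx orbT.
  by rewrite ler_wsqrtr // !d2; apply: ler_sum => i _; exact: pv.
have [q0 qmin] := getPex (ex_intro _ p pargmin).
have := qmin _ (proj1 pargmin).
rewrite -[get _]/(proj_nonpos v) -(@ler_pXn2r _ 2) ?nnegrE ?enorm_ge0 //.
rewrite !enorm_sqr !d2; set q := proj_nonpos v => qp.
have qi i : (v i 0 - q i 0) ^+ 2 - (v i 0 - p i 0) ^+ 2 = 0.
  have := @psumr_eq0P R 'I_k predT
    (fun i => (v i 0 - q i 0) ^+ 2 - (v i 0 - p i 0) ^+ 2); apply=> //.
    by move=> j _; rewrite subr_ge0 pv.
  apply/eqP; rewrite sumrB eq_le subr_le0 qp /= subr_ge0.
  by apply: ler_sum => j _; exact: pv.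
apply/colP => i; have /eqP := qi i; rewrite subr_eq0 mxE; have := q0 i.
case: (leP (v i 0) 0) => vi qi0.
  by rewrite subrr expr0n sqrf_eq0 subr_eq0 => /eqP.
by rewrite subr0 eqf_sqr => /orP[] /eqP; lra.
Qed.

End EuclideanNorm.

Section Slices.
Context {R : realType}.
Implicit Types U V W : normedModType R.

Lemma is_diff_pairl U V (x : U) (v : V) :
  is_diff x (fun x => (x, v)) (fun x : U => (x, 0 : V)).
Proof.
have l : linear (fun x : U => (x, 0 : V)).
  by move=> a b c; apply/pair_equal_spec; split; rewrite /= ?scaler0 ?addr0.
pose L : {linear U -> (U * V)%type} := HB.pack (fun x : U => (x, 0 : V))
  (GRing.isLinear.Build _ _ _ _ _ l).
apply: (is_diff_affine (l := L)) => [z|z h]; last first.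
  by apply/pair_equal_spec; split; rewrite /= ?addr0 // addrC.
by apply: cvg_pair; [exact: cvg_id|exact: cvg_cst].
Qed.

Lemma is_diff_pairr U V (u : U) (x : V) :
  is_diff x (fun x => (u, x)) (fun x : V => (0 : U, x)).
Proof.
have l : linear (fun x : V => (0 : U, x)).
  by move=> a b c; apply/pair_equal_spec; split; rewrite /= ?scaler0 ?addr0.
pose L : {linear V -> (U * V)%type} := HB.pack (fun x : V => (0 : U, x))
  (GRing.isLinear.Build _ _ _ _ _ l).
apply: (is_diff_affine (l := L)) => [z|z h]; last first.
  by apply/pair_equal_spec; split; rewrite /= ?addr0 // addrC.
by apply: cvg_pair; [exact: cvg_cst|exact: cvg_id].
Qed.

Lemma derive_affine U V W (a l : U -> V) (f : V -> W) (x d : U) :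
  is_diff x a l -> differentiable f (a x) ->
  'D_d (fun z => f (a z)) x = 'D_(l d) f (a x).
Proof.
move=> al fd; have ad : differentiable a x by exact: ex_diff.
by rewrite derive_comp // [in 'D_d a x]deriveE // diff_val.
Qed.

Lemma derive_dotv U k (f g : U -> 'cV[R]_k) (x d : U) :
  differentiable f x -> differentiable g x ->
  'D_d (fun z => dotv (f z) (g z)) x =
  dotv ('D_d f x) (g x) + dotv (f x) ('D_d g x).
Proof.
move=> fd gd.
have -> : (fun z => dotv (f z) (g z)) =
    \sum_i ((fun z => f z i 0 : R) * (fun z => g z i 0 : R) : U -> R).
  by apply/funext => z; rewrite dotvE fct_sumE.
rewrite derive_sum; last first.
  by move=> i; apply: derivableM; apply: diff_derivable;
    exact: differentiable_entry.
rewrite !dotvE -big_split; apply: eq_bigr => i _ /=.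
rewrite deriveM; [|by apply: diff_derivable; exact: differentiable_entry..].
by rewrite !derive_entry // /GRing.scale /= addrC [g x i 0 * _]mulrC.
Qed.

Lemma hess_near_eq k (f g : 'cV[R]_k -> R) (x d : 'cV[R]_k) :
  Ck_around 2 x f -> (\forall z \near x, f z = g z) ->
  quad_form (hess f x) d = quad_form (hess g x) d.
Proof.
move=> f2 fg; have g2 := Ck_around_ext fg f2.
transitivity ('D_d ('D_d f) x); first exact: quad_form_hess.
transitivity ('D_d ('D_d g) x); last by apply: esym; exact: quad_form_hess.
apply: near_eq_derive; have := near_join fg; apply: filterS => z.
exact: near_eq_derive.
Qed.

(** In the second derivative of [f \o w] the second derivative of [w] appears
    only through its product with the gradient of [f], which vanishes here. *)
Lemma hess_comp_critical k l (w : 'cV[R]_k -> 'cV[R]_l) (f : 'cV[R]_l -> R)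
    (x d : 'cV[R]_k) :
  Ck_around 2 x w -> Ck_around 2 (w x) f -> grad f (w x) = 0 ->
  quad_form (hess (fun z => f (w z)) x) d =
  quad_form (hess f (w x)) ('D_d w x).
Proof.
move=> w2 f2 f0; rewrite quad_form_hess; last exact: Ck_around_comp.
have Dfw : \forall z \near x, 'D_d (fun z => f (w z)) z =
  dotv ('D_d w z) (grad f (w z)).
  have wz : \forall z \near x, differentiable f (w z).
    exact: (Ck_around_cont w2 (Ck_around_near_differentiable f2)).
  near=> z.
  have wd : differentiable w z.
    by near: z; exact: Ck_around_near_differentiable w2.
  have fd : differentiable f (w z) by near: z.
  by rewrite derive_comp // derive_grad // dotvC.
have wd := Ck_around_differentiable w2.
have gd : differentiable (grad f) (w x).
  exact: Ck_around_differentiable (Ck_around_grad f2).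
rewrite (near_eq_derive _ Dfw) derive_dotv; last first.
- exact: differentiable_comp.
- exact: Ck_around_differentiable (Ck_around_derive d w2).
rewrite f0 [dotv _ 0]dotvC {1}/dotv trmx0 mul0mx mxE add0r.
rewrite (@derive_comp _ _ _ _ w (grad f)) //.
by move: ('D_d w x) => v; rewrite derive_jac // /dotv /quad_form mulmxA.
Unshelve. all: by end_near. Qed.

Lemma grad_eq0P k (f : 'cV[R]_k -> R) (x : 'cV[R]_k) : differentiable f x ->
  grad f x = 0 <-> forall v, 'D_v f x = 0.
Proof.
move=> fd; split=> [f0 v|f0]; last by apply/colP => i; rewrite !mxE f0.
by rewrite derive_grad // f0 /dotv trmx0 mul0mx mxE.
Qed.

End Slices.

(** * Block vectors and the variable of (FP) *)

Section Blocks.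
Context {R : realType}.
Implicit Types U V W : normedModType R.

Lemma Ck_around_linear k (V : normedModType R) l (f : 'cV[R]_l -> V)
    (x : 'cV[R]_l) :
  linear f -> Ck_around k x f.
Proof.
move=> lf; apply: (@Ck_around_affine _ k _ _ _ x f f id);
  last exact: Ck_around_id.
by move=> z; apply: is_diff_affine_cV => // y h;
  rewrite -[h]scale1r lf !scale1r addrC.
Qed.

Lemma Ck_around_col_mx k V a b (z : V) (f : V -> 'cV[R]_a) (g : V -> 'cV[R]_b) :
  Ck_around k z f -> Ck_around k z g -> Ck_around k z
    (fun x => col_mx (f x) (g x)).
Proof.
move=> /Ck_around_mxP fk /Ck_around_mxP gk; apply/Ck_around_mxP => i j.
case: (split_ordP i) => l ->.
  by apply: Ck_around_eq (fk l j) => x; rewrite col_mxEu.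
by apply: Ck_around_eq (gk l j) => x; rewrite col_mxEd.
Qed.

Lemma Ck_around_compmx k V l a b (z : V) (f : V -> 'cV[R]_l)
    (g : 'cV[R]_l -> 'M[R]_(a, b)) :
  Ck_around k z f -> Ck_around k (f z) g -> Ck_around k z (fun x => g (f x)).
Proof.
move=> fk /Ck_around_mxP gk; apply/Ck_around_mxP => i j.
exact: (Ck_around_comp (g := fun x => g x i j) fk (gk i j)).
Qed.

Lemma Ck_around_snd k (U V W : normedModType R) (u : U) (v : V) (f : V -> W) :
  Ck_around k v f -> Ck_around k (u, v) (fun q : U * V => f q.2).
Proof.
move=> fk; have := @Ck_around_affine R k _ _ _ (u, v) snd snd f
  (@is_diff_snd R U V).
exact.
Qed.

Lemma Ck_around_fst k (U V W : normedModType R) (u : U) (v : V) (f : U -> W) :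
  Ck_around k u f -> Ck_around k (u, v) (fun q : U * V => f q.1).
Proof.
move=> fk; have := @Ck_around_affine R k _ _ _ (u, v) fst fst f
  (@is_diff_fst R U V).
exact.
Qed.

Lemma differentiable_col_mx V a b (z : V) (f : V -> 'cV[R]_a)
    (g : V -> 'cV[R]_b) :
  differentiable f z -> differentiable g z ->
  differentiable (fun x => col_mx (f x) (g x)) z.
Proof.
move=> fd gd; apply: differentiable_mxP => i j; case: (split_ordP i) => l ->.
  rewrite (_ : (fun x => _) = fun x => f x l j); last by apply/funext => x;
    rewrite col_mxEu.
  apply: (@differentiable_comp _ _ _ _ f (fun M : 'cV[R]_a => M l j : R)) => //.
  exact: differentiable_coord.
rewrite (_ : (fun x => _) = fun x => g x l j); last by apply/funext => x;
  rewrite col_mxEd.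
apply: (@differentiable_comp _ _ _ _ g (fun M : 'cV[R]_b => M l j : R)) => //.
exact: differentiable_coord.
Qed.

Lemma derive_col_mx V a b (z d : V) (f : V -> 'cV[R]_a) (g : V -> 'cV[R]_b) :
  differentiable f z -> differentiable g z ->
  'D_d (fun x => col_mx (f x) (g x)) z = col_mx ('D_d f z) ('D_d g z).
Proof.
move=> fd gd; have fgd := differentiable_col_mx fd gd.
apply/colP => i; rewrite -derive_entry //; case: (split_ordP i) => l ->.
  rewrite col_mxEu -derive_entry //; congr ('D_d _ z); apply/funext => x.
  by rewrite col_mxEu.
rewrite col_mxEd -derive_entry //; congr ('D_d _ z); apply/funext => x.
by rewrite col_mxEd.
Qed.

Lemma differentiable_slicer U V W (f : U * V -> W) (x : U) (y : V) :
  differentiable f (x, y) -> differentiable (fun z => f (x, z)) y.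
Proof.
move=> fd; have ad := is_diff_pairr x y.
by apply: (@differentiable_comp _ _ _ _ (fun z => (x, z)) f); [exact: ex_diff|].
Qed.

Lemma differentiable_slicel U V W (f : U * V -> W) (x : U) (y : V) :
  differentiable f (x, y) -> differentiable (fun z => f (z, y)) x.
Proof.
move=> fd; have ad := is_diff_pairl x y.
by apply: (@differentiable_comp _ _ _ _ (fun z => (z, y)) f); [exact: ex_diff|].
Qed.

Lemma derive_pair U V W (f : U * V -> W) (x a : U) (y b : V) :
  differentiable f (x, y) ->
  'D_(a, b) f (x, y) = 'D_a (fun z => f (z, y)) x + 'D_b (fun z => f (x, z)) y.
Proof.
move=> fd; rewrite (derive_affine _ (is_diff_pairl x y)) //.
rewrite (derive_affine _ (is_diff_pairr x y)) // !deriveE // -linearD.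
by congr ('d f (x, y) _); apply/pair_equal_spec; rewrite /= addr0 add0r.
Qed.

Lemma dotv_mulmxr k l (a : 'cV[R]_l) (M : 'M[R]_(l, k)) (v : 'cV[R]_k) :
  dotv a (M *m v) = dotv (M^T *m a) v.
Proof. by rewrite /dotv trmx_mul trmxK mulmxA. Qed.

Lemma dotv_delta k (a : 'cV[R]_k) i : dotv a (delta_mx i 0) = a i 0.
Proof.
rewrite dotvE (bigD1 i) //= mxE !eqxx mulr1 big1 ?addr0 // => j ji.
by rewrite mxE (negbTE ji) mulr0.
Qed.

Lemma dotvDl k (a b v : 'cV[R]_k) : dotv (a + b) v = dotv a v + dotv b v.
Proof. by rewrite /dotv linearD mulmxDl mxE. Qed.

Lemma dotvDr k (a b v : 'cV[R]_k) : dotv v (a + b) = dotv v a + dotv v b.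
Proof. by rewrite /dotv mulmxDr mxE. Qed.

Lemma dotv0l k (v : 'cV[R]_k) : dotv 0 v = 0.
Proof. by rewrite /dotv trmx0 mul0mx mxE. Qed.

Lemma dotv0r k (v : 'cV[R]_k) : dotv v 0 = 0.
Proof. by rewrite dotvC dotv0l. Qed.

Lemma dotv_col_mx a b (u u' : 'cV[R]_a) (v v' : 'cV[R]_b) :
  dotv (col_mx u v) (col_mx u' v') = dotv u u' + dotv v v'.
Proof. by rewrite /dotv tr_col_mx mul_row_col mxE. Qed.

End Blocks.

Section Pack.
Context {R : realType} {n m r s : nat}.
Local Notation U := 'cV[R]_(n + (m + (r + s))).

Lemma ux_pack (x : 'cV[R]_n) (y : 'cV[R]_m) (mu : 'cV[R]_r) (xi : 'cV[R]_s) :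
  ux (pack x y mu xi) = x.
Proof. by rewrite /ux /pack col_mxKu. Qed.

Lemma uy_pack (x : 'cV[R]_n) (y : 'cV[R]_m) (mu : 'cV[R]_r) (xi : 'cV[R]_s) :
  uy (pack x y mu xi) = y.
Proof. by rewrite /uy /pack col_mxKd col_mxKu. Qed.

Lemma umu_pack (x : 'cV[R]_n) (y : 'cV[R]_m) (mu : 'cV[R]_r) (xi : 'cV[R]_s) :
  umu (pack x y mu xi) = mu.
Proof. by rewrite /umu /pack !col_mxKd col_mxKu. Qed.

Lemma uxi_pack (x : 'cV[R]_n) (y : 'cV[R]_m) (mu : 'cV[R]_r) (xi : 'cV[R]_s) :
  uxi (pack x y mu xi) = xi.
Proof. by rewrite /uxi /pack !col_mxKd. Qed.

Definition packE := (ux_pack, uy_pack, umu_pack, uxi_pack).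

Lemma pack_eta (u : U) : pack (ux u) (uy u) (umu u) (uxi u) = u.
Proof. by rewrite /pack /ux /uy /umu /uxi !vsubmxK. Qed.

Lemma pack_add x x' y y' mu mu' xi xi' :
  pack x y mu xi + pack x' y' mu' xi' = pack (x + x') (y + y') (mu + mu')
    (xi + xi') :> U.
Proof. by rewrite /pack !add_col_mx. Qed.

Lemma pack_scale c x y mu xi :
  c *: pack x y mu xi = pack (c *: x) (c *: y) (c *: mu) (c *: xi) :> U.
Proof. by rewrite /pack !scale_col_mx. Qed.

Lemma pack0 : pack 0 0 0 0 = 0 :> U.
Proof. by rewrite /pack !col_mx0. Qed.

Lemma linear_ux : linear (ux : U -> _).
Proof.
by move=> a u v; rewrite /ux linearP.
Qed.
Lemma linear_uy : linear (uy : U -> _).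
Proof.
by move=> a u v; rewrite /uy !linearP.
Qed.
Lemma linear_umu : linear (umu : U -> _).
Proof.
by move=> a u v; rewrite /umu !linearP.
Qed.
Lemma linear_uxi : linear (uxi : U -> _).
Proof.
by move=> a u v; rewrite /uxi !linearP.
Qed.

Lemma is_diff_uxy (u : U) : is_diff u (fun u : U => (ux u, uy u))
    (fun u : U => (ux u, uy u)).
Proof.
apply: is_diff_affine_cV => [a v w|v w].
  by apply/pair_equal_spec; rewrite linear_ux linear_uy.
by apply/pair_equal_spec; rewrite /ux /uy !linearD /= [ux w + _]addrC
  [uy w + _]addrC.
Qed.

Lemma Ck_around_uxy k (W : normedModType R)
    (f : 'cV[R]_n * 'cV[R]_m -> W) (u : U) :
  Ck_around k (ux u, uy u) f -> Ck_around k u (fun u => f (ux u, uy u)).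
Proof. exact: (Ck_around_affine is_diff_uxy). Qed.

Lemma is_diff_packx y mu xi (x : 'cV[R]_n) :
  is_diff x (fun z => pack z y mu xi : U) (fun z => pack z 0 0 0).
Proof.
apply: is_diff_affine_cV => [a v w|v w];
  by rewrite ?pack_scale pack_add ?scaler0 ?addr0 // [w + v]addrC.
Qed.

Lemma is_diff_packy x mu xi (y : 'cV[R]_m) :
  is_diff y (fun z => pack x z mu xi : U) (fun z => pack 0 z 0 0).
Proof.
apply: is_diff_affine_cV => [a v w|v w];
  by rewrite ?pack_scale pack_add ?scaler0 ?addr0 // [w + v]addrC.
Qed.

(** The differential is linear and [d] is the sum of its four components. This
    turns derivatives in the single variable of (FP) into the partial Jacobians
    in which the data of the problem are expressed. *)
Lemma derive_pack (W : normedModType R) (f : U -> W) x y mu xi (d : U) :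
  differentiable f (pack x y mu xi) ->
  'D_d f (pack x y mu xi) =
    'D_(ux d) (fun z => f (pack z y mu xi)) x
  + 'D_(uy d) (fun z => f (pack x z mu xi)) y
  + 'D_(umu d) (fun z => f (pack x y z xi)) mu
  + 'D_(uxi d) (fun z => f (pack x y mu z)) xi.
Proof.
move=> fd.
have dx := is_diff_packx y mu xi x; have dy := is_diff_packy x mu xi y.
have dmu : is_diff mu (fun z => pack x y z xi : U) (fun z => pack 0 0 z 0).
  by apply: is_diff_affine_cV => [a v w|v w];
    rewrite ?pack_scale pack_add ?scaler0 ?addr0 // [w + v]addrC.
have dxi : is_diff xi (fun z => pack x y mu z : U) (fun z => pack 0 0 0 z).
  by apply: is_diff_affine_cV => [a v w|v w];
    rewrite ?pack_scale pack_add ?scaler0 ?addr0 // [w + v]addrC.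
rewrite (derive_affine _ dx) // (derive_affine _ dy) //
  (derive_affine _ dmu) //.
rewrite (derive_affine _ dxi) // !deriveE // -!linearD /= !pack_add.
by rewrite !addr0 !add0r pack_eta.
Qed.

End Pack.

(** * The lower-level KKT conditions as a smooth square system *)

Section KKTSystem.
Context {R : realType} {n m p q r s : nat} (P : bilevel R n m p q r s).
Variables (xs : 'cV[R]_n) (ys : 'cV[R]_m) (mus : 'cV[R]_r) (xis : 'cV[R]_s).
Local Notation U := 'cV[R]_(n + (m + (r + s))).
Local Notation us := (pack xs ys mus xis).
Local Notation f2 := (fun z : 'cV[R]_n * 'cV[R]_m => bf P z.1 z.2).
Local Notation h2 := (fun z : 'cV[R]_n * 'cV[R]_m => bh P z.1 z.2).
Local Notation g2 := (fun z : 'cV[R]_n * 'cV[R]_m => bg P z.1 z.2).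
Local Notation active i := (bg P xs ys i 0 == 0).

(** The complementarity row of index [i] is [g_i] when [i] is active at the base
    point and [- xi_i] otherwise. Both are values of [g - proj (g + xi)], which
    is why the sign of [xi_i] is reversed. *)
Definition kkt_system (u : U) : 'cV[R]_(m + (r + s)) :=
  col_mx (stat_FP P u) (col_mx (bh P (ux u) (uy u))
    (\col_i (if active i then bg P (ux u) (uy u) i 0 else - uxi u i 0))).

Definition lower_diff (z : 'cV[R]_n * 'cV[R]_m) : Prop :=
  [/\ differentiable f2 z, differentiable h2 z & differentiable g2 z].

Lemma derive_lagr x y mu xi v : lower_diff (x, y) ->
  'D_v (fun z => lagr P x z mu xi) y =
  'D_v (bf P x) y + dotv mu ('D_v (bh P x) y) + dotv xi ('D_v (bg P x) y).
Proof.
move=> [fd hd gd].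
have fd' := differentiable_slicer fd; have hd' := differentiable_slicer hd.
have gd' := differentiable_slicer gd; rewrite /= in fd' hd' gd'.
have dd k (a : 'cV[R]_k) (e : 'cV[R]_m -> 'cV[R]_k) : differentiable e y ->
    derivable (fun z => dotv a (e z)) y v /\
    'D_v (fun z => dotv a (e z)) y = dotv a ('D_v e y).
  move=> ed; split; last first.
    rewrite (@derive_dotv _ _ _ (fun=> a) e) //.
    by rewrite derive_cst dotv0l add0r.
  apply: diff_derivable.
  rewrite (_ : (fun z => _) = \sum_i (a i 0 *: (fun z => e z i 0 : R))).
    apply: differentiable_sum => i; apply: differentiableZ.
    exact: differentiable_entry.
  by apply/funext => z; rewrite dotvE fct_sumE.
have [h1 h2'] := dd _ mu _ hd'; have [g1 g2'] := dd _ xi _ gd'.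
have f1 : derivable (bf P x) y v by exact: diff_derivable.
rewrite /lagr deriveD //; last exact: derivableD.
by rewrite deriveD // h2' g2'.
Qed.

Lemma grad_y_lagrE x y mu xi : lower_diff (x, y) ->
  grad_y_lagr P x y mu xi =
  grad (bf P x) y + (jac (bh P x) y)^T *m mu + (jac (bg P x) y)^T *m xi.
Proof.
move=> ld; have [fd hd gd] := ld.
have hd' := differentiable_slicer hd; have gd' := differentiable_slicer gd.
rewrite /= in hd' gd'.
apply/colP => i; rewrite /grad_y_lagr mxE derive_lagr // !derive_jac //.
by rewrite !dotv_mulmxr !dotv_delta !mxE.
Qed.

Lemma derive_h u d : lower_diff (ux u, uy u) ->
  'D_d (fun u : U => bh P (ux u) (uy u)) u =
  jac (fun x => bh P x (uy u)) (ux u) *m ux d +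
    jac (bh P (ux u)) (uy u) *m uy d.
Proof.
move=> [_ hd _]; rewrite (@derive_affine _ _ _ _ _ _ h2 _ _ (is_diff_uxy u)) //.
have dl := differentiable_slicel hd; have dr := differentiable_slicer hd.
by rewrite /= in dl dr; rewrite derive_pair // !derive_jac.
Qed.

Lemma derive_g u d : lower_diff (ux u, uy u) ->
  'D_d (fun u : U => bg P (ux u) (uy u)) u =
  jac (fun x => bg P x (uy u)) (ux u) *m ux d +
    jac (bg P (ux u)) (uy u) *m uy d.
Proof.
move=> [_ _ gd]; rewrite (@derive_affine _ _ _ _ _ _ g2 _ _ (is_diff_uxy u)) //.
have dl := differentiable_slicel gd; have dr := differentiable_slicer gd.
by rewrite /= in dl dr; rewrite derive_pair // !derive_jac.
Qed.

(** The stationarity row is affine in the multipliers, which gives the last two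
    blocks. *)
Lemma derive_stat x y mu xi (d : U) : lower_diff (x, y) ->
  differentiable (stat_FP P) (pack x y mu xi) ->
  'D_d (stat_FP P) (pack x y mu xi) =
    jac (fun x => grad_y_lagr P x y mu xi) x *m ux d
  + hess (fun z => lagr P x z mu xi) y *m uy d
  + (jac (bh P x) y)^T *m umu d + (jac (bg P x) y)^T *m uxi d.
Proof.
move=> ld sd.
have sx : differentiable (fun z => stat_FP P (pack z y mu xi)) x.
  apply: (@differentiable_comp _ _ _ _ (fun z => pack z y mu xi)
    (stat_FP P)) => //.
  by have dx := is_diff_packx y mu xi x; exact: ex_diff.
have sy : differentiable (fun z => stat_FP P (pack x z mu xi)) y.
  apply: (@differentiable_comp _ _ _ _ (fun z => pack x z mu xi)
    (stat_FP P)) => //.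
  by have dy := is_diff_packy x mu xi y; exact: ex_diff.
rewrite derive_pack // [in 'D_(ux d) _ x]derive_jac //.
rewrite [in 'D_(uy d) _ y]derive_jac //.
have dlin k (M : 'M[R]_(m, k)) (c e : 'cV[R]_m) z v :
    'D_v (fun z => c + M *m z + e) z = M *m v.
  have dl : is_diff z (fun z => c + M *m z + e) (mulmx M).
    apply: is_diff_affine_cV => [a x' y'|a b];
      first by rewrite mulmxDr -scalemxAr.
    by rewrite mulmxDr -!addrA; congr (_ + _); rewrite addrC -!addrA;
      congr (_ + _); rewrite addrC.
  by rewrite deriveE ?diff_val //; exact: ex_diff.
have -> : (fun z => stat_FP P (pack z y mu xi)) =
    (fun x => grad_y_lagr P x y mu xi).
  by apply/funext => z; rewrite /stat_FP !packE.
have -> : (fun z => stat_FP P (pack x z mu xi)) =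
    grad (fun z => lagr P x z mu xi).
  by apply/funext => z; rewrite /stat_FP !packE.
have -> : (fun z => stat_FP P (pack x y z xi)) = (fun z => grad (bf P x) y +
    (jac (bh P x) y)^T *m z + (jac (bg P x) y)^T *m xi).
  by apply/funext => z; rewrite /stat_FP !packE grad_y_lagrE.
have -> : (fun z => stat_FP P (pack x y mu z)) = (fun z => (grad (bf P x) y +
    (jac (bh P x) y)^T *m mu) + (jac (bg P x) y)^T *m z + 0).
  by apply/funext => z; rewrite /stat_FP !packE grad_y_lagrE // addr0.
by rewrite !dlin.
Qed.

Lemma differentiable_lower u : lower_diff (ux u, uy u) ->
  differentiable (fun u : U => bh P (ux u) (uy u)) u /\
  differentiable (fun u : U => bg P (ux u) (uy u)) u.
Proof.
move=> [_ hd gd]; have ud := is_diff_uxy u; split.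
  by apply: (@differentiable_comp _ _ _ _ (fun u : U => (ux u, uy u)) h2) => //;
    exact: ex_diff.
by apply: (@differentiable_comp _ _ _ _ (fun u : U => (ux u, uy u)) g2) => //;
  exact: ex_diff.
Qed.

Lemma derive_kkt_system u d :
  lower_diff (ux u, uy u) -> differentiable (stat_FP P) u ->
  'D_d kkt_system u =
  col_mx ('D_d (stat_FP P) u) (col_mx ('D_d (fun u : U => bh P (ux u) (uy u)) u)
   (\col_i (if active i then 'D_d (fun u : U => bg P (ux u) (uy u)) u i 0
            else - uxi d i 0))).
Proof.
move=> ld sd; have [hd gd] := differentiable_lower ld.
pose c3 (u : U) : 'cV[R]_s :=
  \col_i (if active i then bg P (ux u) (uy u) i 0 else - uxi u i 0).
have lxi i :
    is_diff u (fun u : U => - uxi u i 0 : R) (fun u : U => - uxi u i 0 : R).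
  apply: is_diff_affine_cV => [a v w|v w].
    rewrite linear_uxi; move: (uxi v) (uxi w) => v' w'.
    by rewrite !mxE /GRing.scale /=; ring.
  have := linear_uxi 1 w v; rewrite !scale1r => ->.
  move: (uxi v) (uxi w) => v' w'.
  by rewrite !mxE; ring.
have c3d i : differentiable (fun u => c3 u i 0 : R) u /\
   'D_d (fun u => c3 u i 0 : R) u =
     if active i then 'D_d (fun u : U => bg P (ux u) (uy u)) u i 0
     else - uxi d i 0.
  rewrite (_ : (fun u => _) =
    fun u => if active i then bg P (ux u) (uy u) i 0 else - uxi u i 0 : R);
    last first.
    by apply/funext => v; rewrite mxE.
  case: (active i); first split.
  - exact: differentiable_entry.
  - by rewrite derive_entry.
  - have lxii := lxi i; split; first exact: ex_diff.
    by rewrite deriveE ?diff_val //; exact: ex_diff.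
have c3d' : differentiable c3 u.
  by apply: differentiable_mxP => i j; rewrite ord1; have [] := c3d i.
rewrite [LHS]derive_col_mx //; last exact: differentiable_col_mx.
rewrite derive_col_mx //; congr (col_mx _ (col_mx _ _)).
by apply/colP => i; rewrite -derive_entry // mxE; have [] := c3d i.
Qed.

Hypothesis smoothP : smooth_around P xs ys.

Lemma near_lower_diff : \forall z \near (xs, ys), lower_diff z.
Proof.
have [[fC gC hC] _ _] := smoothP.
near=> z; split; near: z.
- exact: (Ck_around_near_differentiable fC).
- exact: (Ck_around_near_differentiable hC).
- exact: (Ck_around_near_differentiable gC).
Unshelve. all: by end_near. Qed.

Lemma near_uxy (Q : set ('cV[R]_n * 'cV[R]_m)) (u0 : U) :
  (\forall z \near (ux u0, uy u0), Q z) -> \forall u \near u0, Q (ux u, uy u).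
Proof.
have uc : {for u0, continuous (fun u : U => (ux u, uy u))}.
  by apply: (@Ck_around_cont _ 0); exact: (Ck_around_uxy (Ck_around_id 0 _)).
exact: uc.
Qed.

(** Expanding the gradient of the Lagrangian reduces the claim to [grad f],
    [jac h] and [jac g], whose smoothness is assumed. *)
Lemma Ck_around_stat : Ck_around 2 us (stat_FP P).
Proof.
have [_ [fC gC hC] _] := smoothP.
have uE : (ux us, uy us) = (xs, ys) by rewrite !packE.
have Ck_lin k (l : U -> 'cV[R]_k) : linear l -> Ck_around 2 us l
  by exact: Ck_around_linear.
have : Ck_around 2 us (fun u => grad (bf P (ux u)) (uy u) +
    (jac (bh P (ux u)) (uy u))^T *m umu u +
      (jac (bg P (ux u)) (uy u))^T *m uxi u).
  apply: Ck_aroundD; first apply: Ck_aroundD.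
  - by apply: (Ck_around_uxy (f := fun z => grad (bf P z.1) z.2)); rewrite uE.
  - apply: Ck_around_mulmx; last by apply: Ck_lin; exact: linear_umu.
    apply: Ck_around_tr;
      apply: (Ck_around_uxy (f := fun z => jac (bh P z.1) z.2)).
    by rewrite uE.
  - apply: Ck_around_mulmx; last by apply: Ck_lin; exact: linear_uxi.
    apply: Ck_around_tr;
      apply: (Ck_around_uxy (f := fun z => jac (bg P z.1) z.2)).
    by rewrite uE.
apply: Ck_around_ext; have : \forall u \near us, lower_diff (ux u, uy u).
  by apply: near_uxy; rewrite uE; exact: near_lower_diff.
by apply: filterS => u ld; rewrite /stat_FP grad_y_lagrE.
Qed.

Lemma Ck_around_lower : Ck_around 2 us (fun u : U => bh P (ux u) (uy u)) /\
  Ck_around 2 us (fun u : U => bg P (ux u) (uy u)).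
Proof.
have [[_ gC hC] _ _] := smoothP.
have uE : (ux us, uy us) = (xs, ys) by rewrite !packE.
by split; [apply: (Ck_around_uxy (f := h2))|apply: (Ck_around_uxy (f := g2))];
  rewrite uE.
Qed.

Lemma Ck_around_kkt_system : Ck_around 2 us kkt_system.
Proof.
have [hC gC] := Ck_around_lower.
apply: Ck_around_col_mx; first exact: Ck_around_stat.
apply: Ck_around_col_mx; first exact: hC.
apply/Ck_around_mxP => i j; rewrite ord1.
apply: (Ck_around_eq (f := fun u =>
  if active i then bg P (ux u) (uy u) i 0 else - uxi u i 0 : R)).
  by move=> u; rewrite mxE.
case: (active i); first by have /Ck_around_mxP := gC; exact.
have : Ck_around 2 us (uxi : U -> _) by apply: Ck_around_linear;
  exact: linear_uxi.
move=> /Ck_around_mxP/(_ i 0); move=> uC.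
apply: (Ck_around_eq (f := fun u : U => -1 * uxi u i 0 : R));
  first by move=> u; rewrite mulN1r.
exact: (@Ck_aroundM _ 2 _ us (fun=> -1) _ (Ck_around_cst _ _ _) uC).
Qed.

End KKTSystem.

(** * Invertibility of the KKT system *)

Section Free.
Context {R : realType}.

Lemma free_mapP (K : eqType) (V : vectType R) (v : K -> V)
    (L : seq K) : uniq L ->
  free [seq v k | k <- L] <->
  (forall c : K -> R, \sum_(k <- L) c k *: v k = 0 ->
     forall k, k \in L -> c k = 0).
Proof.
move=> uL; set X := map v L.
have sX : size X = size L by rewrite size_map.
have sumE (k0 : K) (c : 'I_(size X) -> R) (c' : K -> R) :
    (forall i : 'I_(size X), c i = c' (nth k0 L i)) ->
    \sum_(i < size X) c i *: X`_i = \sum_(k <- L) c' k *: v k.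
  move=> cc'; rewrite (big_nth k0) big_mkord -sX; apply: eq_bigr => i _.
  by rewrite cc' (nth_map k0) // -sX.
have /rwP <- : reflect _ (free X) := @freeP R V _ (in_tuple X).
split=> [fX c cL k kL|fL c cX i].
  have iX : (index k L < size X)%N by rewrite sX index_mem.
  have := fX (fun i => c (nth k L i)); rewrite (sumE k _ c) //.
  by move=> /(_ cL (Ordinal iX)) /=; rewrite nth_index.
have k0 : K by case: (L) sX i => [/= ->|k0 _ _ _] //; case.
have iL : (i < size L)%N by rewrite -sX.
pose c' k := if insub (index k L) is Some j then c j else 0.
have cc' j : c j = c' (nth k0 L j).
  by rewrite /c' index_uniq -?sX // valK.
rewrite cc'; apply: fL; last exact: mem_nth.
by rewrite -(sumE k0 c).
Qed.

(** Extending the coefficients by zero outside [A] replaces the sum over a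
    filtered list by one over all indices, to which matrix products apply. *)
Lemma free_activeP m r s (a : 'I_r -> 'cV[R]_m) (b : 'I_s -> 'cV[R]_m)
    (A : pred 'I_s) :
  free ([seq a j | j <- enum 'I_r] ++ [seq b i | i <- enum 'I_s & A i]) <->
  (forall (c : 'cV[R]_r) (e : 'cV[R]_s), (forall i, ~~ A i -> e i 0 = 0) ->
     \sum_j c j 0 *: a j + \sum_i e i 0 *: b i = 0 -> c = 0 /\ e = 0).
Proof.
pose L : seq ('I_r + 'I_s) :=
  [seq inl j | j <- enum 'I_r] ++ [seq inr i | i <- enum 'I_s & A i].
pose v (k : 'I_r + 'I_s) := match k with inl j => a j | inr i => b i end.
have uL : uniq L.
  rewrite cat_uniq map_inj_uniq; last by move=> ? ? [].
  rewrite enum_uniq map_inj_uniq; last by move=> ? ? [].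
  rewrite filter_uniq ?enum_uniq // andbT /=; apply/hasPn => k /mapP [i _ ->];
    apply/negP => /mapP [j _]; done.
have -> : [seq a j | j <- enum 'I_r] ++
    [seq b i | i <- enum 'I_s & A i] = map v L.
  by rewrite map_cat -!map_comp.
have sumL (c : 'I_r + 'I_s -> R) : \sum_(k <- L) c k *: v k =
    \sum_j c (inl j) *: a j + \sum_(i | A i) c (inr i) *: b i.
  by rewrite big_cat !big_map big_filter /=; congr (_ + _);
    rewrite big_enum_cond.
apply: (iff_trans (free_mapP v uL)); split=> [fL c e eA ce0|fL c c0].
  pose c' (k : 'I_r + 'I_s) := match k with inl j => c j 0 | inr i => e i 0 end.
  have c'0 : \sum_(k <- L) c' k *: v k = 0.
    rewrite sumL -[RHS]ce0; congr (_ + _); rewrite [RHS](bigID A) /=.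
    by rewrite [X in _ + X]big1 ?addr0 // => i /eA ->; rewrite scale0r.
  have {}fL := fL _ c'0.
  split; apply/colP => i; rewrite mxE.
    by apply: (fL (inl i)); rewrite mem_cat map_f // mem_enum.
  have [Ai|/eA //] := boolP (A i).
  apply: (fL (inr i)); rewrite mem_cat; apply/orP; right.
  by rewrite map_f // mem_filter Ai mem_enum.
have [||cl0 ce0] := fL (\col_j c (inl j))
  (\col_i (if A i then c (inr i) else 0)).
- by move=> i Ai; rewrite mxE (negbTE Ai).
- rewrite -[RHS]c0 sumL; congr (_ + _).
    by apply: eq_bigr => j _; rewrite mxE.
  rewrite [RHS]big_mkcond; apply: eq_bigr => i _; rewrite mxE.
  by case: (A i); rewrite ?scale0r.
move=> [j|i]; rewrite mem_cat => /orP[] /mapP [].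
- by move=> j' _ [->]; have /colP/(_ j') := cl0; rewrite !mxE.
- by [].
- by [].
- move=> i'; rewrite mem_filter => /andP[Ai _] [->].
  by have /colP/(_ i') := ce0; rewrite !mxE Ai.
Qed.

Lemma jac_row k l (f : 'cV[R]_k -> 'cV[R]_l) (x d : 'cV[R]_k) i :
  (jac f x *m d) i 0 = dotv (grad (fun z => f z i 0) x) d.
Proof. by rewrite dotvE mxE; apply: eq_bigr => j _; rewrite !mxE. Qed.

Lemma jac_tr_mul k l (f : 'cV[R]_k -> 'cV[R]_l) (x : 'cV[R]_k) (c : 'cV[R]_l) :
  (jac f x)^T *m c = \sum_i c i 0 *: grad (fun z => f z i 0) x.
Proof.
apply/colP => j; rewrite summxE mxE; apply: eq_bigr => i _.
by rewrite !mxE mulrC.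
Qed.

End Free.

Section Uniqueness.
Context {R : realType} {n m p q r s : nat} (P : bilevel R n m p q r s).

Lemma juc_complementarity x y mu xi i : jacobian_uniqueness P x y mu xi ->
  (bg P x y i 0 = 0 /\ 0 < xi i 0) \/ (bg P x y i 0 < 0 /\ xi i 0 = 0).
Proof.
move=> [[_ _ xi0 g0 xg] _ sc _].
have : xi i 0 * bg P x y i 0 = 0.
  apply: oppr_inj; rewrite oppr0.
  have := @psumr_eq0P R 'I_s predT (fun i => - (xi i 0 * bg P x y i 0));
    apply=> //.
    by move=> j _; rewrite oppr_ge0 mulr_ge0_le0.
  by rewrite sumrN -dotvE xg oppr0.
move=> /eqP; rewrite mulf_eq0 => /orP[] /eqP h; have := sc i.
  by rewrite h sub0r oppr_gt0; right.
by rewrite h subr0; left.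
Qed.

Variables (xs : 'cV[R]_n) (ys : 'cV[R]_m) (mus : 'cV[R]_r) (xis : 'cV[R]_s).
Local Notation U := 'cV[R]_(n + (m + (r + s))).
Local Notation us := (pack xs ys mus xis).
Local Notation active i := (bg P xs ys i 0 == 0).
Local Notation E := (kkt_system P xs ys).

(** Read row by row, the derivative becomes a linear system to which LICQ and
    the second-order condition can be applied. *)
Lemma kkt_kernel x y mu xi (v : 'cV[R]_(m + (r + s))) :
  lower_diff P (x, y) -> differentiable (stat_FP P) (pack x y mu xi) ->
  differentiable E (pack x y mu xi) ->
  let dy := uy (col_mx 0 v : U) in let dmu := umu (col_mx 0 v : U) in
  let dxi := uxi (col_mx 0 v : U) in
  rsubmx (jac E (pack x y mu xi)) *m v = 0 <->
  [/\ hess (fun z => lagr P x z mu xi) y *m dy + (jac (bh P x) y)^T *m dmu +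
        (jac (bg P x) y)^T *m dxi = 0,
      jac (bh P x) y *m dy = 0 &
      forall i, if active i then (jac (bg P x) y *m dy) i 0 = 0
                else dxi i 0 = 0].
Proof.
move=> ld sd Ed dy dmu dxi.
have ld' : lower_diff P (ux (pack x y mu xi), uy (pack x y mu xi))
  by rewrite !packE.
have -> : rsubmx (jac E (pack x y mu xi)) *m v = 'D_(col_mx 0 v) E
  (pack x y mu xi).
  by rewrite derive_jac // -{2}[jac _ _]hsubmxK mul_row_col mulmx0 add0r.
rewrite derive_kkt_system // derive_stat // derive_h // derive_g // !packE.
have -> : ux (col_mx 0 v : U) = 0 by rewrite /ux col_mxKu.
rewrite !mulmx0 !add0r -/dy -/dmu -/dxi; split=> [|[-> -> gi]]; last first.
  rewrite -[RHS]col_mx0 -col_mx0; congr (col_mx _ (col_mx _ _)).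
  apply/colP => i; rewrite [LHS]mxE [RHS]mxE; have := gi i.
  by case: ifP => _ // ->; rewrite oppr0.
rewrite -[RHS]col_mx0 -col_mx0 => /eq_col_mx [e1 /eq_col_mx [e2 /colP e3]].
split=> // i; have := e3 i; rewrite [X in X = _]mxE [X in _ = X]mxE.
case: ifP => // _ /eqP.
by rewrite oppr_eq0 => /eqP.
Qed.

Lemma slices_eq0 (v : 'cV[R]_(m + (r + s))) : uy (col_mx 0 v : U) = 0 ->
  umu (col_mx 0 v : U) = 0 -> uxi (col_mx 0 v : U) = 0 -> v = 0.
Proof.
rewrite /uy /umu /uxi col_mxKd => y0 mu0 xi0.
by rewrite -[v]vsubmxK -[dsubmx v]vsubmxK y0 mu0 xi0 !col_mx0.
Qed.

(** Let [(dy, dmu, dxi)] be in the kernel. Then [dy] is tangent to the active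
    constraints, hence critical by stationarity, and pairing the linearized
    stationarity with [dy] gives a zero curvature along [dy]; the second-order
    condition forces [dy = 0]. What remains of the stationarity equation is a
    vanishing combination of active gradients, and LICQ applies. *)
Lemma kkt_unit : lower_diff P (xs, ys) -> differentiable (stat_FP P) us ->
  differentiable E us -> jacobian_uniqueness P xs ys mus xis ->
  rsubmx (jac E us) \in unitmx.
Proof.
move=> ld sd Ed J; have [[st _ _ _ _] licq _ sosc] := J.
apply: unitmx_inj => v /(kkt_kernel v ld sd Ed).
set dy := uy _; set dmu := umu _; set dxi := uxi _ => -[e1 e2 e3].
have gxi (a : 'cV[R]_s) : (forall i, ~~ active i -> a i 0 = 0) ->
    dotv a (jac (bg P xs) ys *m dy) = 0.
  move=> ai; rewrite dotvE big1 // => i _; have := e3 i.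
  by case: ifP => [_ ->|/negbT /ai -> _]; rewrite ?mulr0 ?mul0r.
have dy0 : dy = 0.
  apply/eqP; case: (eqVneq dy 0) => // dy0.
  have : lower_critical_cone P xs ys dy.
    split=> // [i gi|].
      by rewrite -jac_row; have := e3 i; rewrite gi eqxx => ->.
    have := st; rewrite grad_y_lagrE // => /(congr1 (fun w => dotv w dy)).
    rewrite !dotvDl dotv0l -!dotv_mulmxr e2 dotv0r addr0 gxi ?addr0 => [->//|i].
    by have [[->]|[_ ->]] := juc_complementarity i J; rewrite ?eqxx.
  move=> /sosc /(_ dy0).
  have := congr1 (dotv dy) e1; rewrite !dotvDr dotv0r.
  rewrite [dotv dy (_ *m dmu)]dotvC -dotv_mulmxr e2 dotv0r addr0.
  rewrite [dotv dy (_ *m dxi)]dotvC -dotv_mulmxr.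
  rewrite gxi ?addr0 => [|i ai]; last by have := e3 i; rewrite (negbTE ai).
  by rewrite /dotv mulmxA -/(quad_form _ _) => ->; rewrite ltxx.
have /free_activeP fr := licq.
have [||dmu0 dxi0] := fr dmu dxi.
- by move=> i; have := e3 i; case: ifP.
- by move: e1; rewrite dy0 mulmx0 add0r !jac_tr_mul.
exact: slices_eq0.
Qed.

(** Invertibility is an open condition, and it implies LICQ: a vanishing
    combination of the active gradients is an element of the kernel with
    [dy = 0]. This is how LICQ passes to nearby points. *)
Lemma kkt_unit_licq x y mu xi : lower_diff P (x, y) ->
  differentiable (stat_FP P) (pack x y mu xi) ->
  differentiable E (pack x y mu xi) ->
  rsubmx (jac E (pack x y mu xi)) \in unitmx ->
  (forall i, (bg P x y i 0 == 0) = active i) ->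
  free ([seq grad (fun z => bh P x z j 0) y | j <- enum 'I_r] ++
        [seq grad (fun z => bg P x z i 0) y | i <- enum 'I_s &
          bg P x y i 0 == 0]).
Proof.
move=> ld sd Ed Eu act; apply/free_activeP => c e eA ce0.
have : rsubmx (jac E (pack x y mu xi)) *m col_mx 0 (col_mx c e) = 0.
  apply/kkt_kernel => //.
  have -> : col_mx 0 (col_mx 0 (col_mx c e)) = pack 0 0 c e :> U by [].
  rewrite !packE !mulmx0 add0r !jac_tr_mul ce0; split=> // i.
  by case: ifP; rewrite ?mxE // -act => /negbT /eA.
move=> /(congr1 (mulmx (invmx (rsubmx (jac E (pack x y mu xi)))))).
rewrite mulKmx // mulmx0 => /eqP; rewrite col_mx_eq0 => /andP[_].
by rewrite col_mx_eq0 => /andP[/eqP -> /eqP ->].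
Qed.

End Uniqueness.

(** * Persistence of the Jacobian uniqueness conditions *)

Section Cone.
Context {R : realType}.

Lemma quad_formZ k (M : 'M[R]_k) (c : R) (d : 'cV[R]_k) :
  quad_form M (c *: d) = c ^+ 2 * quad_form M d.
Proof.
rewrite /quad_form (_ : (c *: d)^T = c *: d^T); last by rewrite linearZ.
by rewrite -!scalemxAl -scalemxAr !mxE mulrA expr2.
Qed.

Lemma dotvZr k (c : R) (u v : 'cV[R]_k) : dotv u (c *: v) = c * dotv u v.
Proof. by rewrite /dotv -scalemxAr mxE. Qed.

Lemma lower_critical_coneZ n m p q r s
    (P : bilevel R n m p q r s) x y (c : R) d :
  0 <= c -> lower_critical_cone P x y d -> lower_critical_cone P x y (c *: d).
Proof.
move=> c0 [hd gd fd]; split=> [|i /gd|]; first by rewrite -scalemxAr hd scaler0.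
  by rewrite dotvZr; exact: mulr_ge0_le0.
by rewrite dotvZr mulr_ge0_le0.
Qed.

End Cone.

Section Persistence.
Context {R : realType} {n m p q r s : nat} (P : bilevel R n m p q r s).
Variables (xs : 'cV[R]_n) (ys : 'cV[R]_m) (mus : 'cV[R]_r) (xis : 'cV[R]_s).
Local Notation U := 'cV[R]_(n + (m + (r + s))).
Local Notation us := (pack xs ys mus xis).
Local Notation active i := (bg P xs ys i 0 == 0).
Local Notation E := (kkt_system P xs ys).
Hypothesis smoothP : smooth_around P xs ys.
Hypothesis jucP : jacobian_uniqueness P xs ys mus xis.

Lemma kkt_system_eq0 u : E u = 0 <->
  [/\ stat_FP P u = 0, bh P (ux u) (uy u) = 0 &
      forall i, if active i then bg P (ux u) (uy u) i 0 = 0 else uxi u i 0 = 0].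
Proof.
rewrite /kkt_system; split=> [|[-> -> gi]]; last first.
  rewrite -[RHS]col_mx0 -col_mx0; congr (col_mx _ (col_mx _ _)).
  apply/colP => i; rewrite [LHS]mxE [RHS]mxE; have := gi i.
  by case: ifP => _ // ->; rewrite oppr0.
rewrite -[RHS]col_mx0 -col_mx0 => /eq_col_mx [e1 /eq_col_mx [e2 /colP e3]].
split=> // i; have := e3 i; rewrite [X in X = _]mxE [X in _ = X]mxE.
by case: ifP => // _ /eqP; rewrite oppr_eq0 => /eqP.
Qed.

Lemma kkt_system_us : E us = 0.
Proof.
have [[st h0 _ _ _] _ _ _] := jucP.
apply/kkt_system_eq0; rewrite /stat_FP !packE; split=> // i.
by have [[->]|[g0 ->]] := juc_complementarity i jucP; rewrite ?eqxx ?lt_eqF.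
Qed.

Lemma kkt_system_unit : rsubmx (jac E us) \in unitmx.
Proof.
apply: kkt_unit => //.
- exact: (nbhs_singleton (near_lower_diff smoothP)).
- exact: (Ck_around_differentiable (Ck_around_stat _ _ smoothP)).
- exact: (Ck_around_differentiable (Ck_around_kkt_system _ _ smoothP)).
Qed.

Variables (y : 'cV[R]_n -> 'cV[R]_m) (mu : 'cV[R]_n -> 'cV[R]_r)
  (xi : 'cV[R]_n -> 'cV[R]_s).
Hypotheses (yxs : y xs = ys) (muxs : mu xs = mus) (xixs : xi xs = xis).
Hypotheses (yc : Ck_around 0 xs y) (muc : Ck_around 0 xs mu)
  (xic : Ck_around 0 xs xi).
Local Notation W x := (pack x (y x) (mu x) (xi x) : U).

Lemma Ck_around_pack k : Ck_around k xs y -> Ck_around k xs mu ->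
  Ck_around k xs xi -> Ck_around k xs (fun x => W x).
Proof.
move=> yk muk xik; apply: Ck_around_col_mx; first exact: Ck_around_id.
by apply: Ck_around_col_mx => //; exact: Ck_around_col_mx.
Qed.

Lemma near_W (Q : set U) : (\forall u \near us, Q u) ->
    \forall x \near xs, Q (W x).
Proof.
have Wc : {for xs, continuous (fun x => W x)}.
  by apply: Ck_around_cont; exact: (Ck_around_pack yc muc xic).
move=> Qu; have := Wc Q; rewrite /= yxs muxs xixs; exact.
Qed.

Lemma near_lower_diff_W : \forall x \near xs, lower_diff P (x, y x).
Proof.
have : \forall u \near us, lower_diff P (ux u, uy u).
  by apply: near_uxy; rewrite !packE; exact: near_lower_diff.
by move=> /near_W; apply: filterS => x; rewrite !packE.
Qed.

(** The strict inequalities in strict complementarity survive by continuity, so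
    the active set is locally constant along the KKT map. *)
Lemma near_signs : \forall x \near xs, forall i,
  if active i then 0 < xi x i 0 else bg P x (y x) i 0 < 0.
Proof.
have sgn i : \forall x \near xs,
    if active i then 0 < xi x i 0 else bg P x (y x) i 0 < 0; last first.
  exact: (@filter_forall _ _ _ _ _ sgn).
have [hC gC] := Ck_around_lower mus xis smoothP.
have [[gi xi0]|[gi xi0]] := juc_complementarity i jucP.
  rewrite gi eqxx.
  have /Ck_around_mxP/(_ i 0)/Ck_around_cont := xic.
  by move=> /cvgr_gt; apply; rewrite xixs.
rewrite lt_eqF //.
have : \forall u \near us, bg P (ux u) (uy u) i 0 < 0.
  have /Ck_around_mxP/(_ i 0)/Ck_around_cont := gC.
  by move=> /cvgr_lt; apply; rewrite !packE.
by move=> /near_W; apply: filterS => x; rewrite !packE.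
Qed.

(** The second-order condition survives a small perturbation since the unit
    sphere is compact: every direction on it satisfies, together with its
    neighbours, either a strict inequality or a violated equation excluding it
    from the critical cone, or the strict positivity of the Hessian. *)
Lemma near_sosc :
  (\forall x \near xs, forall i, active i -> bg P x (y x) i 0 = 0) ->
  \forall x \near xs,
  forall d, lower_critical_cone P x (y x) d -> d != 0 ->
    0 < quad_form (hess (fun z => lagr P x z (mu x) (xi x)) (y x)) d.
Proof.
move=> gact.
have [[fC gC hC] [f1C g1C h1C] _] := smoothP.
have uE : (ux us, uy us) = (xs, ys) by rewrite !packE.
have W0 := Ck_around_pack yc muc xic.
have WC a b (M : U -> 'M[R]_(a, b)) (d : 'cV[R]_m) : Ck_around 0 us M ->
    Ck_around 0 (d, xs) (fun t : 'cV[R]_m * 'cV[R]_n => M (W t.2)).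
  move=> Mc; apply: (Ck_around_snd _ (f := fun x => M (W x))).
  by apply: Ck_around_compmx => //; rewrite yxs muxs xixs.
have d1 (d : 'cV[R]_m) : Ck_around 0 (d, xs)
  (fun t : 'cV[R]_m * 'cV[R]_n => t.1).
  exact: (Ck_around_fst _ (Ck_around_id 0 d)).
have hc d : Ck_around 0 (d, xs) (fun t : 'cV[R]_m * 'cV[R]_n => jac (bh P t.2)
  (y t.2) *m t.1).
  apply: Ck_around_mulmx => //.
  apply: (Ck_around_eq (f := fun t =>
    (fun u : U => jac (bh P (ux u)) (uy u)) (W t.2))).
    by move=> t; rewrite !packE.
  apply: (WC _ _ (fun u : U => jac (bh P (ux u)) (uy u))).
  apply: (Ck_around_uxy (f := fun z => jac (bh P z.1) z.2)).
  by rewrite uE; exact: Ck_around_le h1C.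
have gc d : Ck_around 0 (d, xs) (fun t : 'cV[R]_m * 'cV[R]_n => jac (bg P t.2)
  (y t.2) *m t.1).
  apply: Ck_around_mulmx => //.
  apply: (Ck_around_eq (f := fun t =>
    (fun u : U => jac (bg P (ux u)) (uy u)) (W t.2))).
    by move=> t; rewrite !packE.
  apply: (WC _ _ (fun u : U => jac (bg P (ux u)) (uy u))).
  apply: (Ck_around_uxy (f := fun z => jac (bg P z.1) z.2)).
  by rewrite uE; exact: Ck_around_le g1C.
have fc d : Ck_around 0 (d, xs) (fun t : 'cV[R]_m * 'cV[R]_n =>
  dotv (grad (bf P t.2) (y t.2)) t.1).
  apply: Ck_around_dotv => //.
  apply: (Ck_around_eq (f := fun t =>
    (fun u : U => grad (bf P (ux u)) (uy u)) (W t.2))).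
    by move=> t; rewrite !packE.
  apply: (WC _ _ (fun u : U => grad (bf P (ux u)) (uy u))).
  apply: (Ck_around_uxy (f := fun z => grad (bf P z.1) z.2)).
  by rewrite uE; exact: Ck_around_le f1C.
have statC := Ck_around_stat mus xis smoothP.
(* The Hessian in [y] is read off the derivative of [stat_FP], known to be
   continuous in the packed variable. *)
pose quad (t : 'cV[R]_m * 'cV[R]_n) := dotv t.1 (jac (stat_FP P) (W t.2) *m
  (pack 0 t.1 0 0 : U)).
have quadc d : Ck_around 0 (d, xs) quad.
  apply: Ck_around_dotv => //; apply: Ck_around_mulmx.
    apply: (WC _ _ (jac (stat_FP P))).
    exact: Ck_around_le (Ck_around_jac statC).
  apply: Ck_around_col_mx; first exact: Ck_around_cst.
  by apply: Ck_around_col_mx => //; exact: Ck_around_cst.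
have quadE x d : lower_diff P (x, y x) -> differentiable (stat_FP P) (W x) ->
    quad_form (hess (fun z => lagr P x z (mu x) (xi x)) (y x)) d = quad (d, x).
  move=> ld sd; rewrite /quad /= -derive_jac // derive_stat // !packE.
  by rewrite !mulmx0 add0r !addr0 /dotv mulmxA.
have near_ld := near_lower_diff_W.
have near_sd : \forall x \near xs, differentiable (stat_FP P) (W x).
  exact: (near_W (Ck_around_near_differentiable statC)).
have sphere : \forall x \near xs, [set d : 'cV[R]_m | `|d| = 1] `<=`
    (fun d => lower_critical_cone P x (y x) d -> 0 < quad (d, x)).
  apply: (proj1 (compact_near_coveringP _) (@compact_sphere _ m) _ (nbhs xs)
    (fun x d => lower_critical_cone P x (y x) d -> 0 < quad (d, x))) => d /= dd.
  have d0 : d != 0 by rewrite -normr_eq0 dd oner_eq0.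
  suff : \forall t \near (d, xs), lower_critical_cone P t.2
    (y t.2) t.1 -> 0 < quad t.
    by apply: filterS => -[].
  have [hd|/eqP hd] := eqVneq (jac (bh P xs) ys *m d) 0; last first.
    have [j hj] : exists j, (jac (bh P xs) ys *m d) j 0 != 0.
      apply: contrapT => /forallNP hj; apply: hd; apply/colP => j;
        rewrite [RHS]mxE.
      by apply/eqP/negPn/negP; exact: hj.
    have /Ck_around_mxP/(_ j 0)/Ck_around_cont := hc d.
    move=> /cvgr_neq0 /=; rewrite yxs => /(_ hj);
      apply: filterS => t tj [ht _ _].
    by move: tj; rewrite ht mxE eqxx.
  have [[i gi gid]|gN] := pselect (exists2 i, active i &
    0 < (jac (bg P xs) ys *m d) i 0).
    have /Ck_around_mxP/(_ i 0)/Ck_around_cont := gc d.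
    move=> /cvgr_gt /=; rewrite yxs => /(_ _ gid) gt.
    have gz : \forall t \near (d, xs), bg P t.2 (y t.2) i 0 = 0.
      by apply: (near_snd d (P := fun x => bg P x (y x) i 0 = 0));
        apply: filterS gact => x; exact.
    apply: filterS2 gz gt => t g0 gt0 [_ gl _].
    by have := gl i g0; rewrite -jac_row leNgt gt0.
  have [fd|fd] := ltP 0 (dotv (grad (bf P xs) ys) d).
    have /Ck_around_cont := fc d.
    move=> /cvgr_gt /=; rewrite yxs => /(_ _ fd); apply: filterS => t tf [_ _].
    by rewrite leNgt tf.
  have : 0 < quad (d, xs).
    rewrite -quadE;
      [|exact: (nbhs_singleton near_ld)|exact: (nbhs_singleton near_sd)].
    rewrite yxs muxs xixs; have [_ _ _] := jucP; apply=> //;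
      split=> // i /eqP gi.
    by rewrite -jac_row leNgt; apply/negP => gd; apply: gN; exists i.
  have /Ck_around_cont := quadc d.
  by move=> /cvgr_gt h /h; apply: filterS.
near=> x => d dcone d0.
have c0 : 0 < `|d| by rewrite normr_gt0.
have dE : d = `|d| *: (`|d|^-1 *: d) by rewrite scalerA mulfV
  ?gt_eqF // scale1r.
have ld : lower_diff P (x, y x) by near: x.
have sd : differentiable (stat_FP P) (W x) by near: x.
have Sx : [set d : 'cV[R]_m | `|d| = 1] `<=`
    (fun d => lower_critical_cone P x (y x) d -> 0 < quad (d, x)) by near: x.
rewrite dE quad_formZ mulr_gt0 ?exprn_gt0 // quadE //; apply: Sx.
  by rewrite /= normrZ ger0_norm ?invr_ge0 // mulVf // gt_eqF.
by apply: lower_critical_coneZ => //; rewrite invr_ge0.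
Unshelve. all: by end_near. Qed.

Lemma near_jacobian_uniqueness : (\forall x \near xs, E (W x) = 0) ->
  \forall x \near xs, jacobian_uniqueness P x (y x) (mu x) (xi x).
Proof.
move=> EW.
have gact : \forall x \near xs, forall i, active i -> bg P x (y x) i 0 = 0.
  apply: filterS EW => x /kkt_system_eq0; rewrite !packE => -[_ _ gi] i ai.
  by have := gi i; rewrite ai.
have sosc := near_sosc gact; have sgn := near_signs.
have statC := Ck_around_stat mus xis smoothP.
have EC := Ck_around_kkt_system mus xis smoothP.
have near_ld := near_lower_diff_W.
have near_sd := near_W (Ck_around_near_differentiable statC).
have near_Ed := near_W (Ck_around_near_differentiable EC).
have near_Eu := near_W (near_jac_unit EC kkt_system_unit).
near=> x.
have : E (W x) = 0 by near: x.
move=> /kkt_system_eq0; rewrite /stat_FP !packE => -[st h0 gi].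
have sg : forall i, if active i then 0 < xi x i 0 else bg P x (y x) i 0 < 0.
  by near: x.
have cases i : (active i /\ bg P x (y x) i 0 = 0 /\ 0 < xi x i 0) \/
    (~~ active i /\ bg P x (y x) i 0 < 0 /\ xi x i 0 = 0).
  by have := gi i; have := sg i; case: ifP => ai; [left|right].
split.
- split=> //.
  + by move=> i; have [[_ [_ /ltW]]|[_ [_ ->]]] := cases i.
  + by move=> i; have [[_ [-> _]]|[_ [/ltW]]] := cases i.
  + rewrite dotvE big1 // => i _.
    by have [[_ [-> _]]|[_ [_ ->]]] := cases i; rewrite ?mulr0 ?mul0r.
- apply: (@kkt_unit_licq _ _ _ _ _ _ _ P xs ys x (y x) (mu x) (xi x)).
  + by near: x.
  + by near: x.
  + by near: x.
  + by near: x.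
  + move=> i; have [[-> [-> _]]|[/negbTE -> [g0 _]]] := cases i;
      first exact: eqxx.
    by rewrite lt_eqF.
- by move=> i; have [[_ [-> xi0]]|[_ [g0 ->]]] := cases i;
    rewrite ?subr0 // sub0r oppr_gt0.
- by near: x.
Unshelve. all: by end_near. Qed.

End Persistence.

Section Existence.
Context {R : realType} {n m p q r s : nat} (P : bilevel R n m p q r s).

(** The ball of the KKT map is chosen Euclidean and small enough for the values
    to stay at distance [1] of the base values; any radius would do for them. *)
Lemma kkt_map_exists xs ys mus xis : smooth_around P xs ys ->
  jacobian_uniqueness P xs ys mus xis ->
  exists (delta1 eps1 : R) (y : 'cV[R]_n -> 'cV[R]_m)
         (mu : 'cV[R]_n -> 'cV[R]_r) (xi : 'cV[R]_n -> 'cV[R]_s),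
     kkt_map P xs ys mus xis delta1 eps1 y mu xi.
Proof.
move=> smoothP jucP.
have EC := Ck_around_kkt_system mus xis smoothP.
have E0 := kkt_system_us jucP; have Eu := kkt_system_unit smoothP jucP.
have [d [w [d0 wxs wC wE]]] := implicit_function EC E0 Eu.
pose y x := usubmx (w x); pose mu x := usubmx (dsubmx (w x)).
pose xi x := dsubmx (dsubmx (w x)).
have wpack x : col_mx x (w x) = pack x (y x) (mu x) (xi x).
  by rewrite /pack !vsubmxK.
have ob := @ball_open R 'cV[R]_n xs d.
have xsb : ball xs d xs by exact: ballxx.
have entries k l (f : 'cV[R]_n -> 'M[R]_(k, l)) :
    (forall i j, exists i', forall x, w x i' 0 = f x i j) ->
      Ck_on 2 (ball xs d) f.
  move=> fw; apply/Ck_on_mxP => // i j; have [i' wf] := fw i j.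
  have /(Ck_on_mxP _ _ ob)/(_ i' 0) := wC.
  by apply: Ck_on_ext => // x _.
have yC : Ck_on 2 (ball xs d) y.
  by apply: entries => i j; rewrite ord1; exists (lshift _ i) => x;
    rewrite [RHS]mxE.
have muC : Ck_on 2 (ball xs d) mu.
  apply: entries => i j; rewrite ord1; exists (rshift m (lshift s i)) => x.
  by rewrite [RHS]mxE [RHS]mxE.
have xiC : Ck_on 2 (ball xs d) xi.
  apply: entries => i j; rewrite ord1; exists (rshift m (rshift r i)) => x.
  by rewrite [RHS]mxE [RHS]mxE.
have yxs : y xs = ys by rewrite /y wxs col_mxKu.
have muxs : mu xs = mus by rewrite /mu wxs col_mxKd col_mxKu.
have xixs : xi xs = xis by rewrite /xi wxs !col_mxKd.
have C0 k (f : 'cV[R]_n -> 'cV[R]_k) : Ck_on 2 (ball xs d) f ->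
  Ck_around 0 xs f.
  by move=> fC; apply: Ck_around_le (Ck_on_around ob xsb fC).
have near_b : \forall x \near xs, ball xs d x by exact: nbhsx_ballx.
have near_close k (f : 'cV[R]_n -> 'cV[R]_k) : Ck_on 2 (ball xs d) f ->
    \forall x \near xs, cball (f xs) 1 (f x).
  move=> /C0/Ck_around_cont fc; apply: fc.
  exact: (near_enorm_le (f xs) ltr01).
have close_y := near_close _ _ yC; have close_mu := near_close _ _ muC.
have close_xi := near_close _ _ xiC.
have near_J : \forall x \near xs, jacobian_uniqueness P x (y x) (mu x) (xi x).
  apply: (near_jacobian_uniqueness smoothP jucP yxs muxs xixs (C0 _ _ yC)
    (C0 _ _ muC) (C0 _ _ xiC)).
  by apply: filterS near_b => x xd; rewrite -wpack wE.
have [e e0 eP] : exists2 e, 0 < e & cball xs e `<=` (fun x => [/\ ball xs d x,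
    [/\ cball (y xs) 1 (y x), cball (mu xs) 1 (mu x) & cball (xi xs) 1 (xi x)] &
    jacobian_uniqueness P x (y x) (mu x) (xi x)]).
  apply: near_cball; near=> x; split; [by near: x| |by near: x].
  by split; near: x.
exists e, 1, y, mu, xi; split=> //.
  have sub : [set x | enorm (x - xs) < e] `<=` ball xs d.
    by move=> x /= xe; have [] : [/\ ball xs d x,
    [/\ cball (y xs) 1 (y x), cball (mu xs) 1 (mu x) & cball (xi xs) 1 (xi x)] &
    jacobian_uniqueness P x (y x) (mu x) (xi x)] by apply: eP; exact: ltW.
  by split; [apply: Ck_on_sub yC|apply: Ck_on_sub muC|apply: Ck_on_sub xiC].
by rewrite -yxs -muxs -xixs => x /eP [_ [? ? ?] ?]; split.
Unshelve. all: by end_near. Qed.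

End Existence.

(** * Equivalence of the two second-order conditions *)

Section Equivalence.
Context {R : realType} {n m p q r s : nat} (P : bilevel R n m p q r s).
Variables (xs : 'cV[R]_n) (ys : 'cV[R]_m) (mus : 'cV[R]_r) (xis : 'cV[R]_s).
Local Notation U := 'cV[R]_(n + (m + (r + s))).
Local Notation us := (pack xs ys mus xis).
Local Notation active i := (bg P xs ys i 0 == 0).
Local Notation E := (kkt_system P xs ys).
Hypothesis smoothP : smooth_around P xs ys.
Hypothesis jucP : jacobian_uniqueness P xs ys mus xis.
Variables (delta1 eps1 : R) (y : 'cV[R]_n -> 'cV[R]_m)
  (mu : 'cV[R]_n -> 'cV[R]_r) (xi : 'cV[R]_n -> 'cV[R]_s).
Hypothesis kktP : kkt_map P xs ys mus xis delta1 eps1 y mu xi.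
Local Notation W x := (pack x (y x) (mu x) (xi x) : U).

Lemma kkt_map_base : [/\ y xs = ys, mu xs = mus & xi xs = xis].
Proof. by case: kktP. Qed.

Lemma kkt_map_C2 : [/\ Ck_around 2 xs y, Ck_around 2 xs mu & Ck_around 2 xs xi].
Proof.
have [[d0 _] _ [yC muC xiC] _] := kktP.
have oD := @open_enorm_ball R n xs delta1.
have xsD : [set x | enorm (x - xs) < delta1] xs by rewrite /= subrr enorm0.
by split; apply: (Ck_on_around oD xsD).
Qed.

Lemma near_kkt_map :
  \forall x \near xs, jacobian_uniqueness P x (y x) (mu x) (xi x).
Proof.
have [[d0 _] _ _ J] := kktP.
have := near_enorm_le xs d0; apply: filterS => x xd.
by have [] := J x xd.
Qed.

Lemma near_W_kkt (Q : set U) : (\forall u \near us, Q u) ->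
    \forall x \near xs, Q (W x).
Proof.
have [yxs muxs xixs] := kkt_map_base; have [yC muC xiC] := kkt_map_C2.
by apply: near_W => //; exact: (@Ck_around_le _ 0 2).
Qed.

Lemma W_base : W xs = us.
Proof. by have [-> -> ->] := kkt_map_base. Qed.

Lemma W_C2 : Ck_around 2 xs (fun x => W x).
Proof. by have [yC muC xiC] := kkt_map_C2; exact: Ck_around_pack. Qed.

Lemma near_kkt_system : \forall x \near xs, E (W x) = 0.
Proof.
have [yxs muxs xixs] := kkt_map_base; have [yC muC xiC] := kkt_map_C2.
have le k (f : 'cV[R]_n -> 'cV[R]_k) : Ck_around 2 xs f -> Ck_around 0 xs f.
  exact: Ck_around_le.
have sgn := near_signs smoothP jucP yxs muxs xixs (le _ _ yC)
  (le _ _ muC) (le _ _ xiC).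
apply: filterS2 near_kkt_map sgn => x J sg.
have [[st h0 _ _ _] _ _ _] := J.
apply/kkt_system_eq0; rewrite /stat_FP !packE; split=> // i.
have := sg i; have [[-> xi0]|[g0 ->]] := juc_complementarity i J;
  case: ifP => //.
  by rewrite ltxx.
by rewrite ltxx.
Qed.

(** No entry of [g + xi] vanishes at the base point: it is positive where the
    constraint is active and negative elsewhere. Hence the projection is linear
    nearby. *)
Lemma near_proj : \forall v \near bg P xs ys + xis, forall i,
  proj_nonpos v i 0 = if active i then 0 else v i 0.
Proof.
have sg i : \forall v \near bg P xs ys + xis,
    proj_nonpos v i 0 = if active i then 0 else v i 0; last first.
  exact: (@filter_forall _ _ _ _ _ sg).
have vc : {for bg P xs ys + xis, continuous (fun v : 'cV[R]_s => v i 0)}.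
  exact: coord_continuous.
have vE : (bg P xs ys + xis) i 0 = bg P xs ys i 0 + xis i 0 by rewrite mxE.
have [[gi xi0]|[gi xi0]] := juc_complementarity i jucP.
  move/cvgr_gt: vc => /(_ 0); rewrite vE gi add0r => /(_ xi0).
  apply: filterS => v v0; rewrite proj_nonposE mxE eqxx; apply: min_idPr.
  exact: ltW.
move/cvgr_lt: vc => /(_ 0); rewrite vE xi0 addr0 => /(_ gi).
apply: filterS => v v0; rewrite proj_nonposE mxE lt_eqF //; apply: min_idPl.
exact: ltW.
Qed.

Lemma jac_proj : jac (@proj_nonpos R s) (bg P xs ys + xis) =
  diag_mx (\row_i (~~ active i)%:R).
Proof.
apply/matrixP => i j; rewrite !mxE.
rewrite (@near_eq_derive _ _ _ _ (fun v : 'cV[R]_s =>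
  if active i then 0 else v i 0 : R)); last first.
  by apply: filterS near_proj => v; exact.
case: (bg P xs ys i 0 == 0) => /=; first by rewrite derive_cst mul0rn.
rewrite (derive_entry (f := fun v => v)) // derive_id mxE eqxx andbT eq_sym.
by case: eqVneq => // ->.
Qed.

(** With [proj (g + xi)] equal to zero on active entries and to [g + xi] on the
    others, [g - proj (g + xi)] is [g] or [- xi]. *)
Lemma near_compl : \forall u \near us, E u =
  col_mx (stat_FP P u) (col_mx (bh P (ux u) (uy u)) (compl_FP P u)).
Proof.
have gxiC : {for us, continuous (fun u : U => bg P (ux u) (uy u) + uxi u)}.
  apply: (@Ck_around_cont _ 2); apply: Ck_aroundD.
    by have [_] := Ck_around_lower mus xis smoothP.
  by apply: Ck_around_linear; exact: linear_uxi.
have {}gxiC : (fun u : U => bg P (ux u) (uy u) + uxi u) @ us -->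
  bg P xs ys + xis.
  by move: gxiC; rewrite /prop_for /continuous_at !packE.
have pC : \forall u \near us, forall i,
    proj_nonpos (bg P (ux u) (uy u) + uxi u) i 0 =
    if active i then 0 else (bg P (ux u) (uy u) + uxi u) i 0.
  exact: (gxiC _ near_proj).
apply: filterS pC => u pu; congr (col_mx _ (col_mx _ _)).
apply/colP => i; rewrite [LHS]mxE /compl_FP [RHS]mxE [X in _ + X]mxE pu.
case: ifP => _; first by rewrite oppr0 addr0.
by rewrite [X in _ = _ - X]mxE opprD addrA subrr add0r.
Qed.

Definition upper_lagr (lamH : 'cV[R]_p) (lamG : 'cV[R]_q) (u : U) : R :=
  bF P (ux u) (uy u) + dotv lamH (bH P (ux u) (uy u)) +
    dotv lamG (bG P (ux u) (uy u)).

Definition kkt_mult (lam : @FPmult R m p q r s) : 'cV[R]_(m + (r + s)) :=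
  col_mx (lam_L lam) (col_mx (lam_h lam) (lam_g lam)).

Lemma near_lagr_FP (lam : @FPmult R m p q r s) : \forall u \near us,
  upper_lagr (lam_H lam) (lam_G lam) u + dotv (kkt_mult lam) (E u) =
    lagr_FP P lam u.
Proof.
apply: filterS near_compl => u ->; rewrite /lagr_FP /upper_lagr.
by rewrite !dotv_col_mx !addrA.
Qed.

Lemma Ck_around_upper :
  [/\ Ck_around 2 us (fun u : U => bF P (ux u) (uy u)),
      Ck_around 2 us (fun u : U => bH P (ux u) (uy u)) &
      Ck_around 2 us (fun u : U => bG P (ux u) (uy u))].
Proof.
have [_ _ [FC GC HC]] := smoothP.
have uE : (ux us, uy us) = (xs, ys) by rewrite !packE.
split; [apply: (Ck_around_uxy (f := fun z => bF P z.1 z.2))|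
  apply: (Ck_around_uxy (f := fun z => bH P z.1 z.2))|
  apply: (Ck_around_uxy (f := fun z => bG P z.1 z.2))]; by rewrite uE.
Qed.

Lemma Ck_around_upper_lagr lamH lamG : Ck_around 2 us (upper_lagr lamH lamG).
Proof.
have [FC HC GC] := Ck_around_upper.
apply: Ck_aroundD; first apply: Ck_aroundD; first exact: FC.
- by apply: Ck_around_dotv HC; exact: Ck_around_cst.
- by apply: Ck_around_dotv GC; exact: Ck_around_cst.
Qed.

Lemma Ck_around_lagr_FP (lam : @FPmult R m p q r s) :
  Ck_around 2 us (lagr_FP P lam).
Proof.
apply: Ck_around_ext (near_lagr_FP lam) _.
apply: Ck_aroundD; first exact: Ck_around_upper_lagr.
apply: Ck_around_dotv; first exact: Ck_around_cst.
exact: Ck_around_kkt_system.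
Qed.

(** The terms that distinguish the two Lagrangians multiply [E], which vanishes
    on the graph of the KKT map. *)
Lemma near_lagr_SP (lam : @FPmult R m p q r s) : \forall x \near xs,
  lagr_FP P lam (W x) = lagr_SP P y (lam_H lam, lam_G lam) x.
Proof.
have := near_W_kkt (near_lagr_FP lam).
apply: filterS2 near_kkt_system => x Ex <-.
by rewrite Ex dotv0r addr0 /upper_lagr /lagr_SP !packE.
Qed.

Lemma derive_W d : 'D_d (fun x => W x) xs =
  pack d (jac y xs *m d) (jac mu xs *m d) (jac xi xs *m d).
Proof.
have [yC muC xiC] := kkt_map_C2.
have yd := Ck_around_differentiable yC;
  have mud := Ck_around_differentiable muC.
have xid := Ck_around_differentiable xiC.
have d1 := differentiable_col_mx mud xid;
  have d2 := differentiable_col_mx yd d1.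
by rewrite !derive_col_mx // derive_id !derive_jac.
Qed.

Lemma Ck_around_lagr_SP (lam : @FPmult R m p q r s) :
  Ck_around 2 xs (lagr_SP P y (lam_H lam, lam_G lam)).
Proof.
apply: Ck_around_ext (near_lagr_SP lam) _.
by apply: (Ck_around_comp W_C2); rewrite W_base; exact: Ck_around_lagr_FP.
Qed.

Lemma derive_lagr_SP (lam : @FPmult R m p q r s) d :
  'D_d (lagr_SP P y (lam_H lam, lam_G lam)) xs =
  'D_(pack d (jac y xs *m d) (jac mu xs *m d) (jac xi xs *m d))
    (lagr_FP P lam) us.
Proof.
rewrite -(near_eq_derive _ (near_lagr_SP lam)).
rewrite (@derive_comp _ _ _ _ (fun x => W x)).
- by rewrite derive_W W_base.
- exact: (Ck_around_differentiable W_C2).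
- by rewrite W_base; exact: (Ck_around_differentiable (Ck_around_lagr_FP lam)).
Qed.

(** [lagr_SP] is [lagr_FP] composed with the KKT map, at a critical point of the
    latter Lagrangian. *)
Lemma hess_lagr_SP (lam : @FPmult R m p q r s) d :
  grad (lagr_FP P lam) us = 0 ->
  quad_form (hess (lagr_SP P y (lam_H lam, lam_G lam)) xs) d =
  quad_form (hess (lagr_FP P lam) us)
    (pack d (jac y xs *m d) (jac mu xs *m d) (jac xi xs *m d)).
Proof.
move=> g0; rewrite -derive_W.
have := @hess_comp_critical R n _ (fun x => W x) (lagr_FP P lam) xs d W_C2.
rewrite W_base => /(_ (Ck_around_lagr_FP lam) g0) <-.
apply/esym/hess_near_eq; last exact: near_lagr_SP.
by apply: (Ck_around_comp W_C2); rewrite W_base; exact: Ck_around_lagr_FP.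
Qed.

Lemma derive_kkt_W d :
  'D_(pack d (jac y xs *m d) (jac mu xs *m d) (jac xi xs *m d)) E us = 0.
Proof.
rewrite -derive_W -W_base.
rewrite -(@derive_comp _ _ _ _ (fun x => W x) E).
- by rewrite (near_eq_derive _ near_kkt_system) derive_cst.
- exact: (Ck_around_differentiable W_C2).
- rewrite W_base;
    exact: (Ck_around_differentiable (Ck_around_kkt_system mus xis smoothP)).
Qed.

(** Differentiating [E (W x) = 0] shows that tangent vectors of the graph are in
    the kernel. Conversely, a kernel element and the tangent vector with the
    same [x]-component differ by a kernel element without [x]-component, which
    is zero since the partial derivative is invertible. *)
Lemma kkt_tangent (d : U) : 'D_d E us = 0 <->
  d = pack (ux d) (jac y xs *m ux d) (jac mu xs *m ux d) (jac xi xs *m ux d).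
Proof.
split=> [Ed|->]; last exact: derive_kkt_W.
set d' := pack _ _ _ _; have Ed' : 'D_d' E us = 0 by exact: derive_kkt_W.
have EC := Ck_around_differentiable (Ck_around_kkt_system mus xis smoothP).
have : jac E us *m (d - d') = 0 by rewrite mulmxBr -!derive_jac // Ed Ed' subrr.
have -> : d - d' = col_mx 0 (dsubmx (d - d')).
  rewrite -[LHS]vsubmxK; congr (col_mx _ _).
  by rewrite linearB /= /d' col_mxKu /ux subrr.
rewrite -{1}[jac E us]hsubmxK mul_row_col mulmx0 add0r.
move=> /(congr1 (mulmx (invmx (rsubmx (jac E us))))).
rewrite mulKmx ?mulmx0 //; last exact: kkt_system_unit.
move=> dd; apply/eqP; rewrite -subr_eq0 -[d - d']vsubmxK dd.
by rewrite linearB /= /d' col_mxKu /ux subrr col_mx0.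
Qed.

(** The lower blocks of [A] are the derivative of the KKT system, since [I - W]
    and [W] are the diagonal selectors of the active and inactive
    constraints. *)
Lemma A_FP_kernel (d : U) : A_FP P us *m d = 0 <->
  jac (fun x => bH P x ys) xs *m ux d + jac (bH P xs) ys *m uy d = 0 /\
  'D_d E us = 0.
Proof.
have ld : lower_diff P (xs, ys) by exact: (nbhs_singleton
  (near_lower_diff smoothP)).
have ld' : lower_diff P (ux us, uy us) by rewrite !packE.
have sd : differentiable (stat_FP P) us.
  exact: (Ck_around_differentiable (Ck_around_stat mus xis smoothP)).
rewrite derive_kkt_system // derive_stat // derive_h // derive_g // !packE.
rewrite /A_FP /= !packE -{1}(pack_eta d) /pack !mul_col_mx
  !mul_row_col !mul0mx !addr0.
rewrite jac_proj.
set C1 := _ + _; set C2 := jac _ _ *m ux d + _; set C3 := _ + _.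
set C4 := _ + _; set C2' := _ + _ ; set C4' := \col_i _.
have DE (v : 'cV[R]_s) i :
    (diag_mx (\row_i (~~ active i)%:R) *m v) i 0 = (~~ active i)%:R * v i 0.
  by rewrite mul_diag_mx !mxE.
have -> : C4 = C4'.
  rewrite /C4 /C4' -!mulmxA mulmxBl mul1mx mulmxBl mul1mx mulNmx.
  move: (_ *m ux d) (_ *m uy d) (uxi d) => a b c.
  have addE (u v : 'cV[R]_s) i : (u + v) i 0 = u i 0 + v i 0 by rewrite mxE.
  have oppE (u : 'cV[R]_s) i : (- u) i 0 = - u i 0 by rewrite mxE.
  apply/colP => i; rewrite [RHS]mxE add0r !(addE, oppE, DE).
  by case: (bg P xs ys i 0 == 0) => /=; ring.
have -> : C2 = C2' by rewrite /C2 /C2' !addrA.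
split=> [|[-> ->]]; last by rewrite col_mx0.
by rewrite -[RHS]col_mx0 => /eq_col_mx [].
Qed.

Lemma mult_FP_SP (lam : @FPmult R m p q r s) : mult_FP P us lam ->
  mult_SP P y xs (lam_H lam, lam_G lam).
Proof.
have [yxs _ _] := kkt_map_base.
move=> [g0]; rewrite !packE => H0 [lG lG0 G0] _ _.
rewrite /mult_SP /= yxs; split=> //.
apply/grad_eq0P;
  first exact: (Ck_around_differentiable (Ck_around_lagr_SP lam)).
move=> v; rewrite derive_lagr_SP.
have Ld := Ck_around_differentiable (Ck_around_lagr_FP lam).
by have /(grad_eq0P Ld) := g0.
Qed.

(** Stationarity of [lagr_FP] in [w = (y, mu, xi)] is a linear equation for the
    multiplier of [E] with matrix the transpose of the invertible derivative of
    [E] in [w]. Once it is solved, only the directions tangent to the graph of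
    the KKT map remain, where the derivative is that of [lagr_SP]. *)
Lemma mult_SP_FP lamH lamG : mult_SP P y xs (lamH, lamG) ->
  exists2 lam, mult_FP P us lam & lam_H lam = lamH /\ lam_G lam = lamG.
Proof.
have [yxs muxs xixs] := kkt_map_base.
rewrite /mult_SP /= yxs => -[g0 H0 lG lG0 G0].
pose J := rsubmx (jac E us).
have Ju : J \in unitmx by exact: kkt_system_unit.
pose a := dsubmx (grad (upper_lagr lamH lamG) us).
pose lamE := - ((invmx J)^T *m a).
pose lam := FPMult lamH lamG (usubmx lamE) (usubmx (dsubmx lamE))
  (dsubmx (dsubmx lamE)).
exists lam => //.
have EC := Ck_around_kkt_system mus xis smoothP.
have Ed := Ck_around_differentiable EC.
have Ud := Ck_around_differentiable (Ck_around_upper_lagr lamH lamG).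
have Ld := Ck_around_differentiable (Ck_around_lagr_FP lam).
have lamEE : kkt_mult lam = lamE by rewrite /kkt_mult /= !vsubmxK.
have DL v : 'D_(col_mx 0 v) (lagr_FP P lam) us = 0.
  rewrite -(near_eq_derive _ (near_lagr_FP lam)) lamEE.
  have cd : differentiable (fun=> lamE : 'cV[R]_(m + (r + s))) us by [].
  have dd : derivable (fun u => dotv lamE (E u)) us (col_mx 0 v).
    apply: diff_derivable; apply: (@Ck_around_differentiable _ 1).
    by apply: Ck_around_dotv EC; exact: Ck_around_cst.
  rewrite deriveD //; last exact: diff_derivable.
  rewrite (derive_dotv _ cd Ed) derive_cst dotv0l add0r.
  rewrite derive_grad // derive_jac // -{1}[grad _ us]vsubmxK
    dotv_col_mx dotv0r add0r.
  rewrite -[jac E us]hsubmxK mul_row_col mulmx0 add0r -/J -/a.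
  rewrite dotv_mulmxr /lamE mulmxN mulmxA -trmx_mul mulVmx // trmx1 mul1mx.
  by rewrite -dotvDl subrr dotv0l.
have [st0 h0] : stat_FP P us = 0 /\ bh P xs ys = 0.
  by have /kkt_system_eq0[] := kkt_system_us jucP; rewrite !packE.
have compl0 : compl_FP P us = 0.
  have := nbhs_singleton near_compl; rewrite (kkt_system_us jucP).
  by rewrite -[LHS]col_mx0 -col_mx0 => /eq_col_mx [_ /eq_col_mx[_ <-]].
rewrite /mult_FP /= !packE; split=> //; apply/(grad_eq0P Ld) => d.
pose d' : U := pack (ux d) (jac y xs *m ux d) (jac mu xs *m ux d)
  (jac xi xs *m ux d).
have -> : d = d' + col_mx 0 (dsubmx d - dsubmx d').
  by rewrite -{1}[d]vsubmxK -{1}[d']vsubmxK add_col_mx addr0 [dsubmx d' +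
    _]addrC subrK col_mxKu.
rewrite deriveE // linearD -!deriveE // DL addr0 -derive_lagr_SP.
have Sd := Ck_around_differentiable (Ck_around_lagr_SP lam).
by have /(grad_eq0P Sd) := g0.
Qed.

Lemma chain_row k (f : 'cV[R]_n -> 'cV[R]_m -> 'cV[R]_k) (d : 'cV[R]_n) :
  (jac (fun x => f x ys) xs + jac (f xs) ys *m jac y xs) *m d =
  jac (fun x => f x ys) xs *m d + jac (f xs) ys *m (jac y xs *m d).
Proof. by rewrite mulmxDl mulmxA. Qed.

Lemma dotv_chain (a : 'cV[R]_n) (b : 'cV[R]_m) (M : 'M[R]_(m, n)) d :
  ((a^T + b^T *m M) *m d) 0 0 = dotv a d + dotv b (M *m d).
Proof. by rewrite /dotv mulmxDl mxE mulmxA. Qed.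

Lemma crit_FPP (d : U) : crit_FP P us d <->
  crit_SP P y xs (ux d) /\
  d = pack (ux d) (jac y xs *m ux d) (jac mu xs *m ux d) (jac xi xs *m ux d).
Proof.
have [yxs _ _] := kkt_map_base.
have key dx : (let d := pack dx (jac y xs *m dx) (jac mu xs *m dx)
  (jac xi xs *m dx) : U in
    crit_FP P us d) <-> crit_SP P y xs dx.
  rewrite /= /crit_FP /crit_SP /= !packE yxs chain_row dotv_chain.
  split=> [[/A_FP_kernel[]]|[h0 gd fd]].
    rewrite !packE => h0 _ gd fd; split=> // i gi.
    by rewrite dotv_chain; exact: gd.
  split=> // [|i gi]; last by rewrite -dotv_chain; exact: gd.
  apply/A_FP_kernel; rewrite !packE; split=> //.
  exact: derive_kkt_W.
split=> [cd|[cd dE]]; last by rewrite dE; apply/key.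
have /kkt_tangent dE : 'D_d E us = 0 by have [/A_FP_kernel[]] := cd.
by split=> //; apply/key; rewrite /= -dE.
Qed.

(** Directions and multipliers correspond to each other with equal quadratic
    forms, so each supremum is bounded below by the other. *)
Lemma SOSC_equiv : SOSC_SP P y xs <-> SOSC_FP P us.
Proof.
split=> -[[lam0 lam0P] sosc]; split.
- by case: lam0 lam0P => lH lG /mult_SP_FP [lam lamP _]; exists lam.
- move=> d /crit_FPP [cd dE] d0.
  have dx0 : ux d != 0.
    by apply: contra d0 => /eqP dx0; rewrite dE dx0 !mulmx0 pack0.
  apply: lt_le_trans (sosc _ cd dx0) _; apply: ereal_sup_le =>
    _ /= [[lH lG] lP <-].
  have [lam lamP [lHE lGE]] := mult_SP_FP lP.
  exists lam => //; have [g0 _ _ _ _] := lamP.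
  by have := hess_lagr_SP (ux d) g0; rewrite lHE lGE -dE => ->.
- by exists (lam_H lam0, lam_G lam0); exact: mult_FP_SP.
- move=> d cd d0.
  pose d' : U := pack d (jac y xs *m d) (jac mu xs *m d) (jac xi xs *m d).
  have cd' : crit_FP P us d' by apply/crit_FPP; rewrite /d' !packE.
  have d'0 : d' != 0.
    by apply: contra d0 => /eqP /(congr1 ux);
      rewrite /d' packE -pack0 packE => ->.
  apply: lt_le_trans (sosc _ cd' d'0) _; apply: ereal_sup_le =>
    _ /= [lam lamP <-].
  exists (lam_H lam, lam_G lam); first exact: mult_FP_SP.
  by have [g0 _ _ _ _] := lamP; rewrite hess_lagr_SP.
Qed.

End Equivalence.

(** * Growth and bi-local optimality *)

Section ConstrainedGrowth.
Context {R : realType} {T : normedModType R} {k a c : nat}.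
Local Notation V := 'cV[R]_k.
Variables (phi : T * V -> R) (H : T * V -> 'cV[R]_a) (G : T * V -> 'cV[R]_c).
Variables (b : T -> V) (t0 : T).
Local Notation p0 := (t0, b t0).

(** A direction outside the critical cone violates an equation, or an active
    inequality, to first order, or else increases the objective. *)
Theorem constrained_growth :
  {for t0, continuous b} ->
  Ck_around 1 p0 phi -> Ck_around 1 p0 H -> Ck_around 1 p0 G ->
  (\forall t \near t0, H (t, b t) = 0) ->
  (forall i, G p0 i 0 = 0 -> \forall t \near t0, G (t, b t) i 0 = 0) ->
  (forall d, d != 0 -> 'D_(0, d) H p0 = 0 ->
    (forall i, G p0 i 0 = 0 -> 'D_(0, d) G p0 i 0 <= 0) ->
    'D_(0, d) phi p0 <= 0 ->
    exists L : T * V -> R, [/\ Ck_around 2 p0 L,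
      \forall p \near p0, H p = 0 -> nonpos (G p) -> L p <= phi p,
      \forall t \near t0, L (t, b t) = phi (t, b t),
      \forall t \near t0, forall v, 'D_(0, v) L (t, b t) = 0 &
      0 < 'D_(0, d) ('D_(0, d) L) p0]) ->
  exists2 gamma, 0 < gamma & \forall p \near p0, H p = 0 -> nonpos (G p) ->
    phi (p.1, b p.1) + gamma * `|p.2 - b p.1| ^+ 2 <= phi p.
Proof.
move=> bc phi1 H1 G1 Hb Gb crit.
have Hd := Ck_around_differentiable H1; have Gd := Ck_around_differentiable G1.
have [|gamma g0 gP] := @parametric_growth R T k b t0 bc
  [set p | H p = 0 /\ nonpos (G p)] phi phi1; last first.
- by exists gamma => //; apply: filterS gP => p pP Hp Gp; apply: pP.
move=> d d0.
have [DH|/eqP DH] := eqVneq ('D_(0, d) H p0) 0; last first.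
  have [j hj] : exists j, 'D_(0, d) H p0 j 0 != 0.
    apply: contrapT => /forallNP hj; apply: DH; apply/colP => j;
      rewrite [RHS]mxE.
    by apply/eqP/negPn/negP; exact: hj.
  (* The sign turns the equation into an inequality violated along [d]. *)
  apply: Or31; exists (fun p => Num.sg ('D_(0, d) H p0 j 0) * H p j 0).
  have Hj := (Ck_around_mxP 1 p0 H).2 H1 j 0.
  split.
  - exact: (@Ck_aroundM _ 1 _ p0 (fun=> Num.sg _) _ (Ck_around_cst _ _ _) Hj).
  - by near=> p => -[-> _]; rewrite mxE mulr0.
  - by apply: filterS Hb => t ->; rewrite mxE mulr0.
  - rewrite (_ : (fun p => _) = Num.sg ('D_(0, d) H p0 j 0) *:
      (fun p => H p j 0 : R)) //.
    rewrite deriveZ; last exact/diff_derivable/(Ck_around_differentiable Hj).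
    by rewrite derive_entry // /GRing.scale /= -normrEsg normr_gt0.
have [[i gi gid]|gN] := pselect (exists2 i, G p0 i 0 = 0 &
  0 < 'D_(0, d) G p0 i 0).
  apply: Or31; exists (fun p => G p i 0); split.
  - exact: ((Ck_around_mxP 1 p0 G).2 G1 i 0).
  - by near=> p => -[_]; exact.
  - by apply: filterS (Gb i gi) => t ->.
  - by rewrite derive_entry.
have [fd|fd] := ltP 0 ('D_(0, d) phi p0); first exact: Or32.
have [|L [L2 LC Lb LD Ld]] := crit d d0 DH _ fd.
  by move=> i gi; rewrite leNgt; apply/negP => gd; apply: gN; exists i.
by apply: Or33; exists L; split=> //; apply: filterS LC =>
  p LC [Hp Gp]; exact: LC.
Unshelve. all: by end_near. Qed.

End ConstrainedGrowth.

Section Growth.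
Context {R : realType} {n m p q r s : nat} (P : bilevel R n m p q r s).
Variables (xs : 'cV[R]_n) (ys : 'cV[R]_m) (mus : 'cV[R]_r) (xis : 'cV[R]_s).
Local Notation U := 'cV[R]_(n + (m + (r + s))).
Local Notation us := (pack xs ys mus xis).
Hypothesis smoothP : smooth_around P xs ys.
Hypothesis feasU : Phi P (xs, ys).
Hypothesis jucP : jacobian_uniqueness P xs ys mus xis.
Variables (delta1 eps1 : R) (y : 'cV[R]_n -> 'cV[R]_m)
  (mu : 'cV[R]_n -> 'cV[R]_r) (xi : 'cV[R]_n -> 'cV[R]_s).
Hypothesis kktP : kkt_map P xs ys mus xis delta1 eps1 y mu xi.
Local Notation W x := (pack x (y x) (mu x) (xi x) : U).

Lemma Ck_around_graph k (f : U -> 'cV[R]_k) : Ck_around 2 us f ->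
  Ck_around 2 xs (fun x => f (W x)).
Proof.
by move=> fC; apply: (Ck_around_compmx (W_C2 kktP)); rewrite (W_base kktP).
Qed.

Lemma derive_graph (V : normedModType R) (f : 'cV[R]_n -> 'cV[R]_m -> V)
    (d : 'cV[R]_n) :
  differentiable (fun z : 'cV[R]_n * 'cV[R]_m => f z.1 z.2) (xs, ys) ->
  'D_d (fun x => f x (y x)) xs =
  'D_d (fun x => f x ys) xs + 'D_(jac y xs *m d) (f xs) ys.
Proof.
move=> fd; have ud := is_diff_uxy us.
have fud : differentiable (fun u : U => f (ux u) (uy u)) us.
  apply: (@differentiable_comp _ _ _ _ (fun u : U => (ux u, uy u))
    (fun z => f z.1 z.2)); first exact: ex_diff.
  by rewrite !packE.
have -> : (fun x => f x (y x)) = fun x => (fun u : U => f (ux u) (uy u)) (W x).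
  by apply/funext => x; rewrite !packE.
rewrite (@derive_comp _ _ _ _ (fun x => W x) (fun u : U => f (ux u) (uy u)));
  first last.
- by rewrite (W_base kktP).
- exact: (Ck_around_differentiable (W_C2 kktP)).
rewrite (derive_W kktP) (W_base kktP).
rewrite (@derive_affine _ _ _ _ _ _ (fun z : 'cV[R]_n * 'cV[R]_m => f z.1 z.2) _
  _ ud) ?packE //.
by rewrite derive_pair.
Qed.

Let near_J := near_kkt_map kktP.

Let y_cont : {for xs, continuous y}.
Proof. by have [yC _ _] := kkt_map_C2 kktP; exact: Ck_around_cont yC. Qed.

(** The supremum over the multipliers being positive, one of them has positive
    curvature along the given critical direction, and its Lagrangian is below
    the objective on the feasible set. Problem (SP) has no parameter, hence the
    dummy [t : R]. *)
Lemma upper_growth : SOSC_SP P y xs ->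
  exists2 gamma, 0 < gamma & \forall x \near xs, Phi P (x, y x) ->
    bF P xs ys + gamma * `|x - xs| ^+ 2 <= bF P x (y x).
Proof.
move=> [_ sosc]; have [yxs _ _] := kkt_map_base kktP.
have [FC HC GC] := Ck_around_upper mus xis smoothP.
have WC := W_C2 kktP; have WE := W_base kktP.
have FC' : Ck_around 2 xs (fun x => bF P x (y x)).
  apply: (Ck_around_eq (f := fun x => (fun u : U => bF P (ux u) (uy u)) (W x))).
    by move=> x; rewrite !packE.
  by apply: (Ck_around_comp (g := fun u : U => bF P (ux u) (uy u)) WC);
    rewrite WE.
have HC' : Ck_around 2 xs (fun x => bH P x (y x)).
  apply: Ck_around_eq (Ck_around_graph HC) => x; by rewrite !packE.
have GC' : Ck_around 2 xs (fun x => bG P x (y x)).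
  apply: Ck_around_eq (Ck_around_graph GC) => x; by rewrite !packE.
pose b (_ : R) := xs.
have snd1 (V : normedModType R) (f : 'cV[R]_n -> V) (t : R) x d :
  differentiable f x ->
    'D_(0, d) (fun p : R * 'cV[R]_n => f p.2) (t, x) = 'D_d f x.
  by move=> fd; rewrite (derive_affine _ (@is_diff_snd _ _ _ (t, x))).
have le1 (V : normedModType R) (f : 'cV[R]_n -> V) : Ck_around 2 xs f ->
    Ck_around 1 (0 : R, xs) (fun p : R * 'cV[R]_n => f p.2).
  by move=> fC; apply: Ck_around_snd; exact: Ck_around_le fC.
have [H0 G0] : bH P xs ys = 0 /\ nonpos (bG P xs ys) by [].
have [_ _ [FD GD HD]] := smoothP.
have [||||gamma g0 gP] := @constrained_growth R R n p q
  (fun z => bF P z.2 (y z.2)) (fun z => bH P z.2 (y z.2))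
  (fun z => bG P z.2 (y z.2)) b 0 _ (le1 _ _ FC') (le1 _ _ HC') (le1 _ _ GC').
- exact: cst_continuous.
- by near=> t; rewrite /b /= yxs.
- by move=> i /= gi; near=> t.
- move=> d d0.
  rewrite (snd1 _ (fun x => bH P x (y x)));
    last exact: Ck_around_differentiable HC'.
  rewrite (snd1 _ (fun x => bG P x (y x)));
    last exact: Ck_around_differentiable GC'.
  rewrite (snd1 _ (fun x => bF P x (y x)));
    last exact: Ck_around_differentiable FC'.
  have Fd := Ck_around_differentiable FD;
    have Gd := Ck_around_differentiable GD.
  have Hd := Ck_around_differentiable HD.
  have sl (V : normedModType R) (f : 'cV[R]_n -> 'cV[R]_m -> V) :
      differentiable (fun z : 'cV[R]_n * 'cV[R]_m => f z.1 z.2) (xs, ys) ->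
      differentiable (fun x => f x ys) xs /\ differentiable (f xs) ys.
    by move=> fd; split;
      [exact: (differentiable_slicel fd)|exact: (differentiable_slicer fd)].
  have [Fl Fr] := sl _ _ Fd; have [Gl Gr] := sl _ _ Gd;
    have [Hl Hr] := sl _ _ Hd.
  rewrite !derive_graph // !derive_jac // !derive_grad // => DH DG DF.
  have cd : crit_SP P y xs d.
    rewrite /crit_SP /= yxs; split; first by rewrite mulmxDl -mulmxA.
      move=> i gi; rewrite dotv_chain -!jac_row.
      by have := DG i; rewrite /= /b yxs gi mxE => /(_ erefl).
    by rewrite dotv_chain.
  have /ereal_sup_gt [_ /= [lam lamP <-]] := sosc d cd d0;
    rewrite lte_fin => quad0.
  pose lam' : @FPmult R m p q r s := FPMult lam.1 lam.2 0 0 0.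
  have LC : Ck_around 2 xs (lagr_SP P y lam).
    by have := Ck_around_lagr_SP smoothP jucP kktP lam';
      rewrite /= -surjective_pairing.
  exists (fun z => lagr_SP P y lam z.2).
  have Ld := Ck_around_differentiable LC.
  have [g0' _ lG lG0 _] := lamP; split.
  + exact: Ck_around_snd.
  + near=> z => Hz Gz; rewrite /lagr_SP Hz dotv0r addr0 gerDl dotvE.
    by apply: sumr_le0 => i _; exact: mulr_ge0_le0.
  + by near=> t; rewrite /lagr_SP /b /= lG0 yxs H0 dotv0r !addr0.
  + by near=> t => v; rewrite (snd1 _ (lagr_SP P y lam)) //;
      move/(grad_eq0P Ld): g0'; exact.
  + rewrite (_ : 'D_(0, d) ('D_(0, d) _) _ =
      quad_form (hess (lagr_SP P y lam) xs) d) //.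
    by rewrite quad_form_hess.
exists gamma => //.
have : \forall t \near (0 : R) & x \near xs, bH P x (y x) = 0 ->
  nonpos (bG P x (y x)) ->
    bF P xs (y xs) + gamma * `|x - xs| ^+ 2 <= bF P x (y x).
  by apply: filterS gP => -[t x].
move=> [[A B] /= [A0 Bx] AB]; apply: filterS Bx => x Bx [Hx Gx].
rewrite -[ys in leLHS]yxs; apply: (AB (0, x)) => //.
by split=> //; exact: nbhs_singleton.
Unshelve. all: by end_near. Qed.

(** The Lagrangian at the multipliers of [x] is below [f x] on [Y x], since
    these multipliers are nonnegative, and it is critical at [y x]; its
    curvature is needed at the base point only. *)
Lemma lower_growth : exists2 gamma, 0 < gamma & \forall z \near (xs, ys),
  Y P z.1 z.2 -> bf P z.1 (y z.1) + gamma * `|z.2 - y z.1| ^+ 2 <= bf P z.1 z.2.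
Proof.
have [yxs muxs xixs] := kkt_map_base kktP.
have [yC muC xiC] := kkt_map_C2 kktP.
have [[fC gC hC] _ _] := smoothP.
have le1 (V : normedModType R) (f : 'cV[R]_n * 'cV[R]_m -> V) :
  Ck_around 2 (xs, ys) f ->
    Ck_around 1 (xs, y xs) f.
  by rewrite yxs; exact: Ck_around_le.
have near_xy (Q : set ('cV[R]_n * 'cV[R]_m)) :
  (\forall z \near (xs, ys), Q z) ->
    \forall x \near xs, Q (x, y x).
  move=> nQ; have : \forall u \near us, Q (ux u, uy u).
    by apply: near_uxy; rewrite !packE.
  by move=> /(near_W_kkt kktP); apply: filterS => x; rewrite !packE.
have [|||gamma g0 gP] := @constrained_growth R 'cV[R]_n m r s
  (fun z => bf P z.1 z.2) (fun z => bh P z.1 z.2) (fun z => bg P z.1 z.2) y xs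
  y_cont (le1 _ _ fC) (le1 _ _ hC) (le1 _ _ gC).
- by apply: filterS near_J => x [[_ -> _ _ _] _ _ _].
- rewrite /= yxs => i gi.
  have [leyC lemuC lexiC] : [/\ Ck_around 0 xs y, Ck_around 0 xs mu &
    Ck_around 0 xs xi].
    by split; exact: (@Ck_around_le _ 0 2).
  have sgn := near_signs smoothP jucP yxs muxs xixs leyC lemuC lexiC.
  apply: filterS2 near_J sgn => x J sg; have := sg i; rewrite gi eqxx.
  by have [[-> //]|[_ ->]] := juc_complementarity i J; rewrite ltxx.
- move=> d d0; rewrite yxs.
  have fd := Ck_around_differentiable fC;
    have hd := Ck_around_differentiable hC.
  have gd := Ck_around_differentiable gC.
  have slr (V : normedModType R) (f : 'cV[R]_n * 'cV[R]_m -> V) x z v :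
      differentiable f (x, z) -> 'D_(0, v) f (x, z) =
        'D_v (fun z => f (x, z)) z.
    by move=> fd'; rewrite (derive_affine _ (is_diff_pairr x z)).
  rewrite !slr // !derive_jac;
    [|exact: (differentiable_slicer gd)|exact: (differentiable_slicer hd)].
  rewrite derive_grad; last exact: (differentiable_slicer fd).
  rewrite /= => DH DG DF.
  have cd : lower_critical_cone P xs ys d.
    by split=> // i gi; rewrite -jac_row; exact: DG.
  pose L (z : 'cV[R]_n * 'cV[R]_m) := lagr P z.1 z.2 (mu z.1) (xi z.1).
  have LC : Ck_around 2 (xs, ys) L.
    apply: Ck_aroundD; first apply: Ck_aroundD; first exact: fC.
      by apply: Ck_around_dotv hC; exact: Ck_around_fst.
    by apply: Ck_around_dotv gC; exact: Ck_around_fst.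
  have near_Ld := Ck_around_near_differentiable LC.
  exists L; split.
  + exact: LC.
  + have : \forall z \near (xs, ys), jacobian_uniqueness P z.1 (y z.1)
      (mu z.1) (xi z.1).
      exact: (near_fst ys near_J).
    apply: filterS => z [[_ _ xi0 _ _] _ _ _] hz gz.
    rewrite /L /lagr hz dotv0r addr0 gerDl dotvE.
    by apply: sumr_le0 => i _; exact: mulr_ge0_le0.
  + apply: filterS near_J => x [[_ h0 _ _ xg] _ _ _].
    by rewrite /L /lagr /= h0 xg dotv0r !addr0.
  + apply: filterS2 (near_xy _ near_Ld) near_J => x Ldx [[st _ _ _ _] _ _ _] v.
    rewrite slr // derive_grad; last exact: (differentiable_slicer Ldx).
    by rewrite /L /= -/(grad_y_lagr P x (y x) (mu x) (xi x)) st dotv0l.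
  + have Lr : Ck_around 2 ys (fun z => L (xs, z)).
      exact: (Ck_around_affine (is_diff_pairr xs)).
    have nD : \forall z \near (xs, ys), 'D_(0, d) L z =
      'D_d (fun w => L (z.1, w)) z.2.
      by apply: filterS near_Ld => -[x z] Lz; rewrite slr.
    rewrite slr; last exact: (Ck_around_differentiable
      (Ck_around_derive (0, d) LC)).
    have nD' : \forall z \near ys, 'D_(0, d) L (xs, z) =
      'D_d (fun w => L (xs, w)) z.
      have rd := is_diff_pairr xs ys.
      have c : {for ys, continuous (fun z => (xs, z))}.
        by apply: differentiable_continuous; exact: ex_diff.
      exact: (c _ nD).
    rewrite (near_eq_derive _ nD') -quad_form_hess //.
    have [_ _ _] := jucP; rewrite /L /= muxs xixs; exact.
- by exists gamma => //; move: gP; rewrite yxs;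
    apply: filterS => z zP [hz gz]; exact: zP.
Qed.

(** The radius [e] does not depend on [x], and it can be decreased as long as
    [y x] stays in the ball: the bi-local property needs a family of radii. *)
Lemma argmin_near : exists d e, [/\ 0 < d, 0 < e &
  forall x eps, cball xs d x -> eps <= e -> cball ys eps (y x) ->
    argmin (bf P x) (Y P x `&` cball ys eps) = [set y x]].
Proof.
have [gamma g0 gP] := lower_growth.
have gP' : \forall x \near xs & z \near ys,
    Y P x z -> bf P x (y x) + gamma * `|z - y x| ^+ 2 <= bf P x z.
  by apply: filterS gP => -[x z].
have [[A B] /= [Ax By] AB] := gP'.
have near1 : \forall x \near xs, A x /\ Y P x (y x).
  by apply: filterS2 Ax near_J => x Ax' [[_ h0 _ g0' _] _ _ _]; split.
have [d d0 dP] := near_cball near1; have [e e0 eP] := near_cball By.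
exists d, e; split=> // x eps xd epse yx.
have [Ax' Yx] := dP x xd.
have best z : (Y P x `&` cball ys eps) z ->
    bf P x (y x) + gamma * `|z - y x| ^+ 2 <= bf P x z.
  move=> [Yz zeps]; apply: (AB (x, z)) => //; split=> //=; apply: eP.
  exact: le_trans zeps epse.
apply/seteqP; split=> [z [zC zmin]|_ ->] /=; last first.
  split=> // z zC; apply: le_trans (best z zC).
  by rewrite lerDl mulr_ge0 ?exprn_ge0 // ltW.
have := le_trans (best z zC) (zmin _ (conj Yx yx)).
rewrite gerDl pmulr_rle0 // => z0; apply/eqP; rewrite -subr_eq0 -normr_eq0.
by rewrite -sqrf_eq0 eq_le z0 exprn_ge0.
Qed.

(** This controls how small the lower-level ball may be while still containing
    [y x] for all [x] at distance at most [delta]. *)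
Lemma near_y_lipschitz : exists2 K, 0 < K &
  \forall x \near xs, enorm (y x - ys) <= K * enorm (x - xs).
Proof.
have [yxs _ _] := kkt_map_base kktP; have [yC _ _] := kkt_map_C2 kktP.
have yd := Ck_around_differentiable yC.
have yJ := differentiable_jac_eps yd ltr01.
exists (m.+1%:R * (n%:R * `|jac y xs| + 1)).
  by rewrite mulr_gt0 // ltr_wpDl // mulr_ge0.
have sh : {for xs, continuous (fun x => x - xs)}.
  apply: (@Ck_around_cont _ 0); apply: Ck_aroundD; first exact: Ck_around_id.
  exact: Ck_around_cst.
have : \forall x \near xs, `|y (x - xs + xs) - y xs - jac y xs *m
  (x - xs)| <= 1 * `|x - xs|.
  by move: sh; rewrite /prop_for /continuous_at subrr => /(_ _ yJ).
apply: filterS => x; rewrite subrK yxs => yx.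
apply: le_trans (enorm_le _) _; rewrite -mulrA ler_wpM2l //.
apply: (@le_trans _ _ ((n%:R * `|jac y xs| + 1) * `|x - xs|)); last first.
  by rewrite ler_wpM2l ?norm_le_enorm // addr_ge0 // mulr_ge0.
rewrite -(subrK (jac y xs *m (x - xs)) (y x - ys)) mulrDl [leRHS]addrC.
apply: le_trans (ler_normD _ _) _; apply: lerD => //.
exact: norm_mulmx.
Qed.

Hypothesis soscP : SOSC_SP P y xs.

(** The factor [n.+1%:R] compares the sup norm of the growth estimate with the
    Euclidean norm. *)
Lemma SP_growth_exists : exists delta2 eps2 gamma : R,
  [/\ 0 < delta2 < delta1, 0 < eps2 < eps1, 0 < gamma &
      SP_growth P xs ys y delta2 eps2 gamma].
Proof.
have [yxs _ _] := kkt_map_base kktP.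
have [[d10 e10] _ _ _] := kktP.
have [d [e [d0 e0 am]]] := argmin_near.
have [gamma g0 up] := upper_growth soscP.
pose eps2 := Num.min e (eps1 / 2).
have eps20 : 0 < eps2 by rewrite lt_min e0 divr_gt0.
have yc : \forall x \near xs, cball ys eps2 (y x).
  by apply: y_cont; rewrite yxs; exact: near_enorm_le.
have upc : \forall x \near xs, cball ys eps2 (y x) /\
    (Phi P (x, y x) -> bF P xs ys + gamma * `|x - xs| ^+ 2 <= bF P x (y x)).
  by apply: filterS2 yc up => x; split.
have [d' d'0 dP] := near_cball upc.
pose delta2 := Num.min (Num.min d d') (delta1 / 2).
exists delta2, eps2, (gamma / n.+1%:R); split.
- rewrite /delta2 !lt_min d0 d'0 divr_gt0 //=.
  by rewrite gt_min ltr_pdivrMr // ltr_pMr // ltr1n orbT.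
- by rewrite eps20 /eps2 gt_min ltr_pdivrMr // ltr_pMr // ltr1n orbT.
- exact: divr_gt0.
move=> x xd.
have xd1 : cball xs d x by apply: le_trans xd _; rewrite /delta2 !ge_min lexx.
have xd2 : cball xs d' x by apply: le_trans xd _;
  rewrite /delta2 !ge_min lexx orbT.
have [yx ux] := dP x xd2; split.
  by apply: am => //; rewrite /eps2 ge_min lexx.
move=> /ux; apply: le_trans; rewrite lerD2l -mulrA ler_wpM2l ?(ltW g0) //.
by rewrite mulrC ler_pdivrMr // mulrC enorm_sqr_le.
Qed.

(** With [eta delta = K * delta] and [K] a Lipschitz constant of [y] at [xs],
    the only minimizer of the lower level over the ball is [y x], and the growth
    of the upper-level objective applies. *)
Lemma SOSC_bilocal : bilocal_solution P xs ys.
Proof.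
have [yxs _ _] := kkt_map_base kktP.
have [[_ h0 _ g0' _] _ _ _] := jucP.
have [d [e [d0 e0 am]]] := argmin_near.
have [gamma g0 up] := upper_growth soscP.
have [K K0 yK] := near_y_lipschitz.
have nr : \forall x \near xs, enorm (y x - ys) <= K * enorm (x - xs) /\
    (Phi P (x, y x) -> bF P xs ys + gamma * `|x - xs| ^+ 2 <= bF P x (y x)).
  by apply: filterS2 yK up => x; split.
have [d' d'0 dP] := near_cball nr.
pose delta0 := Num.min (Num.min d d') (e / K).
have delta00 : 0 < delta0 by rewrite !lt_min d0 d'0 divr_gt0.
split=> //; exists delta0, (fun delta => K * delta); split=> //.
- by move=> delta /andP[delta_gt0 _]; exact: mulr_gt0.
- apply: cvg_at_right_filter; rewrite -[X in _ --> X](mulr0 K).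
  by apply: cvgM; [exact: cvg_cst|exact: cvg_id].
move=> delta /andP[delta_gt0]; rewrite !le_min => /andP[/andP[dd dd'] dK].
have etae : K * delta <= e by rewrite mulrC -ler_pdivlMr.
have am' x : cball xs delta x ->
    argmin (bf P x) (Y P x `&` cball ys (K * delta)) = [set y x].
  move=> xd; apply: am => //; first exact: le_trans xd dd.
  have [yx _] := dP x (le_trans xd dd').
  by apply: le_trans yx _; rewrite ler_wpM2l // ltW.
split=> [z zC|x z Pxz xd zd zmin].
  have : argmin (bf P xs) (Y P xs `&` cball ys (K * delta)) ys.
    by rewrite am' ?yxs //= /cball /= subrr enorm0 ltW.
  by move=> [_ /(_ z zC)].
have zE : z = y x by have := zmin; rewrite am'.
move: Pxz; rewrite zE => Pxz; have [_ ux] := dP x (le_trans xd dd').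
by apply: le_trans (ux Pxz); rewrite lerDl mulr_ge0 ?exprn_ge0 // ltW.
Qed.

End Growth.

Theorem theorem4p6 (R : realType) (n m p q r s : nat)
    (P : bilevel R n m p q r s)
    (xs : 'cV[R]_n) (ys : 'cV[R]_m) (mus : 'cV[R]_r) (xis : 'cV[R]_s)
    (smoothP : smooth_around P xs ys)
    (feasU : Phi P (xs, ys))
    (feasL : Y P xs ys)
    (jucP : jacobian_uniqueness P xs ys mus xis) :
  (exists (delta1 eps1 : R) (y : 'cV[R]_n -> 'cV[R]_m)
          (mu : 'cV[R]_n -> 'cV[R]_r) (xi : 'cV[R]_n -> 'cV[R]_s),
     kkt_map P xs ys mus xis delta1 eps1 y mu xi) /\
  (forall (delta1 eps1 : R) (y : 'cV[R]_n -> 'cV[R]_m)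
          (mu : 'cV[R]_n -> 'cV[R]_r) (xi : 'cV[R]_n -> 'cV[R]_s),
     kkt_map P xs ys mus xis delta1 eps1 y mu xi ->
     (SOSC_SP P y xs <-> SOSC_FP P (pack xs ys mus xis)) /\
     (SOSC_SP P y xs \/ SOSC_FP P (pack xs ys mus xis) ->
        (exists delta2 eps2 gamma : R,
           [/\ 0 < delta2 < delta1, 0 < eps2 < eps1, 0 < gamma &
               SP_growth P xs ys y delta2 eps2 gamma]) /\
        bilocal_solution P xs ys)).
Proof.
split; first exact: kkt_map_exists.
move=> delta1 eps1 y mu xi kktP.
have equiv := SOSC_equiv smoothP jucP kktP; split=> // sosc.
have soscP : SOSC_SP P y xs by case: sosc => // /equiv.
split; first exact: (SP_growth_exists smoothP feasU jucP kktP soscP).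
exact: (SOSC_bilocal smoothP feasU jucP kktP soscP).
Qed.
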